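(* Let the copula $C$ of $(U^1,\dots,U^d)$ be differentiable with continuous partial derivatives, and let $f:[0,1]^d\to\mathbb R$ be right-continuous and of bounded variation in the sense of Hardy–Krause. Then $$\frac1{\sqrt n}\sum_{i=1}^n\Big(f\big(F^1_n(U^1_i),\dots,F^d_n(U^d_i)\big)-\mathbb E[f(U^1,\dots,U^d)]\Big)\xrightarrow{d}\int_{[0,1]^d}G_C(u^1,\dots,u^d)\,d\widehat f(u^1,\dots,u^d)$$ as $n\to\infty$, and the limit distribution is Gaussian (centred normal).
   Context: Let $d\ge2$ and $(U^1,\dots,U^d)$ a random vector with uniform marginals on $[0,1]$ and copula $C$; let $(U^1_i,\dots,U^d_i)$, $i\ge1$, be i.i.d. copies, and $F^j_n(u)=\frac1n\sum_{i=1}^n\mathbf 1_{\{U^j_i\le u\}}$. Let $B_C$ be a centred Gaussian field on $[0,1]^d$ with covariance $\mathbb E[B_C(u)B_C(\bar u)]=C(u\wedge\bar u)-C(u)C(\bar u)$ ($\wedge$ = componentwise minimum) and $G_C(u)=B_C(u)-\sum_{j=1}^d\partial_jC(u)B_C(1,\dots,1,u^j,1,\dots,1)$ ($u^j$ in the $j$-th slot). A function $f:[0,1]^d\to\mathbb R$ is right-continuous if $f(u_n)\to f(u)$ whenever each coordinate of $u_n$ decreases to the corresponding coordinate of $u$. Hardy–Krause variation: $V(f)=\sum_{k=1}^d\sum_{1\le i_1<\dots<i_k\le d}V^{(k)}(f;i_1,\dots,i_k)$, where $V^{(k)}(f;i_1,\dots,i_k)$ is the Vitali variation (supremum over partitions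 into subboxes $J$ of $\sum_J|\Delta(f;J)|$, $\Delta(f;J)$ the alternating sum of $f$ over the vertices of $J$) of $f$ restricted to the face $\{u\in[0,1]^d: u_j=1 \text{ for } j\notin\{i_1,\dots,i_k\}\}$; $f$ has bounded Hardy–Krause variation if $V(f)<\infty$. Define $\widehat f(u^1,\dots,u^d)=0$ if $u^j=1$ for at least one $j$, and $\widehat f(u^1,\dots,u^d)=f(u^1,\dots,u^d)$ otherwise. Integrals with respect to $d\widehat f$ are Lebesgue–Stieltjes integrals with respect to the signed measure induced by $\widehat f$. *)

(* Defs.v *)
From HB Require Import structures.
From mathcomp Require Import all_boot all_order all_algebra.
From mathcomp Require Import all_classical all_reals all_analysis.
Set Implicit Arguments. Unset Strict Implicit. Unset Printing Implicit Defensive.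
Import Order.TTheory GRing.Theory Num.Theory.
Import numFieldNormedType.Exports.
Local Open Scope classical_set_scope.
Local Open Scope ring_scope.

Section Defs.
Variables (R : realType) (d : nat).
Local Notation pt := ('rV[R]_d).

Definition cube (u : pt) : Prop := forall j : 'I_d, 0 <= u ord0 j <= 1.

Definition Rd := g_sigma_algebraType (@open pt).

Definition cubeRd : set Rd := cube.

Definition box (a b : pt) : set Rd :=
  [set u : pt | forall j, a ord0 j < u ord0 j <= b ord0 j].

Definition vertex (S T : {set 'I_d}) (a b : pt) : pt :=
  \row_k (if k \in S then (if k \in T then b ord0 k else a ord0 k) else 1).

Definition box_delta (g : pt -> R) (S : {set 'I_d}) (a b : pt) : R :=
  \sum_(T : {set 'I_d} | T \subset S) (-1) ^+ #|S :\: T| * g (vertex S T a b).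

Definition grid_ok (m : nat) (p : 'I_d -> 'I_m.+2 -> R) : Prop :=
  forall k, p k ord0 = 0 /\ p k ord_max = 1 /\
            (forall i j : 'I_m.+2, (i <= j)%N -> p k i <= p k j).

Definition vitali_sum (g : pt -> R) (S : {set 'I_d}) (m : nat)
    (p : 'I_d -> 'I_m.+2 -> R) : R :=
  \sum_(i : {ffun 'I_d -> 'I_m.+1} | [forall k, (k \notin S) ==> (i k == ord0)])
    `| box_delta g S (\row_k p k (inord (i k))) (\row_k p k (inord (i k).+1)) |.

(* bounded Hardy-Krause variation: every Vitali variation V^(k)(g; S),
   S nonempty, is finite (equivalently their finite sum V(g) is finite) *)
Definition bounded_HK (g : pt -> R) : Prop :=
  exists M : R, forall (S : {set 'I_d}) (m : nat) (p : 'I_d -> 'I_m.+2 -> R),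
    S != finset.set0 -> grid_ok p -> vitali_sum g S p <= M.

Definition right_cont_cube (g : pt -> R) : Prop :=
  forall (u : pt) (v : nat -> pt), cube u -> (forall n, cube (v n)) ->
    (forall j, {homo (fun n => v n ord0 j) : m n / (m <= n)%N >-> n <= m}) ->
    (forall j, (fun n => v n ord0 j) @ \oo --> u ord0 j) ->
    (fun n => g (v n)) @ \oo --> g u.

Definition fhat (g : pt -> R) (u : pt) : R :=
  if [exists j, u ord0 j == 1] then 0 else g u.

Definition partial_deriv_cube (C : pt -> R) (j : 'I_d) (u : pt) (D : R) : Prop :=
  (fun h : R => h^-1 * (C (u + h *: delta_mx ord0 j) - C u))
    @ within [set h : R | cube (u + h *: delta_mx ord0 j)] (0 : R)^'
    --> D.

Definition only_coord (u : pt) (j : 'I_d) : pt :=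
  \row_k (if k == j then u ord0 j else 1).

Definition ptmin (u v : pt) : pt := \row_k Num.min (u ord0 k) (v ord0 k).
End Defs.

Definition gauss_law (R : realType) (v : R) : set R -> \bar R :=
  if v == 0 then @dirac _ R 0 R else normal_prob 0 (Num.sqrt v).

Section Prob.
Variables (dO : measure_display) (Omega : measurableType dO) (R : realType).
Variable (P : probability Omega R).

Definition gen_events (I : Type) (X : I -> Omega -> R) : set (set Omega) :=
  <<s (fun A => exists j (B : set R), measurable B /\ A = X j @^-1` B) >>.

Definition independent_vectors (I : Type) (X : nat -> I -> Omega -> R) : Prop :=
  forall (J : seq nat) (A : nat -> set Omega), uniq J ->
    (forall i, i \in J -> gen_events (X i) (A i)) ->
    P (\bigcap_(i in [set` J]) A i) = (\prod_(i <- J) P (A i))%E.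

Definition centred_gaussian_field (d : nat) (B : 'rV[R]_d -> Omega -> R)
    (K : 'rV[R]_d -> 'rV[R]_d -> R) : Prop :=
  (forall u, measurable_fun setT (B u)) /\
  forall (k : nat) (us : 'I_k -> 'rV[R]_d) (c : 'I_k -> R),
    (forall i, cube (us i)) ->
    forall A : set R, measurable A ->
      P [set w | \sum_(i < k) c i * B (us i) w \in A] =
      gauss_law (\sum_(i < k) \sum_(l < k) c i * c l * K (us i) (us l)) A.

Definition cvg_distr (dO' : measure_display) (Omega' : measurableType dO')
    (P' : probability Omega' R) (X : nat -> Omega -> R) (Y : Omega' -> R) : Prop :=
  forall g : R -> R, continuous g -> (exists M, forall x, `|g x| <= M) ->
    (fun n => Rintegral P setT (g \o X n)) @ \oo --> Rintegral P' setT (g \o Y).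
End Prob.

(* Main.v *)
Require Import Defs.
From HB Require Import structures.
From mathcomp Require Import all_boot all_order all_algebra.
From mathcomp Require Import all_classical all_reals all_analysis.
From mathcomp Require Import measurable_realfun.
From mathcomp Require Import ring lra.
Import Order.TTheory GRing.Theory Num.Theory.
Import numFieldNormedType.Exports.
Local Open Scope classical_set_scope.
Local Open Scope ring_scope.
Set Implicit Arguments.
Unset Strict Implicit.
Unset Printing Implicit Defensive.

(* Write [V_i] for the vector of the [F_n^j (U_i^j)], and [mu] for [mu1 - mu2].  Since
   [fhat v = (-1)^d * mu (box v 1)], Fubini turns the statistic into
   [(-1)^d * int sqrt n * (C_n - C) dmu] with [C_n u] the proportion of the [V_i < u]; the
   at most [d] indices [i] with some [V_i^j = 1], where [f] and [fhat] differ, cost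
   [O (1 / sqrt n)].
   Let [alpha] be the empirical process of the sample and [beta u] be
   [alpha u - sum_j dC_j u * alpha (1,..,u_j,..,1)].  If [x = u + s / sqrt n], then almost
   surely [C_n u] differs from the empirical distribution function at [x] by at most
   [sum_j |u_j - F_n^j x_j| + d / n], because the sets [V_i < u] and [U_i <= x] are nested
   in each coordinate; letting [s] run through a fine finite grid gives
   [E |sqrt n * (C_n u - C u) - beta u| --> 0], with no tightness argument.  Fubini again and
   the mean equicontinuity of [beta] replace the integral by a finite combination of orthant
   indicators, for which Trotter's operator method with smooth test functions gives the central
   limit theorem.  The limits of these combinations are the laws of the Riemann sums of
   [int G dmu], whence both the convergence and the normality of the limit; the sign
   [(-1)^d] disappears since centred Gaussian laws are symmetric. *)

(** * Bounded measurable functions *)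

(** The direction [s] for which [F_n^j x_j] meets [u_j] is minus the marginal empirical process at
    [u]. It is random, whereas increments of [alpha] are controlled only between fixed points. This
    is why the error terms of all grid directions are added up: only the choice of the nearest
    direction then depends on the sample. The result is convergence in mean at each fixed [u], which
    is all that dominated convergence under [mu1] and [mu2] asks for. Partial derivatives on a face
    of the cube are one-sided, so a coordinate equal to 0 or 1 is never moved; the marginal process
    vanishes there almost surely. No measurability of [f] is assumed. The ranks lie in a finite
    grid, and on the sample [f] agrees off a null set with a measurable function, the signed mass of
    a box. Test functions with a third-order Taylor bound serve twice: for exchanging sums with
    Gaussian variables and, by way of the logistic function, for recovering bounded continuous
    functions and laws. The variances of the Riemann sums are only shown to be bounded; a cluster
    point supplies the variance of the limit. *)

Section BoundedMeasurable.
Context {d : measure_display} {T : measurableType d} {R : realType}.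

(** Most integrands below are bounded functions on a finite measure space; this class, closed under
    the operations that occur, spares integrability conditions. *)
Definition bmf (X : T -> R) : Prop :=
  measurable_fun setT X /\ exists M, forall w, `|X w| <= M.

Lemma bmf_cst (c : R) : bmf (fun=> c).
Proof. by split=> //; exists `|c|. Qed.

Lemma bmfD (X Y : T -> R) : bmf X -> bmf Y -> bmf (fun w => X w + Y w).
Proof.
move=> [mX [M hM]] [mY [N hN]]; split; first exact: measurable_funD.
by exists (M + N) => w; apply: (le_trans (ler_normD _ _)); exact: lerD.
Qed.

Lemma bmfM (X Y : T -> R) : bmf X -> bmf Y -> bmf (fun w => X w * Y w).
Proof.
move=> [mX [M hM]] [mY [N hN]]; split; first exact: measurable_funM.
by exists (M * N) => w; rewrite normrM ler_pM.
Qed.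

Lemma bmfZ (c : R) (X : T -> R) : bmf X -> bmf (fun w => c * X w).
Proof. by move=> bX; apply: bmfM => //; exact: bmf_cst. Qed.

Lemma bmfN (X : T -> R) : bmf X -> bmf (fun w => - X w).
Proof.
move=> [mX [M hM]]; split; first exact: measurableT_comp.
by exists M => w; rewrite normrN.
Qed.

Lemma bmfB (X Y : T -> R) : bmf X -> bmf Y -> bmf (fun w => X w - Y w).
Proof. by move=> bX bY; apply: bmfD => //; exact: bmfN. Qed.

Lemma bmf_norm (X : T -> R) : bmf X -> bmf (fun w => `|X w|).
Proof.
move=> [mX [M hM]]; split; first exact: measurableT_comp.
by exists M => w; rewrite normr_id.
Qed.

Lemma bmf_sqr (X : T -> R) : bmf X -> bmf (fun w => X w ^+ 2).
Proof. by move=> bX; exact: (bmfM bX bX). Qed.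

Lemma bmf_sum (I : Type) (r : seq I) (Pr : pred I) (X : I -> T -> R) :
  (forall i, Pr i -> bmf (X i)) -> bmf (fun w => \sum_(i <- r | Pr i) X i w).
Proof.
move=> bX; elim: r => [|i r IH].
  rewrite (_ : (fun w => _) = fun=> 0); first exact: bmf_cst.
  by apply/funext => w; rewrite big_nil.
have [Pi|Pi] := boolP (Pr i); last first.
  rewrite (_ : (fun w => _) = fun w => \sum_(j <- r | Pr j) X j w)//.
  by apply/funext => w; rewrite big_cons (negbTE Pi).
rewrite (_ : (fun w => _) = fun w => X i w + \sum_(j <- r | Pr j) X j w).
  by apply: bmfD => //; exact: bX.
by apply/funext => w; rewrite big_cons Pi.
Qed.

Lemma bmf_indic (A : set T) : measurable A -> bmf (\1_A).
Proof.
move=> mA; split; first exact: measurable_indic.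
by exists 1 => w; rewrite indicE ger0_norm ?ler0n// lern1 leq_b1.
Qed.

Lemma bmf_comp (g : R -> R) (X : T -> R) : continuous g ->
  (exists M, forall x, `|g x| <= M) -> measurable_fun setT X ->
  bmf (fun w => g (X w)).
Proof.
move=> cg [M hM] mX; split; last by exists M => w.
by apply: measurableT_comp => //; exact: continuous_measurable_fun.
Qed.

End BoundedMeasurable.

(** * Expectations with respect to a finite measure *)

Section Expectation.
Context {d : measure_display} {T : measurableType d} {R : realType}.
Variable m : {finite_measure set T -> \bar R}.
Implicit Types X Y : T -> R.

Notation E X := (Rintegral m setT X).

Lemma bmf_integrable X : bmf X -> m.-integrable setT (EFin \o X).
Proof.
move=> [mX [M hM]]; apply: measurable_bounded_integrable => //.
  exact: fin_num_fun_lty (fin_num_measure m).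
exists M; split; first by rewrite num_real.
by move=> x Mx w _; apply: (le_trans (hM w)); exact: ltW.
Qed.

Lemma ED X Y : bmf X -> bmf Y -> E (fun w => X w + Y w) = E X + E Y.
Proof. by move=> bX bY; rewrite RintegralD//; exact: bmf_integrable. Qed.

Lemma EB X Y : bmf X -> bmf Y -> E (fun w => X w - Y w) = E X - E Y.
Proof. by move=> bX bY; rewrite RintegralB//; exact: bmf_integrable. Qed.

Lemma EZ c X : bmf X -> E (fun w => c * X w) = c * E X.
Proof. by move=> bX; rewrite RintegralZl//; exact: bmf_integrable. Qed.

Lemma Ecst c : E (fun=> c) = c * fine (m setT).
Proof. by rewrite Rintegral_cst. Qed.

Lemma Esum (I : Type) (r : seq I) (Pr : pred I) (X : I -> T -> R) :
  (forall i, Pr i -> bmf (X i)) ->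
  E (fun w => \sum_(i <- r | Pr i) X i w) = \sum_(i <- r | Pr i) E (X i).
Proof.
move=> bX; elim: r => [|i r IH].
  by under eq_Rintegral do rewrite big_nil; rewrite Ecst mul0r big_nil.
under eq_Rintegral do rewrite big_cons; rewrite big_cons.
case: ifPn => // Pi; rewrite ED ?IH//; first exact: bX.
exact: bmf_sum.
Qed.

Lemma Eindic (A : set T) : measurable A -> E (\1_A) = fine (m A).
Proof. by move=> mA; rewrite /Rintegral integral_indic// setIT. Qed.

Lemma leE X Y : bmf X -> bmf Y -> (forall w, X w <= Y w) -> E X <= E Y.
Proof. by move=> bX bY XY; apply: le_Rintegral => //; exact: bmf_integrable. Qed.

Lemma E_ge0 X : (forall w, 0 <= X w) -> 0 <= E X.
Proof. by move=> X0; exact: Rintegral_ge0. Qed.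

Lemma normE X : bmf X -> `|E X| <= E (fun w => `|X w|).
Proof. by move=> bX; apply: le_normr_Rintegral => //; exact: bmf_integrable. Qed.

(** The measure is finite, so the constant [M] is an integrable majorant. *)
Lemma E_dct (Xn : nat -> T -> R) X M :
  (forall n, measurable_fun setT (Xn n)) -> (forall n w, `|Xn n w| <= M) ->
  (forall w, (fun n => Xn n w) @ \oo --> X w) ->
  bmf X /\ (fun n => E (Xn n)) @ \oo --> E X.
Proof.
move=> mXn hM XnX.
have mX : measurable_fun setT X.
  by apply: (measurable_fun_cvg mXn) => w _; exact: XnX.
have hX w : `|X w| <= M.
  have /cvg_lim <- // : (fun n => `|Xn n w|) @ \oo --> `|X w|.
    by apply: (cvg_norm (XnX w)).
  apply: limr_le; last by apply: nearW => n; exact: hM.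
  by apply/cvg_ex; exists `|X w|; apply: (cvg_norm (XnX w)).
have bX : bmf X by split => //; exists M.
split => //.
have [|||||_ _] := @dominated_convergence _ _ _ m setT measurableT
  (fun n w => (Xn n w)%:E) (fun w => (X w)%:E) (fun=> M%:E).
- by move=> n; exact/measurable_EFinP.
- exact/measurable_EFinP.
- by apply: aeW => w _; apply: cvg_EFin; [exact: nearW|exact: XnX].
- by apply: (bmf_integrable (bmf_cst M)).
- by apply: aeW => w n _ /=; rewrite lee_fin.
have fE Z : bmf Z -> (\int[m]_w (Z w)%:E)%E = (E Z)%:E.
  by move=> bZ; rewrite fineK//; apply: integrable_fin_num => //;
    exact: bmf_integrable.
by rewrite /= fE// => /fine_cvgP[_ h].
Qed.

Lemma E_ae_eq X Y (N : set T) : measurable N -> m N = 0%E -> bmf Y ->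
  (forall w, ~ N w -> X w = Y w) -> bmf X -> E X = E Y.
Proof.
move=> mN N0 bY XY bX; congr fine; apply: ae_eq_integral => //.
- by apply/measurable_EFinP; exact: bX.1.
- by apply/measurable_EFinP; exact: bY.1.
- exists N; split => // w /=; apply: contra_notP => Nw _.
  by rewrite XY.
Qed.

Lemma leE_ae X Y (N : set T) : measurable N -> m N = 0%E -> bmf X -> bmf Y ->
  (forall w, ~ N w -> X w <= Y w) -> E X <= E Y.
Proof.
move=> mN N0 bX bY XY.
(* Multiplication by the indicator of the complement of [N] makes the inequality hold everywhere. *)
have bN : bmf (fun w => \1_(~` N) w : R) by apply: bmf_indic; exact: measurableC.
have NE w : N w -> \1_(~` N) w = 0 :> R.
  by move=> Nw; rewrite indicE memNset//= => /(_ Nw).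
have NE' w : ~ N w -> \1_(~` N) w = 1 :> R by move=> Nw; rewrite indicE mem_set.
rewrite (@E_ae_eq X (fun w => X w * \1_(~` N) w) N)//; last 2 first.
- exact: bmfM.
- by move=> w Nw; rewrite NE'// mulr1.
rewrite (@E_ae_eq Y (fun w => Y w * \1_(~` N) w) N)//; last 2 first.
- exact: bmfM.
- by move=> w Nw; rewrite NE'// mulr1.
apply: leE; [exact: bmfM|exact: bmfM|move=> w].
have [Nw|Nw] := pselect (N w); first by rewrite NE// !mulr0.
by rewrite NE'// !mulr1; exact: XY.
Qed.

End Expectation.

(** * Integrands that are measurable off a null set, and Fubini's theorem *)

Import HBNNSimple.

Section NonmeasurableIntegrand.
Context {d : measure_display} {T : measurableType d} {R : realType}.
Variable m : {measure set T -> \bar R}.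
Local Open Scope ereal_scope.

(* The integrand f need not be measurable: its lower integral ignores the null set N. *)
Lemma ge0_integral_off_null (f g : T -> \bar R) (N : set T) :
  measurable N -> m N = 0 -> (forall x, 0 <= f x) -> (forall x, 0 <= g x) ->
  measurable_fun setT g -> (forall x, ~ N x -> f x = g x) ->
  \int[m]_x f x = \int[m]_x g x.
Proof.
move=> mN N0 f0 g0 mg fg; apply/eqP; rewrite eq_le; apply/andP; split.
  rewrite ge0_integralTE//; apply: ge_ereal_sup => _ /= [h hf <-].
  rewrite -integralT_nnsfun; apply: ae_ge0_le_integral => //.
  - by move=> x _; rewrite lee_fin; exact: fun_ge0.
  - by apply/measurable_EFinP.
  - exists N; split => // x /=; apply: contra_notP => Nx _.
    by rewrite -fg//; exact: hf.
rewrite [leLHS]ge0_integralTE//; apply: ge_ereal_sup => _ /= [h hg <-].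
have mNC : measurable (~` N) by exact: measurableC.
apply: (@le_trans _ _ (sintegral m (proj_nnsfun h mNC))).
  rewrite -!integralT_nnsfun; apply: ae_ge0_le_integral => //.
  - by move=> x _; rewrite lee_fin; exact: fun_ge0.
  - by apply/measurable_EFinP.
  - by move=> x _; rewrite lee_fin; exact: fun_ge0.
  - by apply/measurable_EFinP.
  - exists N; split => // x /=; apply: contra_notP => Nx _.
    rewrite [leRHS](_ : _ = ((h \_ (~` N)) x)%:E).
      by rewrite patchE mem_set.
    by congr EFin; rewrite (mrestrict h mNC).
rewrite [leRHS]ge0_integralTE//; apply: ereal_sup_ubound => /=.
exists (proj_nnsfun h mNC) => // x.
rewrite [X in X%:E](_ : _ = (h \_ (~` N)) x); last by rewrite (mrestrict h mNC).
rewrite patchE; have [Nx|Nx] := pselect (N x).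
  by rewrite memNset//= => /(_ Nx).
by rewrite mem_set// fg//; exact: hg.
Qed.

End NonmeasurableIntegrand.

Section Tonelli.
Context {d1 d2 : measure_display} {T1 : measurableType d1}
  {T2 : measurableType d2} {R : realType}.
Variables (m1 : {finite_measure set T1 -> \bar R})
  (m2 : {finite_measure set T2 -> \bar R}).

(** In contrast to [E_ae_eq], no measurability of [X] is asked for; this is what [f] evaluated at
    the sample requires. *)
Lemma Rintegral_off_null (X Y : T1 -> R) (N : set T1) : measurable N ->
  m1 N = 0%E -> bmf Y -> (forall w, ~ N w -> X w = Y w) ->
  Rintegral m1 setT X = Rintegral m1 setT Y.
Proof.
move=> mN N0 [mY _] XY; congr fine; rewrite integralE [in RHS]integralE.
have mY' : measurable_fun setT (EFin \o Y) by exact/measurable_EFinP.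
congr (_ - _)%E; apply: (@ge0_integral_off_null _ _ _ _ _ _ N) => //.
- exact: measurable_funepos.
- by move=> w Nw; rewrite !funeposE XY.
- exact: measurable_funeneg.
- by move=> w Nw; rewrite !funenegE XY.
Qed.

Lemma bmf_section1 (F : T1 * T2 -> R) (x : T1) : bmf F -> bmf (fun y => F (x, y)).
Proof.
move=> [mF [M hM]]; split; last by exists M => y.
by apply: measurableT_comp mF _; exact: measurable_pair1.
Qed.

Lemma bmf_section2 (F : T1 * T2 -> R) (y : T2) : bmf F -> bmf (fun x => F (x, y)).
Proof.
move=> [mF [M hM]]; split; last by exists M => x.
by apply: measurableT_comp mF _; exact: measurable_pair2.
Qed.

Lemma EFin_E (F : T2 -> R) : bmf F ->
  ((Rintegral m2 setT F)%:E = \int[m2]_y (F y)%:E)%E.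
Proof.
move=> bF; rewrite /Rintegral fineK//; apply: integrable_fin_num => //.
exact: bmf_integrable.
Qed.

Lemma bmf_E (F : T1 * T2 -> R) : bmf F ->
  bmf (fun x => Rintegral m2 setT (fun y => F (x, y))).
Proof.
move=> bF; have [mF [M hM]] := bF; split.
  apply/measurable_EFinP.
  rewrite (_ : _ \o _ = fun x => (\int[m2]_y (F (x, y))%:E)%E); last first.
    by apply/funext => x /=; rewrite EFin_E//; exact: bmf_section1.
  have := @measurable_fubini_F _ _ T1 T2 R m1 m2 (EFin \o F).
  apply.
  apply/integrable12ltyP; first exact/measurable_EFinP.
  apply: (@le_lt_trans _ _ (\int[m1]_x \int[m2]_y M%:E)%E).
    apply: ge0_le_integral => //.
    - by move=> x _; apply: integral_ge0.
    - apply: (measurable_fun_fubini_tonelli_F (fun z => `|(F z)%:E|)%E) => //.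
      apply: measurableT_comp => //.
      exact/measurable_EFinP.

    - move=> x _; apply: ge0_le_integral => //.
      + apply: measurableT_comp => //; apply/measurable_EFinP.
        by have [] := bmf_section1 x bF.
      + by move=> y _; rewrite /= lee_fin; apply: hM.
  have h2 : (\int[m2]_y M%:E)%E \is a fin_num.
    by apply: integrable_fin_num => //; exact: (bmf_integrable _ (bmf_cst M)).
  rewrite -(fineK h2) -ge0_fin_numE.
    by apply: integrable_fin_num => //; exact: (bmf_integrable _ (bmf_cst _)).
  apply: integral_ge0 => x _; rewrite lee_fin; apply: fine_ge0.
  by apply: integral_ge0 => y _; rewrite lee_fin (le_trans _ (hM (x, y))).
exists (M * fine (m2 setT)) => x.
apply: (le_trans (normE _ (bmf_section1 x bF))).
rewrite -(Ecst m2 M); apply: leE => //.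
- exact: (bmf_norm (bmf_section1 x bF)).
- exact: bmf_cst.
Qed.

End Tonelli.

Lemma E_swap {d1 d2 : measure_display} {T1 : measurableType d1}
  {T2 : measurableType d2} {R : realType}
  (m1 : {finite_measure set T1 -> \bar R})
  (m2 : {finite_measure set T2 -> \bar R}) (F : T1 * T2 -> R) : bmf F ->
  Rintegral m1 setT (fun x => Rintegral m2 setT (fun y => F (x, y))) =
  Rintegral m2 setT (fun y => Rintegral m1 setT (fun x => F (x, y))).
Proof.
move=> bF; have [mF [M hM]] := bF.
(* Adding [M'] makes the integrand nonnegative, as Tonelli's theorem wants; the constant contributes
   the same amount to both sides. *)
pose M' := `|M|.
pose K := fun z => F z + M'.
have bK : bmf K by apply: bmfD => //; exact: bmf_cst.
have K0 z : 0 <= K z.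
  by rewrite -lerBlDr sub0r lerNl (le_trans (ler_norm _))// normrN
    (le_trans (hM z))// ler_norm.
have bF1 x := bmf_section1 x bF; have bF2 y := bmf_section2 y bF.
have bK1 x := bmf_section1 x bK; have bK2 y := bmf_section2 y bK.
have bs1 : bmf (fun x => Rintegral m2 setT (fun y => F (x, y))) by exact: bmf_E.
have bG : bmf (fun z : T2 * T1 => F (z.2, z.1)).
  split; last by exists M => z.
  by apply: measurableT_comp mF _; exact: measurable_swap.
have bs2 : bmf (fun y => Rintegral m1 setT (fun x => F (x, y))).
  exact: (@bmf_E _ _ _ _ _ m2 m1 _ bG).
have h1 : Rintegral m1 setT (fun x => Rintegral m2 setT (fun y => K (x, y))) =
  Rintegral m1 setT (fun x => Rintegral m2 setT (fun y => F (x, y))) +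
    M' * fine (m2 setT) * fine (m1 setT).
  rewrite -Ecst -ED//; last exact: bmf_cst.
  by apply: eq_Rintegral => x _; rewrite ED ?Ecst//; exact: bmf_cst.
have h2 : Rintegral m2 setT (fun y => Rintegral m1 setT (fun x => K (x, y))) =
  Rintegral m2 setT (fun y => Rintegral m1 setT (fun x => F (x, y))) +
    M' * fine (m1 setT) * fine (m2 setT).
  rewrite -Ecst -ED//; last exact: bmf_cst.
  by apply: eq_Rintegral => y _; rewrite ED ?Ecst//; exact: bmf_cst.
apply: (addIr (M' * fine (m2 setT) * fine (m1 setT))).
rewrite -h1 -mulrA [fine (m2 _) * _]mulrC mulrA -h2 {1 3}/Rintegral.
congr fine; transitivity (\int[m1]_x \int[m2]_y (K (x, y))%:E)%E.
  by apply: eq_integral => x _; rewrite EFin_E.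
rewrite (@sfinite_Fubini _ _ _ _ _ m1 m2 (EFin \o K))//.
- by apply: eq_integral => y _; rewrite EFin_E.
- by apply/measurable_EFinP; have [] := bK.
Qed.

(** * Smooth test functions *)

Section DerivativeCalculus.
Context {R : realType}.
Implicit Types f g : R -> R.

Definition has_deriv g g' := forall t : R, is_derive t (1 : R) g (g' t).

Lemma has_derivE g g' g'' : (forall t, g' t = g'' t) ->
  has_deriv g g' -> has_deriv g g''.
Proof. by move=> e dg t; rewrite -e; exact: dg. Qed.

Lemma has_deriv_cst c : has_deriv (fun=> c) (fun=> 0).
Proof. by move=> t; exact: is_derive_cst. Qed.

Lemma has_deriv_id : has_deriv (fun t => t) (fun=> 1).
Proof. by move=> t; exact: is_derive_id. Qed.

Lemma has_derivD f f' g g' : has_deriv f f' -> has_deriv g g' ->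
  has_deriv (fun t => f t + g t) (fun t => f' t + g' t).
Proof. by move=> df dg t; exact: (is_deriveD (df t) (dg t)). Qed.

Lemma has_derivN f f' : has_deriv f f' ->
  has_deriv (fun t => - f t) (fun t => - f' t).
Proof. by move=> df t; exact: (is_deriveN (df t)). Qed.

Lemma has_derivB f f' g g' : has_deriv f f' -> has_deriv g g' ->
  has_deriv (fun t => f t - g t) (fun t => f' t - g' t).
Proof. by move=> df dg; apply: has_derivD => //; exact: has_derivN. Qed.

Lemma has_derivM f f' g g' : has_deriv f f' -> has_deriv g g' ->
  has_deriv (fun t => f t * g t) (fun t => f' t * g t + f t * g' t).
Proof.
move=> df dg t; apply: is_derive_eq (is_deriveM (df t) (dg t)) _.
by rewrite /GRing.scale/= addrC mulrC.
Qed.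

Lemma has_deriv_comp f f' g g' : has_deriv f f' -> has_deriv g g' ->
  has_deriv (fun t => f (g t)) (fun t => f' (g t) * g' t).
Proof.
move=> df dg t; apply: is_derive_eq (is_derive1_comp (df (g t)) (dg t)) _.
by rewrite /GRing.scale/=.
Qed.

Lemma has_deriv_shift f f' x : has_deriv f f' ->
  has_deriv (fun t => f (x + t)) (fun t => f' (x + t)).
Proof.
move=> df; apply: has_derivE (has_deriv_comp df
  (has_derivD (has_deriv_cst x) has_deriv_id)) => t.
by rewrite add0r mulr1.
Qed.

Lemma has_deriv_expR : has_deriv expR expR.
Proof. by move=> t; exact: is_derive_expR. Qed.

Lemma has_deriv_continuous g g' : has_deriv g g' -> continuous g.
Proof.
move=> dg t; apply: differentiable_continuous.
by apply/derivable1_diffP; have := dg t => -[].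
Qed.

Lemma mvt_le g g' (K y : R) : has_deriv g g' ->
  (forall t, `|t| <= `|y| -> `|g' t| <= K) -> `|g y - g 0| <= K * `|y|.
Proof.
move=> dg hK; have cg := has_deriv_continuous dg.
have wcg a b : {within `[a, b], continuous g} by exact: continuous_subspaceT.
have [y0|y0] := leP 0 y.
  have [c] := MVT_segment y0 (fun t _ => dg t) (wcg 0 y).
  rewrite in_itv/= => /andP[c0 cy] ->; rewrite subr0 normrM ler_wpM2r// hK//.
  by rewrite !ger0_norm.
have [c] := MVT_segment (ltW y0) (fun t _ => dg t) (wcg y 0).
rewrite in_itv/= => /andP[c0 cy]; rewrite -[X in X <= _]normrN opprB => ->.
rewrite sub0r normrM normrN ler_wpM2r// hK//.
by rewrite !ler0_norm ?lerN2// ltW.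
Qed.

(** Three mean value estimates, climbing from [f2] to [f]. The constant [L] in place of the sharp
    [L / 6] is good enough. *)
Lemma taylor3 f f1 f2 f3 (L x y : R) :
  has_deriv f f1 -> has_deriv f1 f2 -> has_deriv f2 f3 ->
  (forall t, `|t| <= `|y| -> `|f3 (x + t)| <= L) ->
  `|f (x + y) - f x - f1 x * y - f2 x * (y ^+ 2 / 2)| <= L * `|y| ^+ 3.
Proof.
move=> d1 d2 d3 hL.
have L0 : 0 <= L by apply: le_trans (hL 0 _); rewrite ?normr0.
have dZ c g g' : has_deriv g g' -> has_deriv (fun t => c * g t) (fun t => c * g' t).
  move=> dg; apply: has_derivE (has_derivM (has_deriv_cst c) dg) => t.
  by rewrite mul0r add0r.
have b2 t : `|t| <= `|y| -> `|f2 (x + t) - f2 x| <= L * `|y|.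
  move=> ty; have := mvt_le (y := t) (K := L) (has_deriv_shift x d3).
  rewrite addr0 => h; apply: (le_trans (h _)); last by rewrite ler_wpM2l.
  by move=> s st; apply: hL; exact: le_trans ty.
have b1 t : `|t| <= `|y| -> `|f1 (x + t) - f1 x - f2 x * t| <= L * `|y| * `|y|.
  move=> ty; have := mvt_le (y := t) (K := L * `|y|)
    (has_derivB (has_deriv_shift x d2) (dZ (f2 x) _ _ has_deriv_id)).
  rewrite addr0 mulr0 subr0 mulr1 (addrAC (f1 _)) => h; apply: (le_trans (h _)).
    by move=> s st; apply: b2; exact: le_trans ty.
  by rewrite ler_wpM2l// mulr_ge0.
have dsq : has_deriv (fun t : R => t ^+ 2 / 2) (fun t => t).
  apply: has_derivE (has_derivM (has_derivM has_deriv_id has_deriv_id)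
    (has_deriv_cst 2^-1)) => t.
  by field.
have := mvt_le (y := y) (K := L * `|y| * `|y|)
    (has_derivB (has_derivB (has_deriv_shift x d1) (dZ (f1 x) _ _ has_deriv_id))
      (dZ (f2 x) _ _ dsq)).
rewrite addr0 mulr0 subr0 expr0n/= mul0r mulr0 subr0 mulr1.
rewrite (_ : f (x + y) - f1 x * y - _ - f x =
  f (x + y) - f x - f1 x * y - f2 x * (y ^+ 2 / 2)); last by ring.
rewrite (_ : L * `|y| ^+ 3 = L * `|y| * `|y| * `|y|); last by ring.
by apply => t ty; exact: b1.
Qed.

End DerivativeCalculus.

Section SmoothFunctions.
Context {R : realType}.
Implicit Types h : R -> R.

(** Derivatives enter only through the Taylor estimate, with [h1] and [h2] any functions that
    satisfy it. The class is thus stable under sums, multiples and affine changes of variable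
    without differentiating anything. *)
Definition smooth (K L : R) h := [/\ exists M, forall x, `|h x| <= M,
  forall x y, `|h x - h y| <= K * `|x - y| &
  exists h1 h2, (forall x y,
    `|h (x + y) - h x - h1 x * y - h2 x * (y ^+ 2 / 2)| <= L * `|y| ^+ 3) /\
    forall x, `|h2 x| <= K].

Lemma smooth_continuous K L h : smooth K L h -> continuous h.
Proof.
move=> [_ hK _] x; apply/cvgrPdist_le => e e0.
have K1 : 0 < `|K| + 1 by rewrite ltr_wpDl.
near=> y; apply: (le_trans (hK x y)).
apply: (@le_trans _ _ ((`|K| + 1) * `|x - y|)).
  by rewrite ler_wpM2r// (le_trans (ler_norm K))// lerDl.
rewrite mulrC -ler_pdivlMr//; near: y.
by apply: cvgr_dist_le; [exact: cvg_id|rewrite divr_gt0].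
Unshelve. all: by end_near. Qed.

Lemma smoothD K L K' L' h g : smooth K L h -> smooth K' L' g ->
  smooth (K + K') (L + L') (fun x => h x + g x).
Proof.
move=> [[M hM] hK [h1 [h2 [hL h2K]]]] [[M' gM] gK [g1 [g2 [gL g2K]]]]; split.
- by exists (M + M') => x; apply: (le_trans (ler_normD _ _)); exact: lerD.
- move=> x y; rewrite (_ : _ - _ = (h x - h y) + (g x - g y)); last by ring.
  by rewrite mulrDl; apply: (le_trans (ler_normD _ _)); exact: lerD.
- exists (fun x => h1 x + g1 x), (fun x => h2 x + g2 x); split => [x y|x].
    rewrite (_ : _ - _ = (h (x + y) - h x - h1 x * y - h2 x * (y ^+ 2 / 2)) +
      (g (x + y) - g x - g1 x * y - g2 x * (y ^+ 2 / 2))); last by ring.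
    by rewrite mulrDl; apply: (le_trans (ler_normD _ _)); exact: lerD.
  by apply: (le_trans (ler_normD _ _)); exact: lerD.
Qed.

Lemma smoothZ K L h c : smooth K L h -> smooth (`|c| * K) (`|c| * L) (fun x => c * h x).
Proof.
move=> [[M hM] hK [h1 [h2 [hL h2K]]]]; split.
- by exists (`|c| * M) => x; rewrite normrM ler_wpM2l.
- by move=> x y; rewrite -mulrBr normrM -[leRHS]mulrA ler_wpM2l.
- exists (fun x => c * h1 x), (fun x => c * h2 x); split => [x y|x].
    rewrite (_ : _ - _ = c * (h (x + y) - h x - h1 x * y - h2 x * (y ^+ 2 / 2)));
      last by ring.
    by rewrite normrM -[leRHS]mulrA ler_wpM2l.
  by rewrite normrM ler_wpM2l.
Qed.

Lemma smooth_affine K L h a b : smooth K L h ->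
  exists K' L', smooth K' L' (fun x => h (a * x + b)).
Proof.
move=> [[M hM] hK [h1 [h2 [hL h2K]]]].
have K0 : 0 <= K by apply: le_trans (h2K 0).
exists (K * `|a| + K * a ^+ 2), (L * `|a| ^+ 3); split.
- by exists M.
- move=> x y; apply: (le_trans (hK _ _)).
  rewrite (_ : _ - _ = a * (x - y)); last by ring.
  by rewrite normrM mulrA ler_wpM2r// lerDl mulr_ge0// sqr_ge0.
- exists (fun x => h1 (a * x + b) * a), (fun x => h2 (a * x + b) * a ^+ 2).
  split => [x y|x].
    have e : a * (x + y) + b = a * x + b + a * y by ring.
    rewrite e -[leRHS]mulrA -exprMn -normrM; apply: le_trans (hL _ _).
    by rewrite le_eqVlt; apply/orP; left; apply/eqP; congr `|_|; ring.
  rewrite normrM (ger0_norm (sqr_ge0 a)) (@le_trans _ _ (K * a ^+ 2))//.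
    by rewrite ler_wpM2r// sqr_ge0.
  by rewrite lerDr mulr_ge0.
Qed.

Lemma smooth_cst c : smooth 0 0 (fun=> c).
Proof.
split; first by exists `|c|.
  by move=> x y; rewrite subrr normr0 mul0r.
exists (fun=> 0), (fun=> 0); split => [x y|x]; last by rewrite normr0.
by rewrite !mul0r subrr !subr0 normr0.
Qed.

End SmoothFunctions.

Section Logistic.
Context {R : realType}.

Definition logistic (x : R) : R := (1 + expR (- x))^-1.

Lemma logistic_gt0 x : 0 < logistic x.
Proof. by rewrite invr_gt0 ltr_wpDr// expR_ge0. Qed.

Lemma logistic_le1 x : logistic x <= 1.
Proof. by rewrite invf_le1 ?lerDl ?expR_ge0// ltr_wpDr// expR_ge0. Qed.

Lemma logistic_oppE x : 1 - logistic x = expR (- x) * logistic x.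
Proof.
have h : 1 + expR (- x) != 0 by rewrite gt_eqF// ltr_wpDr// expR_ge0.
by rewrite /logistic; field.
Qed.

Lemma logistic_le_expR x : logistic x <= expR x.
Proof.
have h : 0 < 1 + expR (- x) by rewrite ltr_wpDr// expR_ge0.
by rewrite -[leRHS]invrK -expRN lef_pV2 ?posrE ?expR_gt0// lerDr.
Qed.

Lemma logistic_ge_expR x : 1 - logistic x <= expR (- x).
Proof. by rewrite logistic_oppE ler_piMr ?logistic_le1// expR_ge0. Qed.

Lemma logistic_ge_half x : 0 <= x -> 2^-1 <= logistic x.
Proof.
move=> x0; have h : 0 < 1 + expR (- x) by rewrite ltr_wpDr// expR_ge0.
rewrite lef_pV2 ?posrE//.
by rewrite -[leRHS]/(1 + 1) lerD2l -expR0 ler_expR oppr_le0.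
Qed.

Lemma has_deriv_logistic : has_deriv logistic (fun x => logistic x - logistic x * logistic x).
Proof.
move=> x; have h : 1 + expR (- x) != 0 by rewrite gt_eqF// ltr_wpDr// expR_ge0.
have dN : has_deriv (fun t : R => - t) (fun=> - 1) by exact: has_derivN has_deriv_id.
have d := has_derivD (has_deriv_cst 1) (has_deriv_comp has_deriv_expR dN).
have := is_deriveV (f := fun t => 1 + expR (- t)) h (d x).
move=> dd; apply: is_derive_eq dd _; rewrite /GRing.scale/= /logistic.
by field.
Qed.

(** All derivatives of the logistic function are polynomials in it, so its values in [[0, 1]] bound
    them; [8] is a generous bound for the third. *)
Lemma smooth_logistic : smooth 1 8 logistic.
Proof.
pose s := logistic.
pose f1 (x : R) := s x - s x * s x.
pose f2 (x : R) := f1 x - (f1 x * s x + s x * f1 x).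
pose f3 (x : R) := f2 x - ((f2 x * s x + f1 x * f1 x) + (f1 x * f1 x + s x * f2 x)).
have d1 : has_deriv s f1 := has_deriv_logistic.
have d2 : has_deriv f1 f2 := has_derivB d1 (has_derivM d1 d1).
have d3 : has_deriv f2 f3 := has_derivB d2 (has_derivD (has_derivM d2 d1) (has_derivM d1 d2)).
have s0 x : 0 <= s x by exact/ltW/logistic_gt0.
have s1 x : s x <= 1 by exact: logistic_le1.
have b1 x : 0 <= f1 x <= 1.
  by have := s0 x; have := s1 x; rewrite /f1; move: (s x) => a ? ?; nra.
have b2 x : `|f2 x| <= 1.
  have := s0 x; have := s1 x; have := b1 x; rewrite /f2 ler_norml.
  by move: (f1 x) (s x) => a b ? ? ?; nra.
have b3 x : `|f3 x| <= 8.
  have := s0 x; have := s1 x; have := b1 x; have := b2 x; rewrite /f3 !ler_norml.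
  by move: (f1 x) (f2 x) (s x) => a b c ? ? ? ?; nra.
split.
- by exists 1 => x; rewrite ger0_norm.
- move=> x y; have := mvt_le (y := x - y) (K := 1) (has_deriv_shift y d1).
  rewrite [y + (x - y)]addrC subrK addr0; apply => t _; have /andP[b0 b1'] := b1 (y + t).
  by rewrite ger0_norm.
- exists f1, f2; split => // x y; apply: (taylor3 d1 d2 d3) => t _; exact: b3.
Qed.

End Logistic.

(** Heine's theorem. The near-covering form of compactness turns the radii found around each point
    into a single one, valid for all points of [K]. *)
Lemma compact_unif_continuous {R : realType} {T : pseudoMetricType R} (K : set T)
  (f : T -> R) (e : R) : compact K -> {within K, continuous f} -> 0 < e ->
  exists2 r : R, 0 < r & forall x y, K x -> K y -> ball x r y -> `|f x - f y| <= e.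
Proof.
move=> cK cf e0.
have /near_covering_withinP nK : near_covering K by exact/compact_near_coveringP.
pose P (r : R) (y : T) := forall z, K z -> ball y r z -> `|f y - f z| <= e.
have : \forall r \near (0 : R)^'+, K `<=` P r.
  apply: nK => x Kx.
  have /cvgrPdist_le /(_ (e / 2)) := (subspace_continuousP K f).1 cf x Kx.
  rewrite divr_gt0// => /(_ isT); rewrite near_withinE => /nbhs_ballP[r /= r0 hr].
  exists (ball x (r / 2), [set s : R | 0 < s < r / 2]).
    split; first by apply: nbhsx_ballx; rewrite divr_gt0.
    near=> s; apply/andP; split; near: s; first exact: nbhs_right_gt.
    by apply: nbhs_right_lt; rewrite divr_gt0.
  move=> [y s] /= [xy /andP[s0 sr]] Ky z Kz yz.
  have xz : ball x r z.
    rewrite [r]splitr; apply: ball_triangle xy _.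
    by apply: le_ball yz; exact: ltW.
  have xy' : ball x r y by apply: le_ball xy; rewrite ler_pdivrMr// mulr_natr mulr2n lerDl ltW.
  have h1 := hr y xy' Ky; have h2 := hr z xz Kz.
  rewrite (_ : f y - f z = (f x - f z) - (f x - f y)); last by ring.
  by rewrite [e]splitr; apply: (le_trans (ler_normB _ _)); exact: lerD.
move=> h; have : \forall r \near (0 : R)^'+, 0 < r /\ K `<=` P r.
  by apply: filterI => //; exact: nbhs_right_gt.
move=> /filter_ex[r [r0 hr]]; exists r => // x y Kx Ky xy.
exact: hr.
Unshelve. all: by end_near. Qed.

Section SmoothFamily.
Context {R : realType}.
Implicit Types h g : R -> R.

Definition smoothe h := exists K L, smooth K L h.

Lemma smoothe_sum (I : Type) (r : seq I) (c : I -> R) (h : I -> R -> R) :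
  (forall i, smoothe (h i)) -> smoothe (fun x => \sum_(i <- r) c i * h i x).
Proof.
move=> sh; elim: r => [|i r [K [L IH]]].
  rewrite (_ : (fun x => _) = fun=> 0); first by exists 0, 0; exact: smooth_cst.
  by apply/funext => x; rewrite big_nil.
have [K' [L' hi]] := sh i; exists (`|c i| * K' + K), (`|c i| * L' + L).
rewrite (_ : (fun x => _) = fun x => c i * h i x + \sum_(i <- r) c i * h i x).
  by apply: smoothD => //; exact: smoothZ.
by apply/funext => x; rewrite big_cons.
Qed.

Lemma smootheB h g : smoothe h -> smoothe g -> smoothe (fun x => h x - g x).
Proof.
move=> [K [L sh]] [K' [L' sg]]; exists (K + `|-1| * K'), (L + `|-1| * L').
have := smoothD sh (smoothZ (-1) sg); congr smooth.
by apply/funext => x; rewrite mulN1r.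
Qed.

Lemma smoothe_logistic a b : smoothe (fun x => logistic (a * x + b)).
Proof. exact: smooth_affine smooth_logistic. Qed.

Lemma smoothe_cst c : smoothe (fun=> c).
Proof. by exists 0, 0; exact: smooth_cst. Qed.

Lemma smoothe_bmf h : smoothe h -> continuous h /\ exists M, forall x, `|h x| <= M.
Proof.
move=> [K [L sh]]; split; first exact: smooth_continuous sh.
by have [] := sh.
Qed.

(* A partition of unity made of differences of steep logistic functions turns
   sampled values of g into a smooth weighted average of nearby values. *)
Lemma smooth_approx g (M A e : R) : continuous g -> (forall x, `|g x| <= M) ->
  0 < A -> 0 < e ->
  exists2 h, smoothe h & (forall x, `|h x| <= M) /\
    forall x, `|x| <= A -> `|g x - h x| <= e + e.
Proof.
move=> cg gM A0 e0.
have M0 : 0 <= M by apply: le_trans (gM 0).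
have [r r0 hr] := compact_unif_continuous (@segment_compact R (- A) A)
  (continuous_subspaceT cg) e0.
pose N := (Num.truncn (2 * (2 * A) / r)).+1.
have N0 : 0 < N%:R :> R by rewrite ltr0n.
pose dl := 2 * A / N%:R.
have dl0 : 0 < dl by rewrite divr_gt0// mulr_gt0.
have dlr : 2 * dl < r.
  rewrite /dl mulrA ltr_pdivrMr// [ltRHS]mulrC -ltr_pdivrMr//.
  exact: truncnS_gt.
(* The steepness: a weight whose node is farther than [dl] from [x] is at most [exp (- lam * dl)],
   and since [exp t >= 1 + t] the [N + 1] such weights, each with an error up to [2 M], cost at most
   [e]. *)
pose lam := (1 + N%:R) * 2 * M / e / dl.
pose p k := - A + k%:R * dl.
(* The end values 1 and 0 make the weights [tau k - tau k.+1] telescope to exactly 1. *)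
pose tau k x := if k == 0%N then 1 else if k == N.+1 then 0
  else logistic (lam * x + - lam * p k).
have lam0 : 0 <= lam.
  by rewrite /lam; do 2 (apply: divr_ge0; last exact: ltW); rewrite !mulr_ge0// addr_ge0.
have tau_sm k : smoothe (tau k).
  rewrite /tau; case: (k == 0%N); first exact: smoothe_cst.
  by case: (k == N.+1); [exact: smoothe_cst|exact: smoothe_logistic].
have tau01 k x : 0 <= tau k x <= 1.
  rewrite /tau; case: (k == 0%N); first by rewrite ler01 lexx.
  case: (k == N.+1); first by rewrite ler01 lexx.
  by rewrite logistic_le1 ltW ?logistic_gt0.
have pS k : p k.+1 = p k + dl by rewrite /p -natr1; ring.
have tau_dec k x : (k <= N)%N -> 0 <= tau k x - tau k.+1 x.
  move=> kN; rewrite subr_ge0 /tau /= eqSS.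
  have [->|k0] := eqVneq k 0%N.
    exact: logistic_le1.
  have -> : (k == N.+1) = false by apply/negbTE; rewrite ltn_eqF.
  case: ifP => _; first exact/ltW/logistic_gt0.
  rewrite lef_pV2 ?posrE ?ltr_wpDr ?expR_ge0// lerD2l ler_expR lerN2 lerD2l.
  by rewrite !mulNr lerN2 ler_wpM2l// pS lerDl ltW.
pose h x := \sum_(k < N.+1) g (p k) * (tau k x - tau k.+1 x).
have sumw x : \sum_(k < N.+1) (tau k x - tau k.+1 x) = 1.
  rewrite -(big_mkord xpredT (fun k => tau k x - tau k.+1 x)).
  under eq_bigr do rewrite -opprB.
  by rewrite sumrN telescope_sumr// opprB /tau /= eqxx subr0.
exists h; first by apply: smoothe_sum => k; exact: smootheB.
split => [x|x xA].
  apply: (le_trans (ler_norm_sum _ _ _)); rewrite -[leRHS]mulr1 -(sumw x) mulr_sumr.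
  apply: ler_sum => k _; rewrite normrM [X in _ * X]ger0_norm.
    by rewrite ler_wpM2r// tau_dec// -ltnS.
  by rewrite tau_dec// -ltnS.
have [xA1 xA2] : - A <= x /\ x <= A by apply/andP; rewrite -ler_norml.
have pN : p N = A.
  by rewrite /p /dl mulrCA mulfV ?gt_eqF// mulr1; ring.
have pk_in k : (k <= N)%N -> - A <= p k <= A.
  move=> kN; apply/andP; split; first by rewrite /p lerDl mulr_ge0 ?(ltW dl0).
  by rewrite -[leRHS]pN /p lerD2l ler_wpM2r ?(ltW dl0)// ler_nat.
rewrite /h -[g x]mulr1 -(sumw x) mulr_sumr -sumrB.
apply: (le_trans (ler_norm_sum _ _ _)).
have small : expR (- (lam * dl)) * (2 * M) * N.+1%:R <= e.
  have E : lam * dl = (1 + N%:R) * 2 * M / e.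
    by rewrite /lam mulfVK// gt_eqF.
  have h1 := expR_ge1Dx (lam * dl).
  rewrite -mulrA mulrC expRN ler_pdivrMr ?expR_gt0//.
  apply: (@le_trans _ _ (e * (1 + lam * dl))); last by rewrite ler_wpM2l// ltW.
  rewrite (_ : e * _ = 2 * M * N.+1%:R + e); first by rewrite lerDl ltW.
  by rewrite E -natr1; field; rewrite gt_eqF.
apply: (@le_trans _ _ (\sum_(k < N.+1)
  (e * (tau k x - tau k.+1 x) + expR (- (lam * dl)) * (2 * M)))); last first.
  rewrite big_split/= -mulr_sumr sumw mulr1 lerD2l sumr_const card_ord.
  by rewrite -[leLHS]mulr_natr.
apply: ler_sum => k _; rewrite -mulrBl normrM.
have kN : (k <= N)%N by rewrite -ltnS.
rewrite [X in _ * X <= _]ger0_norm ?tau_dec//.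
have w0 := tau_dec k x kN.
have w1 : tau k x - tau k.+1 x <= 1.
  rewrite -(sumw x) (bigD1 k)//= lerDl; apply: sumr_ge0 => j _.
  by rewrite tau_dec// -ltnS.
have far : tau k x - tau k.+1 x <= expR (- (lam * dl)) ->
    `|g x - g (p k)| * (tau k x - tau k.+1 x) <=
    e * (tau k x - tau k.+1 x) + expR (- (lam * dl)) * (2 * M).
  move=> hf; rewrite -[leLHS]add0r lerD ?mulr_ge0 ?(ltW e0)//.
  rewrite mulrC ler_pM//; apply: (le_trans (ler_normB _ _)).
  by rewrite mulr_natl mulr2n lerD.
have [h1|h1] := ltP (x + dl) (p k).
  apply: far; apply: (@le_trans _ _ (tau k x)).
    by rewrite lerBlDr lerDl; have /andP[] := tau01 k.+1 x.
  rewrite /tau; case: ifPn => [/eqP k0|_].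
    by move: h1; rewrite k0 /p mul0r addr0 ltNge (le_trans xA1)// lerDl ltW.
  case: ifPn => _; first exact: expR_ge0.
  apply: (le_trans (logistic_le_expR _)); rewrite ler_expR mulNr -mulrBr -mulrN.
  by rewrite ler_wpM2l//; lra.
have [h2|h2] := ltP (p k.+1) (x - dl).
  apply: far; apply: (@le_trans _ _ (1 - tau k.+1 x)).
    by rewrite lerD2r; have /andP[] := tau01 k x.
  rewrite /tau /= eqSS; case: ifPn => [/eqP kE|_].
    by move: h2; rewrite kE pS pN; lra.
  apply: (le_trans (logistic_ge_expR _)); rewrite ler_expR mulNr -mulrBr -mulrN.
  by rewrite -[leRHS]mulrN ler_wpM2l//; lra.
rewrite -[leLHS]addr0 lerD ?mulr_ge0 ?expR_ge0//.
rewrite ler_wpM2r//; apply: hr; rewrite /= ?in_itv/= ?xA1 ?xA2 ?pk_in//.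
rewrite /ball/= ltr_norml; move: h2; rewrite pS; lra.
Qed.

End SmoothFamily.

Section LogisticTail.
Context {R : realType}.

(** A smooth substitute for the indicator of [|x| >= n]. Being an admissible test function, its
    expectation passes to the limit, and this yields tightness. *)
Definition tail (n : nat) (x : R) : R :=
  logistic (1 * x + - n%:R) + (1 - logistic (1 * x + n%:R)).

Lemma tail_bnd n x : 0 <= tail n x <= 2.
Proof.
have a1 := logistic_le1 (1 * x + - n%:R); have a2 := logistic_le1 (1 * x + n%:R).
have b1 := logistic_gt0 (1 * x + - n%:R); have b2 := logistic_gt0 (1 * x + n%:R).
by rewrite /tail; lra.
Qed.

Lemma tail_ge_half n x : n%:R <= `|x| -> 2^-1 <= tail n x.
Proof.
rewrite /tail mul1r => nx.
have a1 := logistic_le1 (x - n%:R); have a2 := logistic_le1 (x + n%:R).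
have b1 := logistic_gt0 (x - n%:R); have b2 := logistic_gt0 (x + n%:R).
have [x0|x0] := leP 0 x.
  rewrite ger0_norm// in nx.
  have : 2^-1 <= logistic (x - n%:R) by apply: logistic_ge_half; lra.
  by lra.
rewrite ltr0_norm// in nx.
have h1 : 2^-1 <= logistic (- (x + n%:R)) by apply: logistic_ge_half; lra.
have h2 : logistic (- (x + n%:R)) = 1 - logistic (x + n%:R).
  rewrite logistic_oppE /logistic opprK.
  have e : expR (x + n%:R) * expR (- (x + n%:R)) = 1 by rewrite -expRD subrr expR0.
  have p1 := expR_gt0 (x + n%:R); have p2 := expR_gt0 (- (x + n%:R)).
  move: e p1 p2; set a := expR (x + _); set b := expR (- _) => e p1 p2.
  have n1 : 1 + a != 0 by rewrite gt_eqF// addr_gt0.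
  have n2 : 1 + b != 0 by rewrite gt_eqF// addr_gt0.
  apply: (mulIf n1); apply: (mulIf n2); rewrite mulVf// mul1r.
  rewrite mulrAC mulfVK// mulrDr mulr1 mulrC e addrC //.
by lra.
Qed.

Lemma smoothe_tail n : smoothe (tail n).
Proof.
have h1 := smoothe_logistic (R := R) 1 (- n%:R).
have h2 := smootheB (smoothe_logistic (R := R) 1 n%:R) (smoothe_cst 1).
have := smootheB h1 h2; congr smoothe; apply/funext => x.
by rewrite /tail; ring.
Qed.

Lemma expRN_le_harmonic (n : nat) (x : R) : n%:R <= x -> expR (- x) <= harmonic n.
Proof.
move=> nx; rewrite expRN /harmonic lef_pV2 ?posrE ?expR_gt0 ?ltr0n//.
by apply: le_trans (expR_ge1Dx x); rewrite -natr1 addrC lerD2l.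
Qed.

Lemma cvg_tail x : (fun n => tail n x) @ \oo --> (0 : R).
Proof.
have h : \forall n \near \oo, `|x| <= n%:R by exact: nbhs_infty_ger.
have : (fun n => (2 * expR `|x|) * expR (- n%:R) : R) @ \oo --> (0 : R).
  rewrite -[X in _ --> X](mulr0 (2 * expR `|x|)); apply: cvgMr.
  apply: (@squeeze_cvgr _ _ _ _ (fun=> 0) harmonic).
  - by apply: nearW => n; rewrite expR_ge0 expRN_le_harmonic.
  - exact: cvg_cst.
  - exact: cvg_harmonic.
apply: (@squeeze_cvgr _ _ _ _ (fun=> 0)); last exact: cvg_cst.
apply: nearW => n; have /andP[-> _] := tail_bnd n x => /=.
rewrite /tail !mul1r mulrAC -mulrA -expRD mulr2n mulrDl mul1r.
rewrite lerD//.
  apply: (le_trans (logistic_le_expR _)); rewrite ler_expR.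
  by have := ler_norm x; lra.
apply: (le_trans (logistic_ge_expR _)); rewrite ler_expR.
by have := ler_norm (- x); rewrite normrN; lra.
Qed.

End LogisticTail.

(** * Smooth functions determine weak limits and laws *)

Section WeakConvergence.
Context {R : realType} {d d' : measure_display} {T : measurableType d}
  {T' : measurableType d'}.
Variables (P : probability T R) (P' : probability T' R).

(** A single [A] makes the tail of [Y] small; convergence against [tail A] carries this over to
    [X n] for large [n], and inside [[-A, A]] the function [g] is replaced by a smooth one. *)
Lemma weak_of_smooth (X : nat -> T -> R) (Y : T' -> R) :
  (forall n, measurable_fun setT (X n)) -> measurable_fun setT Y ->
  (forall h, smoothe h -> (fun n => Rintegral P setT (h \o X n)) @ \oo -->
    Rintegral P' setT (h \o Y)) ->
  cvg_distr P P' X Y.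
Proof.
move=> mX mY hsm g cg [M gM].
have M0 : 0 <= M by apply: le_trans (gM 0).
apply/cvgrPdist_le => eps eps0.
(* Passing from [g] to [h] costs [2 e + 8 M e] on the side of [X n] and [2 e + 4 M e] on the side of
   [Y]; the convergence for [h] costs [e]. *)
pose e := eps / (5 + 12 * M).
have c0 : 0 < 5 + 12 * M by rewrite ltr_wpDr// mulr_ge0.
have e0 : 0 < e by rewrite divr_gt0.
have bsX h n : smoothe h -> bmf (h \o X n).
  by move=> /smoothe_bmf[ch bh]; exact: (bmf_comp ch bh (mX n)).
have bsY h : smoothe h -> bmf (h \o Y).
  by move=> /smoothe_bmf[ch bh]; exact: (bmf_comp ch bh mY).
have [A A0 tA] : exists2 A, (0 < A)%N & Rintegral P' setT (tail A \o Y) <= e.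
  have [|||_] := @E_dct _ _ _ P' (fun n => tail n \o Y) (fun=> 0) 2.
  - by move=> n; have [] := bsY _ (smoothe_tail n).
  - by move=> n w; have /andP[t0 t2] := tail_bnd n (Y w); rewrite ger0_norm.
  - by move=> w; exact: cvg_tail.
  rewrite Ecst mul0r => /cvgrPdist_le /(_ e e0) h.
  have [n [n0 hn]] : exists n, (0 < n)%N /\ `|0 - Rintegral P' setT (tail n \o Y)| <= e.
    near \oo => n; exists n; split; near: n; last exact: h.
    exact: nbhs_infty_gt.
  by exists n => //; rewrite sub0r normrN in hn; exact: le_trans (ler_norm _) hn.
have A0' : 0 < A%:R :> R by rewrite ltr0n.
have [h sh [hM hA]] := smooth_approx cg gM A0' e0.
have gh x : `|g x - h x| <= 2 * e + 4 * M * tail A x.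
  have /andP[t0 t2] := tail_bnd A x.
  have [xA|xA] := leP `|x| A%:R.
    apply: (le_trans (hA x xA)).
    by rewrite mulr_natl mulr2n lerDl mulr_ge0// mulr_ge0.
  have th := tail_ge_half (ltW xA).
  apply: (le_trans (ler_normB _ _)); apply: (le_trans (lerD (gM x) (hM x))).
  have := ler_wpM2l (mulr_ge0 (ler0n R 4) M0) th.
  by move: (e0); lra.
have PT (Q : probability T R) : fine (Q setT) = 1 by rewrite probability_setT.
have PT' (Q : probability T' R) : fine (Q setT) = 1 by rewrite probability_setT.
have bgX n : bmf (g \o X n) by apply: bmf_comp => //; exists M.
have bgY : bmf (g \o Y) by apply: bmf_comp => //; exists M.
have d1 n : `|Rintegral P setT (g \o X n) - Rintegral P setT (h \o X n)| <=
    2 * e + 4 * M * Rintegral P setT (tail A \o X n).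
  rewrite -EB//; last exact: bsX.
  apply: (le_trans (normE _ (bmfB (bgX n) (bsX _ n sh)))).
  have -> : 2 * e = Rintegral P setT (fun=> 2 * e) by rewrite Ecst PT mulr1.
  rewrite -EZ; last by apply: bsX; exact: smoothe_tail.
  rewrite -ED; [|exact: bmf_cst|by apply: bmfZ; apply: bsX; exact: smoothe_tail].
  apply: leE.
  - by apply: bmf_norm; apply: bmfB => //; exact: bsX.
  - apply: bmfD; first exact: bmf_cst.
    by apply: bmfZ; apply: bsX; exact: smoothe_tail.
  - by move=> w; exact: gh.
have d2 : `|Rintegral P' setT (g \o Y) - Rintegral P' setT (h \o Y)| <=
    2 * e + 4 * M * Rintegral P' setT (tail A \o Y).
  rewrite -EB//; last exact: bsY.
  apply: (le_trans (normE _ (bmfB bgY (bsY _ sh)))).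
  have -> : 2 * e = Rintegral P' setT (fun=> 2 * e) by rewrite Ecst PT' mulr1.
  rewrite -EZ; last by apply: bsY; exact: smoothe_tail.
  rewrite -ED; [|exact: bmf_cst|by apply: bmfZ; apply: bsY; exact: smoothe_tail].
  apply: leE.
  - by apply: bmf_norm; apply: bmfB => //; exact: bsY.
  - apply: bmfD; first exact: bmf_cst.
    by apply: bmfZ; apply: bsY; exact: smoothe_tail.
  - by move=> w; exact: gh.
have /cvgrPdist_le /(_ e e0) n1 := hsm _ sh.
have /cvgrPdist_le /(_ e e0) n2 := hsm _ (smoothe_tail A).
near=> n.
have k1 : `|Rintegral P' setT (h \o Y) - Rintegral P setT (h \o X n)| <= e.
  by near: n.
have k2 : `|Rintegral P' setT (tail A \o Y) - Rintegral P setT (tail A \o X n)| <= e.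
  by near: n.
have k3 := d1 n.
have k4 : Rintegral P setT (tail A \o X n) <= e + e.
  by move: k2; rewrite ler_norml => /andP[k2 _]; lra.
have Mk4 := ler_wpM2l (mulr_ge0 (ler0n R 4) M0) k4.
have MtA := ler_wpM2l (mulr_ge0 (ler0n R 4) M0) tA.
have E : eps = 5 * e + 12 * (M * e).
  by rewrite /e; field; rewrite gt_eqF.
rewrite E; move: k1 k3 d2; rewrite !ler_norml => /andP[? ?] /andP[? ?] /andP[? ?].
apply/andP; split; nra.
Unshelve. all: by end_near. Qed.

Lemma E_law (Y : T -> R) (nu : {finite_measure set R -> \bar R}) (h : R -> R) :
  measurable_fun setT Y ->
  (forall A, measurable A -> P (Y @^-1` A) = nu A) -> bmf h ->
  Rintegral P setT (h \o Y) = Rintegral nu setT h.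
Proof.
move=> mY hlaw bh; congr fine.
have ih := bmf_integrable nu bh.
transitivity (\int[pushforward P Y]_x (h x)%:E)%E; last first.
  by apply: eq_measure_integral => A mA _; exact: hlaw.
rewrite integral_pushforward//.
- by apply/measurable_EFinP; exact: bh.1.
- rewrite preimage_setT; apply: (bmf_integrable P (X := h \o Y)).
  split; first by apply: measurableT_comp mY; exact: bh.1.
  by have [_ [M hM]] := bh; exists M => w; exact: hM.
Qed.

(** Open rays are stable under intersection and generate the Borel sets, and their indicators are
    bounded pointwise limits of smooth functions. *)
Lemma law_of_smooth (Y : T -> R) (nu : {finite_measure set R -> \bar R}) :
  measurable_fun setT Y ->
  (forall h, smoothe h -> Rintegral P setT (h \o Y) = Rintegral nu setT h) ->
  forall A, measurable A -> P (Y @^-1` A) = nu A.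
Proof.
move=> mY hsm.
(* The argument is [n^2 (y - a) - n]: at most [- n] for [y <= a], and tending to infinity for
   [y > a]. The limit is thus 0 at [a] itself. *)
pose k a n (y : R) := logistic (n%:R * n%:R * y + - (n%:R * n%:R * a + n%:R)).
have sk a n : smoothe (k a n) by exact: smoothe_logistic.
have kb a n y : `|k a n y| <= 1.
  by rewrite ger0_norm ?logistic_le1// ltW ?logistic_gt0.
have kcv a y : (fun n => k a n y) @ \oo --> (\1_(`]a, +oo[%classic) y : R).
  have [ya|ya] := ltP a y.
    rewrite indicE mem_set; last by rewrite /= in_itv/= andbT.
    apply/cvgrPdist_le => eps eps0.
    have h1 : \forall n \near \oo, 2 / (y - a) <= n%:R by exact: nbhs_infty_ger.
    have /cvgrPdist_le /(_ eps eps0) h2 := @cvg_harmonic R.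
    near=> n.
    have n1 : 2 / (y - a) <= n%:R by near: n.
    have : `|0 - harmonic n| <= eps by near: n.
    rewrite sub0r normrN ger0_norm ?harmonic_ge0// => n2.
    have := logistic_ge_expR (n%:R * n%:R * y + - (n%:R * n%:R * a + n%:R)) => n3.
    rewrite ger0_norm ?subr_ge0 ?logistic_le1//.
    apply: (le_trans n3); apply: le_trans n2; apply: expRN_le_harmonic.
    rewrite ler_pdivrMr ?subr_gt0// in n1.
    by have := ler_wpM2l (ler0n R n) n1; lra.
  rewrite indicE memNset; last by rewrite /= in_itv/= andbT; apply/negP; rewrite -leNgt.
  apply: (@squeeze_cvgr _ _ _ _ (fun=> 0) harmonic); last 2 first.
  - exact: cvg_cst.
  - exact: cvg_harmonic.
  apply: nearW => n; rewrite ltW ?logistic_gt0//=.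
  apply: (le_trans (logistic_le_expR _)).
  rewrite -[X in expR X]opprK; apply: expRN_le_harmonic.
  by have := ler_wpM2l (mulr_ge0 (ler0n R n) (ler0n R n)) ya; lra.
have mYm B : measurable B -> measurable (Y @^-1` B).
  by move=> mB; rewrite -[X in measurable X]setTI; exact: mY.
move=> A mA; pose m0 := (pushforward P Y : {measure set R -> \bar R}); pose m1 := m0 mY.
rewrite -[LHS]/(m1 A).
apply: (measure_unique (@RGenOInfty.G R)
  (fun n => `](- n%:R), +oo[%classic)) => //.
- exact: RGenOInfty.measurableE.
- move=> _ _ [x ->] [y ->]; exists (Num.max x y).
  apply/seteqP; split => z /=; rewrite !in_itv/= !andbT gt_max.
    by move=> [-> ->].
  by move=> /andP[].
- by move=> n; eexists.
- apply/seteqP; split => // z _; exists (Num.truncn `|z|).+1 => //=.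
  rewrite in_itv/= andbT ltrNl (le_lt_trans _ (truncnS_gt `|z|))//.
  by rewrite -normrN ler_norm.
- move=> _ [a ->].
  have mI : measurable `]a, +oo[%classic by exact: measurable_itv.
  have [|||_ c1] := @E_dct _ _ _ P (fun n => k a n \o Y) (\1_(`]a, +oo[%classic) \o Y) 1.
  + move=> n; have [ck _] := smoothe_bmf (sk a n).
    by apply: measurableT_comp => //; exact: continuous_measurable_fun.
  + by move=> n w; exact: kb.
  + by move=> w; exact: kcv.
  have [|||_ c2] := @E_dct _ _ _ nu (k a) (\1_(`]a, +oo[%classic)) 1.
  + by move=> n; have [ck _] := smoothe_bmf (sk a n); exact: continuous_measurable_fun.
  + by move=> n w; exact: kb.
  + by move=> w; exact: kcv.
  have : Rintegral P setT (\1_(`]a, +oo[%classic) \o Y) = Rintegral nu setT (\1_(`]a, +oo[%classic)).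
    apply: cvg_unique c2; first exact: Rhausdorff.
    by move: c1; under eq_fun do rewrite hsm//.
  have -> : Rintegral P setT (\1_(`]a, +oo[%classic) \o Y) =
      Rintegral P setT (\1_(Y @^-1` `]a, +oo[%classic)).
    by apply: eq_Rintegral => w _; rewrite /= !indicE; congr (_%:R); rewrite !inE.
  have mYI : measurable (Y @^-1` `]a, +oo[%classic) by exact: mYm.
  rewrite !Eindic//.
  move=> h; have := congr1 EFin h.
  by rewrite !fineK ?fin_num_measure//; exact: mYm.
- move=> n; rewrite /m1 /m0 /= /pushforward.
  by apply: (le_lt_trans (probability_le1 _ _)); rewrite ?ltry//; exact: mYm.
Unshelve. all: by end_near. Qed.

End WeakConvergence.

(** * Gaussian convolution *)

Section NormalIntegrals.
Context {R : realType}.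
Implicit Types (s m : R).
Notation mu := (@lebesgue_measure R).

Lemma normal_integral m s (f : R -> \bar R) : s != 0 -> (forall x, (0 <= f x)%E) ->
  measurable_fun setT f ->
  (\int[normal_prob m s]_x f x = \int[mu]_x (f x * (normal_pdf m s x)%:E))%E.
Proof.
move=> s0 f0 mf.
have dom := @normal_prob_dominates R m s.
rewrite -(Radon_Nikodym_SigmaFinite.change_of_variables dom)//.
apply: ae_eq_integral => //.
- apply: emeasurable_funM => //.
  exact: measurable_int (Radon_Nikodym_SigmaFinite.f_integrable dom).
- apply: emeasurable_funM => //; apply/measurable_EFinP.
  exact: measurable_normal_pdf.
- apply: ae_eqe_mul2l; apply: integral_ae_eq => //.
  + exact: Radon_Nikodym_SigmaFinite.f_integrable.
  + by apply/measurable_EFinP; exact: measurable_normal_pdf.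
  + by move=> A _ mA; rewrite -Radon_Nikodym_SigmaFinite.f_integral.
Qed.

Lemma integral_translate (a : R) (G : R -> R) : continuous G -> (forall x, 0 <= G x) ->
  (\int[mu]_x (G x)%:E = \int[mu]_x (G (x + a))%:E)%E.
Proof.
move=> cG G0.
have F'E : (fun x : R => x + a)^`()%classic = cst 1.
  by apply/funext => x; rewrite derive1E; apply: derive_val; exact: is_derive_shift.
rewrite (@increasing_ge0_integration_by_substitutionT R (fun x => x + a))//.
- by apply: eq_integral => x _; rewrite F'E /= mulr1.
- by move=> x y xy; rewrite ltrD2r.
- by rewrite F'E; exact: cst_continuous.
- by rewrite F'E; exact: is_cvg_cst.
- by rewrite F'E; exact: is_cvg_cst.
- exact: cvg_addrr_Ny.
- exact: cvg_addrr.
Qed.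

Lemma normal_pdf_gt0E m s x : 0 < s -> normal_pdf m s x =
  s^-1 * normal_peak 1 * expR (- (x - m) ^+ 2 / (s ^+ 2 * 2)).
Proof.
move=> s0; rewrite normal_pdfE ?gt_eqF// /normal_fun mulr_natr; congr (_ * _).
rewrite /normal_peak expr1n mul1r -mulrnAr sqrtrM ?sqr_ge0//.
by rewrite sqrtr_sqr gtr0_norm// invfM.
Qed.

(** Completing the square in [z]: a joint density is rewritten as the marginal density of [y] times
    the conditional density of [z] given [y]. *)
Lemma normal_pdf_conv s t y z : 0 < s -> 0 < t ->
  let r := Num.sqrt (s ^+ 2 + t ^+ 2) in
  normal_pdf z s y * normal_pdf 0 t z =
  normal_pdf 0 r y * normal_pdf (y * t ^+ 2 / r ^+ 2) (s * t / r) z.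
Proof.
move=> s0 t0 r.
have r0 : 0 < r by rewrite sqrtr_gt0 ltr_wpDr ?sqr_ge0// exprn_gt0.
have r2 : r ^+ 2 = s ^+ 2 + t ^+ 2 by rewrite sqr_sqrtr// addr_ge0 ?sqr_ge0.
rewrite !normal_pdf_gt0E// ?divr_gt0 ?mulr_gt0//.
rewrite mulrACA -expRD [RHS]mulrACA -expRD; congr (_ * expR _).
  by field; rewrite !gt_eqF.
have rn : s ^+ 2 + t ^+ 2 != 0 by rewrite -r2 gt_eqF// exprn_gt0.
rewrite exprMn exprVn exprMn r2.
by field; rewrite rn !gt_eqF.
Qed.

(** Exponential tilting moves the mean and keeps the variance; the moment generating function is the
    factor in front. *)
Lemma normal_pdf_tilt s l y : 0 < s ->
  expR (l * y) * normal_pdf 0 s y =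
  expR (l ^+ 2 * s ^+ 2 / 2) * normal_pdf (l * s ^+ 2) s y.
Proof.
move=> s0; rewrite !normal_pdf_gt0E//.
rewrite mulrCA [RHS]mulrCA -!expRD; congr (_ * expR _).
by field; rewrite gt_eqF.
Qed.

Lemma normal_mgf s l : 0 < s ->
  (\int[normal_prob 0 s]_y (expR (l * y))%:E = (expR (l ^+ 2 * s ^+ 2 / 2))%:E)%E.
Proof.
move=> s0; rewrite normal_integral ?gt_eqF//; last first.
  apply/measurable_EFinP; apply: measurableT_comp => //.
under eq_integral do rewrite -EFinM normal_pdf_tilt// EFinM.
rewrite ge0_integralZl//; first by rewrite integral_normal_pdf mule1.
- by apply/measurable_EFinP; exact: measurable_normal_pdf.
- by move=> y _; rewrite lee_fin normal_pdf_ge0.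
Qed.

Lemma normal_expR_integrable s l : 0 < s ->
  (normal_prob 0 s).-integrable setT (fun y => (expR (l * y))%:E).
Proof.
move=> s0; apply/integrableP; split.
  by apply/measurable_EFinP; apply: measurableT_comp.
under eq_integral do rewrite /= ger0_norm ?expR_ge0//.
by rewrite normal_mgf// ltry.
Qed.

End NormalIntegrals.

Section GaussianOperator.
Context {R : realType}.
Implicit Types (v w : R) (h : R -> R).
Notation mu := (@lebesgue_measure R).

Definition gauss_prob v : probability (measurableTypeR R) R :=
  if v == 0 then (@dirac _ (measurableTypeR R) 0 R : probability _ R)
  else (normal_prob 0 (Num.sqrt v) : probability _ R).

Lemma gauss_lawE v (A : set R) : gauss_law v A = gauss_prob v A.
Proof. by rewrite /gauss_law /gauss_prob; case: ifP. Qed.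

(** The heat semigroup, indexed by the variance so that indices add. The Dirac case of [gauss_prob]
    makes [v = 0] the identity on continuous functions. *)
Definition gaussT v h (x : R) : R :=
  Rintegral (gauss_prob v) setT (fun y => h (x + y)).

Lemma measurable_addl (x : R) :
  measurable_fun [set: measurableTypeR R] (fun y : measurableTypeR R => x + y : measurableTypeR R).
Proof. by apply: measurable_funD. Qed.

Lemma gaussT0 h x : continuous h -> gaussT 0 h x = h x.
Proof.
move=> ch; rewrite /gaussT /gauss_prob eqxx /Rintegral integral_dirac//.
  by rewrite diracT mul1e /= addr0.
apply/measurable_EFinP; apply: measurableT_comp => //.
  exact: continuous_measurable_fun.
exact: measurable_addl.
Qed.

(** After Tonelli, for which [K] is nonnegative, [normal_pdf_conv] factors the product of densities
    and the conditional density integrates to 1. *)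
Lemma normal_conv (s t : R) (K : R -> R) (x : R) : 0 < s -> 0 < t -> continuous K ->
  (forall y, 0 <= K y) ->
  (\int[normal_prob 0 t]_z \int[normal_prob 0 s]_y (K (x + z + y))%:E =
   \int[normal_prob 0 (Num.sqrt (s ^+ 2 + t ^+ 2))]_y (K (x + y))%:E)%E.
Proof.
move=> s0 t0 cK K0; set r := Num.sqrt _.
have r0 : 0 < r by rewrite sqrtr_gt0 ltr_wpDr ?sqr_ge0// exprn_gt0.
have mK : measurable_fun setT K by exact: continuous_measurable_fun.
have mKx a : measurable_fun [set: measurableTypeR R] (fun y : measurableTypeR R => (K (a + y))%:E).
  by apply/measurable_EFinP; apply: measurableT_comp (measurable_addl a).
have p0 m q y : 0 <= normal_pdf m q y by exact: normal_pdf_ge0.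
have inner z : (\int[normal_prob 0 s]_y (K (x + z + y))%:E =
    \int[mu]_y (K (x + y) * normal_pdf z s y)%:E)%E.
  rewrite normal_integral ?gt_eqF//; last exact: mKx.
  (* The shift is moved from the argument of [K] to the mean of the density, so that [K] does not
     depend on [z] any more. *)
  rewrite [RHS](integral_translate z).
  - apply: eq_integral => y _; rewrite -EFinM (addrC y) addrA; congr (_ * _)%:E.
    by rewrite !normal_pdf_gt0E// subr0 (addrC z) addrK.
  - move=> y; apply: cvgM.
      apply: (@continuous_comp _ _ _ (fun y => x + y) K); last exact: cK.
      by apply: cvgD; [exact: cvg_cst|exact: cvg_id].
    by apply: continuous_normal_pdf; rewrite gt_eqF.
  - by move=> y; apply: mulr_ge0; [exact: K0|exact: p0].
  - by move=> y; rewrite lee_fin; exact: K0.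
have mF : measurable_fun setT (fun zy : R * R =>
    (K (x + zy.2) * (normal_pdf zy.1 s zy.2 * normal_pdf 0 t zy.1))%:E).
  apply/measurable_EFinP; apply: measurable_funM.
    apply: measurableT_comp mK _; apply: measurable_funD => //.
  apply: measurable_funM.
    under eq_fun do rewrite normal_pdf_gt0E//.
    apply: measurable_funM => //; apply: measurableT_comp => //.
    apply: measurable_funM => //; apply: measurableT_comp => //.
    by apply: measurable_funX; apply: measurable_funB.
  by apply: measurableT_comp (measurable_normal_pdf 0 t) _.
under eq_integral do rewrite inner.
have inner0 z : (0 <= \int[mu]_y (K (x + y) * normal_pdf z s y)%:E)%E.
  by apply: integral_ge0 => y _; rewrite lee_fin; apply: mulr_ge0; [exact: K0|exact: p0].
have innerm : measurable_fun setT
    (fun z : measurableTypeR R => \int[mu]_y (K (x + y) * normal_pdf z s y)%:E)%E.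
  have := @measurable_fun_fubini_tonelli_F _ _ (measurableTypeR R) (measurableTypeR R) R mu
    (fun zy : R * R => (K (x + zy.2) * normal_pdf zy.1 s zy.2)%:E).
  rewrite /fubini_F; apply.
    apply/measurable_EFinP; apply: measurable_funM.
      by apply: measurableT_comp mK _; apply: measurable_funD.
    under eq_fun do rewrite normal_pdf_gt0E//.
    apply: measurable_funM => //; apply: measurableT_comp => //.
    apply: measurable_funM => //; apply: measurableT_comp => //.
    by apply: measurable_funX; apply: measurable_funB.
  by move=> zy; rewrite lee_fin; apply: mulr_ge0; [exact: K0|exact: p0].
rewrite (normal_integral 0 _ inner0 innerm) ?gt_eqF//.
transitivity (\int[mu]_z \int[mu]_y
  (K (x + y) * (normal_pdf z s y * normal_pdf 0 t z))%:E)%E.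
  apply: eq_integral => z _; rewrite -ge0_integralZr//.
  - by apply: eq_integral => y _; rewrite -EFinM mulrA.
  - apply/measurable_EFinP; apply: measurable_funM; last exact: measurable_normal_pdf.
    exact: measurableT_comp mK (measurable_addl x).
  - by move=> y _; rewrite lee_fin; apply: mulr_ge0; [exact: K0|exact: p0].
  - by rewrite lee_fin; exact: p0.
transitivity (\int[mu]_y \int[mu]_z
  (K (x + y) * (normal_pdf z s y * normal_pdf 0 t z))%:E)%E.
  apply: (@fubini_tonelli _ _ (measurableTypeR R) (measurableTypeR R) R mu mu
    (fun zy : R * R => (K (x + zy.2) * (normal_pdf zy.1 s zy.2 * normal_pdf 0 t zy.1))%:E)).
    exact: mF.
  by move=> zy; rewrite lee_fin; apply: mulr_ge0; [exact: K0|apply: mulr_ge0; exact: p0].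
rewrite normal_integral ?gt_eqF//; last 2 first.
- by move=> y; rewrite lee_fin; exact: K0.
- exact: mKx.
apply: eq_integral => y _.
under eq_integral do rewrite normal_pdf_conv// -/r mulrA EFinM.
rewrite ge0_integralZl//.
- by rewrite integral_normal_pdf mule1 EFinM.
- by apply/measurable_EFinP; exact: measurable_normal_pdf.
- by move=> z _; rewrite lee_fin; exact: p0.
- by rewrite lee_fin; apply: mulr_ge0; [exact: K0|exact: p0].
Qed.
End GaussianOperator.

(** Comparison of coefficients without differentiation: divide by [l] and let [l] decrease to 0,
    twice. It serves to read moments off a generating function. *)
Lemma quadratic_small {R : realType} (a b C : R) :
  (forall l, 0 < l -> l <= 1 -> `|l * a + l ^+ 2 * b| <= C * l ^+ 3) -> a = 0 /\ b = 0.
Proof.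
move=> h.
have C0 : 0 <= C.
  by have := h 1 ltr01 (lexx 1); rewrite !expr1n mulr1; apply: le_trans.
have h1 l : 0 < l -> l <= 1 -> `|a + l * b| <= C * l ^+ 2.
  move=> l0 l1; have := h l l0 l1.
  rewrite (_ : l * a + l ^+ 2 * b = l * (a + l * b)); last by ring.
  rewrite (_ : C * l ^+ 3 = l * (C * l ^+ 2)); last by ring.
  by rewrite normrM gtr0_norm// ler_pM2l.
have small (x D : R) : 0 <= D -> (forall l, 0 < l -> l <= 1 -> `|x| <= D * l) -> x = 0.
  move=> D0 hx; apply/eqP; rewrite -normr_le0; apply/ler_addgt0Pr => e e0.
  rewrite add0r; have D1 : 0 < D + 1 by rewrite ltr_wpDl.
  have l0 : 0 < Num.min 1 (e / (D + 1)) by rewrite lt_min ltr01 divr_gt0.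
  apply: (le_trans (hx _ l0 _)); first by rewrite ge_min lexx.
  apply: (@le_trans _ _ ((D + 1) * (e / (D + 1)))); last by rewrite mulrC divfK// gt_eqF.
  apply: ler_pM => //; first exact: ltW.
    by rewrite lerDl.
  by rewrite ge_min lexx orbT.
have a0 : a = 0.
  apply: (small a (C + `|b|)); first by rewrite addr_ge0.
  move=> l l0 l1; have := h1 l l0 l1 => hl.
  rewrite (_ : a = (a + l * b) - l * b); last by ring.
  apply: (le_trans (ler_normB _ _)); rewrite mulrDl lerD//.
    by apply: (le_trans hl); rewrite ler_wpM2l// expr2 ler_piMl// ltW.
  by rewrite normrM gtr0_norm// mulrC.
split => //; apply: (small b C) => // l l0 l1.
have := h1 l l0 l1; rewrite a0 add0r normrM gtr0_norm// expr2 mulrA mulrC.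
by rewrite ler_pM2r.
Qed.

(** * Moments of the normal law from its moment generating function *)

Section NormalMoments.
Context {R : realType}.
Variable s : R.
Hypothesis s0 : 0 < s.
Let N : probability (measurableTypeR R) R := normal_prob 0 s.
Notation E X := (Rintegral N setT X).
Notation intb f := (N.-integrable setT (EFin \o f)).

(** A majorant of [exp (2 |y / s|)] with explicit expectation [exp 2 + exp 2]. One factor
    [exp |y / s|] absorbs powers of [y / s], the other a Taylor remainder of the exponential. *)
Let b (y : R) : R := expR (2 / s * y) + expR (- 2 / s * y).

Let b_int : intb b.
Proof.
rewrite (_ : _ \o _ = (fun y => (expR (2 / s * y))%:E + (expR (- 2 / s * y))%:E)%E)//.
by apply: integrableD => //; exact: normal_expR_integrable.
Qed.

Lemma normal_expR_E (l : R) : E (fun y => expR (l / s * y)) = expR (l ^+ 2 / 2).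
Proof.
rewrite /Rintegral normal_mgf//; congr expR.
by field; rewrite gt_eqF.
Qed.

Let bE : E b = expR 2 + expR 2.
Proof.
rewrite RintegralD//; [|exact: normal_expR_integrable..].
by rewrite !normal_expR_E; congr (expR _ + expR _); field.
Qed.

Let b_ge (y : R) : expR (2 * `|y / s|) <= b y.
Proof.
rewrite /b; have [y0|y0] := leP 0 (y / s).
  by rewrite ger0_norm// (_ : 2 / s * y = 2 * (y / s)) ?lerDl ?expR_ge0//; ring.
rewrite ltr0_norm// (_ : - 2 / s * y = 2 * - (y / s)) ?lerDr ?expR_ge0//.
by rewrite mulNr mulNr mulrN mulrAC mulrA.
Qed.

(** The constant comes from expanding [(1 + |z| / 3)^3 <= exp |z|], whose cubic term is
    [|z|^3 / 27]. *)
Let pow_le (z : R) : [/\ `|z| <= 27 * expR `|z|, z ^+ 2 <= 27 * expR `|z| &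
   `|z| ^+ 3 <= 27 * expR `|z|].
Proof.
have h : (1 + `|z| / 3) ^+ 3 <= expR `|z|.
  rewrite (_ : expR `|z| = expR (`|z| / 3) ^+ 3).
    by rewrite lerXn2r ?nnegrE ?expR_ge0 ?addr_ge0 ?divr_ge0// expR_ge1Dx.
  by rewrite -expRM_natl; congr expR; field.
rewrite -real_normK ?num_real//.
have : 0 <= `|z| by []; move: h; set e := expR _; set a := `|z| => h a0.
have a2 : 0 <= a ^+ 2 by rewrite sqr_ge0.
have a3 : 0 <= a ^+ 3 by rewrite exprn_ge0.
have {h} : 1 + a + a ^+ 2 / 3 + a ^+ 3 / 27 <= e.
  by apply: le_trans h; rewrite le_eqVlt; apply/orP; left; apply/eqP; field.
by split; lra.
Qed.

Let exp_le (y : R) : expR `|y / s| <= b y.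
Proof.
apply: le_trans (b_ge y); rewrite ler_expR mulrDl.
by rewrite mul1r lerDl.
Qed.

Let dom_int (f : measurableTypeR R -> R) C : measurable_fun setT f ->
  (forall y, `|f y| <= C * b y) -> intb f.
Proof.
move=> mf hf.
apply: (@le_integrable _ _ _ N _ measurableT (EFin \o f) (fun y => C%:E * (b y)%:E)%E).
- exact/measurable_EFinP.
- move=> y _ /=; rewrite lee_fin; apply: (le_trans (hf y)); exact: ler_norm.
- exact: integrableZl.
Qed.

Let m_div : measurable_fun setT (fun y : measurableTypeR R => y / s : R).
Proof. exact: measurable_funM. Qed.

Let int1 : intb (fun y => y / s).
Proof.
apply: (dom_int (C := 27) m_div) => y; have [h _ _] := pow_le (y / s).
by apply: (le_trans h); rewrite ler_wpM2l.
Qed.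

Let int2 : intb (fun y => (y / s) ^+ 2).
Proof.
apply: (dom_int (C := 27)); first exact: measurable_funX.
move=> y; have [_ h _] := pow_le (y / s); rewrite ger0_norm ?sqr_ge0//.
by apply: (le_trans h); rewrite ler_wpM2l.
Qed.

Let int3 : intb (fun y => `|y / s| ^+ 3).
Proof.
apply: (dom_int (C := 27)).
  by apply: measurable_funX; apply: measurableT_comp.
move=> y; have [_ _ h] := pow_le (y / s); rewrite ger0_norm ?exprn_ge0//.
by apply: (le_trans h); rewrite ler_wpM2l.
Qed.

Let int_cst (c : R) : intb (fun=> c).
Proof. exact: (bmf_integrable N (bmf_cst c)). Qed.

Let E_cst (c : R) : E (fun=> c) = c.
Proof.
transitivity (c * fine (N setT)); first exact: Ecst.
by rewrite probability_setT mulr1.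
Qed.

Let exp_taylor (x : R) : `|expR x - 1 - x - x ^+ 2 / 2| <= expR `|x| * `|x| ^+ 3.
Proof.
have d := @has_deriv_expR R.
have := taylor3 (L := expR `|x|) (x := 0) (y := x) d d d.
rewrite add0r expR0 !mul1r; apply => t tx; rewrite add0r ger0_norm ?expR_ge0//.
by rewrite ler_expR (le_trans (ler_norm t)).
Qed.

(** The generating function of [y / s] at [l] is [exp (l^2 / 2)]. Expanding both sides to second
    order leaves two cubic remainders, whose constants add up to [C], and [quadratic_small]
    concludes. *)
Lemma normal_moments : E (fun y => y / s) = 0 /\ E (fun y => (y / s) ^+ 2) = 1.
Proof.
set m1 := E _; set m2 := E _.
pose C : R := 27 * (expR 2 + expR 2) + (1 + expR 1).
have [h1 h2] : m1 = 0 /\ (m2 - 1) / 2 = 0.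
  apply: (@quadratic_small R m1 ((m2 - 1) / 2) C) => l l0 l1.
  have key : `|expR (l ^+ 2 / 2) - 1 - l * m1 - l ^+ 2 * (m2 / 2)| <=
      27 * (expR 2 + expR 2) * l ^+ 3.
    have il1 : intb (fun y => l * (y / s)) by exact: (integrableZl measurableT l int1).
    have il2 : intb (fun y => l ^+ 2 / 2 * (y / s) ^+ 2) by exact: (integrableZl measurableT _ int2).
    have ie : intb (fun y => expR (l / s * y)) by exact: normal_expR_integrable.
    have ie1 : intb (fun y => expR (l / s * y) - 1) by exact: (integrableB _ ie (int_cst 1)).
    have ie2 : intb (fun y => expR (l / s * y) - 1 - l * (y / s)).
      by exact: (integrableB _ ie1 il1).
    have ie3 : intb (fun y => expR (l / s * y) - 1 - l * (y / s) - l ^+ 2 / 2 * (y / s) ^+ 2).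
      by exact: (integrableB _ ie2 il2).
    have -> : expR (l ^+ 2 / 2) - 1 - l * m1 - l ^+ 2 * (m2 / 2) =
        E (fun y => expR (l / s * y) - 1 - l * (y / s) - l ^+ 2 / 2 * (y / s) ^+ 2).
      rewrite RintegralB// RintegralB// RintegralB// normal_expR_E E_cst.
      by rewrite RintegralZl// RintegralZl// -/m1 -/m2; field.
    apply: (le_trans (le_normr_Rintegral _ ie3)) => //.
    rewrite (_ : _ * l ^+ 3 = 27 * l ^+ 3 * E b); last by rewrite bE; ring.
    rewrite -RintegralZl//; apply: le_Rintegral => //.
    - by apply: (integrable_norm ie3).
    - exact: (integrableZl measurableT _ b_int).
    move=> y _; rewrite (_ : expR _ - 1 - _ - _ = expR (l * (y / s)) - 1 -
       l * (y / s) - (l * (y / s)) ^+ 2 / 2); last first.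
      by rewrite (_ : l / s * y = l * (y / s)); [field; rewrite gt_eqF|ring].
    apply: (le_trans (exp_taylor _)); rewrite normrM gtr0_norm// exprMn.
    have [_ _ h] := pow_le (y / s).
    have e1 : expR (l * `|y / s|) <= expR `|y / s| by rewrite ler_expR ler_piMl.
    have e2 := b_ge y; rewrite mulr2n mulrDl mul1r expRD in e2.
    rewrite (_ : expR _ * _ = l ^+ 3 * (expR (l * `|y / s|) * `|y / s| ^+ 3)); last by ring.
    rewrite (_ : 27 * l ^+ 3 * b y = l ^+ 3 * (27 * b y)); last by ring.
    rewrite ler_wpM2l ?exprn_ge0 ?(ltW l0)//.
    apply: (le_trans (ler_pM _ _ e1 h)); rewrite ?expR_ge0 ?exprn_ge0//.
    by rewrite mulrCA ler_wpM2l.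
  have e0 : `|expR (l ^+ 2 / 2) - 1 - l ^+ 2 / 2| <= (1 + expR 1) * l ^+ 3.
    have p0 : 0 <= l ^+ 2 / 2 by rewrite divr_ge0// sqr_ge0.
    have := exp_taylor (l ^+ 2 / 2); rewrite (ger0_norm p0) => h.
    have l2 : l ^+ 2 <= 1 by rewrite expr_le1// ltW.
    have l3 : 0 <= l ^+ 3 by rewrite exprn_ge0// ltW.
    have l31 : l ^+ 3 <= 1 by rewrite expr_le1// ltW.
    have l43 : l ^+ 4 <= l ^+ 3 by rewrite ler_wiXn2l// ltW.
    have ee : expR (l ^+ 2 / 2) <= expR 1 by rewrite ler_expR; lra.
    have x3 : (l ^+ 2 / 2) ^+ 3 <= l ^+ 3.
      rewrite (_ : (l ^+ 2 / 2) ^+ 3 = l ^+ 3 * (l ^+ 3 / 8)); last by field.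
      by rewrite ler_piMr//; lra.
    have x4 : (l ^+ 2 / 2) ^+ 2 / 2 <= l ^+ 3.
      rewrite (_ : (l ^+ 2 / 2) ^+ 2 / 2 = l ^+ 4 / 8); last by field.
      by lra.
    have x5 : 0 <= (l ^+ 2 / 2) ^+ 2 / 2 by rewrite divr_ge0// sqr_ge0.
    have h' : expR (l ^+ 2 / 2) * (l ^+ 2 / 2) ^+ 3 <= expR 1 * l ^+ 3.
      by apply: ler_pM => //; rewrite ?expR_ge0 ?exprn_ge0.
    have {}h := le_trans h h'.
    by move: h; rewrite !ler_norml mulrDl mul1r => /andP[? ?]; apply/andP; split; lra.
  rewrite (_ : l * m1 + l ^+ 2 * ((m2 - 1) / 2) =
    (expR (l ^+ 2 / 2) - 1 - l ^+ 2 / 2) -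
    (expR (l ^+ 2 / 2) - 1 - l * m1 - l ^+ 2 * (m2 / 2))); last by field.
  rewrite /C [leRHS]mulrDl [leRHS]addrC.
  by apply: (le_trans (ler_normB _ _)); apply: lerD.
by split => //; lra.
Qed.

Lemma normal_third_moment : E (fun y => `|y / s| ^+ 3) <= 27 * (expR 2 + expR 2).
Proof.
rewrite -bE -RintegralZl//; apply: le_Rintegral => //.
  exact: (integrableZl measurableT _ b_int).
move=> y _; have [_ _ h] := pow_le (y / s).
by apply: (le_trans h); rewrite ler_wpM2l.
Qed.

Lemma normal_taylor (h : R -> R) (h1 h2 L x : R) : bmf (h : measurableTypeR R -> R) ->
  (forall y, `|h (x + y) - h x - h1 * y - h2 * (y ^+ 2 / 2)| <= L * `|y| ^+ 3) ->
  `|E (fun y => h (x + y)) - h x - h2 * (s ^+ 2 / 2)| <=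
  L * (27 * (expR 2 + expR 2)) * s ^+ 3.
Proof.
move=> bh hL.
have L0 : 0 <= L.
  by have := hL 1; rewrite normr1 !expr1n !mulr1; apply: le_trans.
have bhx : bmf (fun y : measurableTypeR R => h (x + y)).
  have [mh [M hM]] := bh; split; last by exists M => y.
  by apply: measurableT_comp mh _; exact: measurable_addl.
have [e1 e2] := normal_moments.
have ih : intb (fun y => h (x + y)) by exact: bmf_integrable.
have i1 : intb (fun y => h (x + y) - h x) by exact: (integrableB _ ih (int_cst (h x))).
have il1 : intb (fun y => h1 * s * (y / s)) by exact: (integrableZl measurableT _ int1).
have il2 : intb (fun y => h2 * s ^+ 2 / 2 * (y / s) ^+ 2).
  by exact: (integrableZl measurableT _ int2).
have i2 : intb (fun y => h (x + y) - h x - h1 * s * (y / s)) by exact: (integrableB _ i1 il1).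
have i3 : intb (fun y => h (x + y) - h x - h1 * s * (y / s) - h2 * s ^+ 2 / 2 * (y / s) ^+ 2).
  by exact: (integrableB _ i2 il2).
have -> : E (fun y => h (x + y)) - h x - h2 * (s ^+ 2 / 2) = E (fun y =>
    h (x + y) - h x - h1 * s * (y / s) - h2 * s ^+ 2 / 2 * (y / s) ^+ 2).
  rewrite RintegralB// RintegralB// RintegralB// E_cst !RintegralZl// e1 e2.
  by field.
apply: (le_trans (le_normr_Rintegral _ i3)) => //.
apply: (@le_trans _ _ (L * s ^+ 3 * E (fun y => `|y / s| ^+ 3))); last first.
  by rewrite [leRHS]mulrAC ler_wpM2l ?normal_third_moment// mulr_ge0// exprn_ge0// ltW.
rewrite -RintegralZl//; apply: le_Rintegral => //.
- exact: (integrable_norm i3).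
- exact: (integrableZl measurableT _ int3).
move=> y _; have := hL y; congr (`|_| <= _).
  by field; rewrite gt_eqF.
by rewrite normrM normfV (gtr0_norm s0); field; rewrite gt_eqF.
Qed.

End NormalMoments.

(** * The Gaussian semigroup *)

Section GaussianSemigroup.
Context {R : realType}.
Implicit Types (v w : R) (h : R -> R).
Local Notation RR := (measurableTypeR R).

Definition cbnd h := continuous h /\ exists M, forall x, `|h x| <= M.

Lemma cbnd_bmf h : cbnd h -> bmf (h : RR -> R).
Proof.
by move=> [ch bh]; split => //; exact: continuous_measurable_fun.
Qed.

Lemma bmf_translate h x : bmf (h : RR -> R) -> bmf (fun y : RR => h (x + y)).
Proof.
move=> [mh [M hM]]; split; last by exists M => y.
by apply: measurableT_comp mh _; exact: measurable_addl.
Qed.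

Lemma gauss_prob_fine v : fine (gauss_prob v setT) = 1.
Proof. by rewrite probability_setT. Qed.

Lemma gaussT_bmf v h : bmf (h : RR -> R) -> bmf (gaussT v h : RR -> R).
Proof.
move=> [mh [M hM]].
apply: (@bmf_E _ _ RR RR R (gauss_prob v) (gauss_prob v) (fun xy => h (xy.1 + xy.2))).
split; last by exists M => xy.
by apply: measurableT_comp mh _; exact: measurable_funD.
Qed.

Lemma gaussT_contract v h g e x : bmf (h : RR -> R) -> bmf (g : RR -> R) ->
  (forall y, `|h y - g y| <= e) -> `|gaussT v h x - gaussT v g x| <= e.
Proof.
move=> bh bg hg; have bhx := bmf_translate x bh; have bgx := bmf_translate x bg.
rewrite /gaussT -EB//; apply: (le_trans (normE _ (bmfB bhx bgx))).
have -> : e = Rintegral (gauss_prob v) setT (fun=> e).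
  by rewrite Ecst gauss_prob_fine mulr1.
apply: leE; [exact: bmf_norm (bmfB bhx bgx)|exact: bmf_cst|].
by move=> y; exact: hg.
Qed.

Lemma gaussT_sum v (I : finType) (p z : I -> R) h x : bmf (h : RR -> R) ->
  gaussT v (fun y => \sum_i p i * h (y + z i)) x = \sum_i p i * gaussT v h (x + z i).
Proof.
move=> bh; rewrite /gaussT Esum; last first.
  move=> i _; apply: bmfZ.
  have := bmf_translate (x + z i) bh; congr bmf; apply/funext => y.
  by rewrite addrAC.
apply: eq_bigr => i _; rewrite -EZ; last exact: bmf_translate.
by apply: eq_Rintegral => y _; rewrite addrAC.
Qed.

Lemma gaussT_normal v h x : v != 0 -> gaussT v h x =
  fine (\int[normal_prob 0 (Num.sqrt v)]_y (h (x + y))%:E)%E.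
Proof. by move=> v0; rewrite /gaussT /gauss_prob (negbTE v0). Qed.

Lemma gaussT_normal_EFin v h x : v != 0 -> bmf (h : RR -> R) -> ((gaussT v h x)%:E =
  \int[normal_prob 0 (Num.sqrt v)]_y (h (x + y))%:E)%E.
Proof.
move=> v0 bh; rewrite /gaussT EFin_E; last exact: bmf_translate.
by rewrite /gauss_prob (negbTE v0).
Qed.

Lemma gaussT_semigroup v w h x : 0 <= v -> 0 <= w -> cbnd h ->
  gaussT v (gaussT w h) x = gaussT (v + w) h x.
Proof.
move=> v0 w0 [ch [M hM]].
have bh : bmf (h : RR -> R) by apply: cbnd_bmf; split => //; exists M.
move: v0; rewrite le_eqVlt => /predU1P[<-|v0].
  rewrite add0r /gaussT /gauss_prob eqxx /Rintegral integral_dirac//.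
    by rewrite diracT mul1e /= addr0.
  apply/measurable_EFinP; have [m _] := bmf_translate x (gaussT_bmf w bh).
  exact: m.
move: w0; rewrite le_eqVlt => /predU1P[<-|w0].
  rewrite addr0; congr gaussT; apply/funext => y; exact: gaussT0.
(* [normal_conv] is about nonnegative functions, and [gaussT] commutes with the addition of a
   constant. *)
pose K (y : R) := h y + M.
have K0 y : 0 <= K y by have := hM y; rewrite ler_norml /K => /andP[? _]; lra.
have cK : continuous K by move=> y; apply: cvgD; [exact: ch|exact: cvg_cst].
have bK : bmf (K : RR -> R) by apply: bmfD => //; exact: bmf_cst.
have TK u y : gaussT u K y = gaussT u h y + M.
  rewrite /gaussT /K ED; [|exact: bmf_translate|exact: bmf_cst].
  by rewrite Ecst gauss_prob_fine mulr1.
have TTK : gaussT v (gaussT w K) x = gaussT v (gaussT w h) x + M.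
  rewrite -[in RHS](mulr1 M) -(gauss_prob_fine v) -Ecst /gaussT -ED; last 2 first.
  - exact: bmf_translate (gaussT_bmf w bh).
  - exact: bmf_cst.
  by apply: eq_Rintegral => y _; rewrite -/(gaussT w K _) TK.
suff E : gaussT v (gaussT w K) x = gaussT (v + w) K x.
  by apply: (addIr M); move: E; rewrite TTK TK.
have vw0 : 0 < v + w by exact: addr_gt0.
rewrite (gaussT_normal _ _ (lt0r_neq0 v0)) (gaussT_normal K _ (lt0r_neq0 vw0)).
have -> : v + w = Num.sqrt w ^+ 2 + Num.sqrt v ^+ 2.
  by rewrite !sqr_sqrtr 1?addrC// ltW.
have sw0 : 0 < Num.sqrt w by rewrite sqrtr_gt0.
have sv0 : 0 < Num.sqrt v by rewrite sqrtr_gt0.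
apply: etrans (congr1 fine (normal_conv x sw0 sv0 cK K0)).
apply: (congr1 fine); apply: eq_integral => y _.
exact: gaussT_normal_EFin (lt0r_neq0 w0) bK.
Qed.

Definition gauss_cst : R := 27 * (expR 2 + expR 2).

(** Half the second derivative is the generator of the semigroup: the first-order term drops as the
    law is centred, and the remainder is of the order of the third absolute moment. *)
Lemma gauss_taylor v h (c1 c2 L x : R) : 0 <= v -> cbnd h ->
  (forall y, `|h (x + y) - h x - c1 * y - c2 * (y ^+ 2 / 2)| <= L * `|y| ^+ 3) ->
  `|gaussT v h x - h x - c2 * (v / 2)| <= L * gauss_cst * Num.sqrt v ^+ 3.
Proof.
move=> v0 ch hL; have bh := cbnd_bmf ch.
move: v0; rewrite le_eqVlt => /predU1P[<-|v0].
  rewrite gaussT0; last by have [] := ch.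
  by rewrite subrr mul0r mulr0 subr0 normr0 sqrtr0 expr0n mulr0.
have s0 : 0 < Num.sqrt v by rewrite sqrtr_gt0.
have := normal_taylor s0 bh hL.
rewrite (sqr_sqrtr (ltW v0)) -/gauss_cst => h0.
by rewrite (gaussT_normal h x (lt0r_neq0 v0)).
Qed.

End GaussianSemigroup.

(** * A central limit theorem by the operator method *)

Section BlockIndependence.
Context {dO : measure_display} {Omega : measurableType dO} {R : realType}.
Variable P : probability Omega R.
Variables (J : Type) (U : nat -> J -> Omega -> R).
Hypothesis Umeas : forall i j, measurable_fun setT (U i j).
Hypothesis Uind : independent_vectors P U.
Variables (I : finType) (A : nat -> I -> set Omega).
Hypothesis genA : forall i p, gen_events (U i) (A i p).
Variables (a m : I -> R).

Notation E X := (Rintegral P setT X).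

Lemma gen_events_measurable i (D : set Omega) : gen_events (U i) D -> measurable D.
Proof.
move: D; apply: smallest_sub; first exact: sigma_algebra_measurable.
move=> _ [j [B [mB ->]]]; rewrite -[X in measurable X]setTI; exact: Umeas.
Qed.

(** [xi i] depends on [w] only through the set of events that occur. Expectations of its functions
    are thus finite sums, and independence is needed for events only. *)
Definition pattern (i : nat) (w : Omega) : {set I} := [set p | w \in A i p]%SET.

Definition pattern_set i (b : {set I}) : set Omega := [set w | pattern i w = b].

Lemma pattern_set_gen i b : gen_events (U i) (pattern_set i b).
Proof.
pose G := (fun A => exists j (B : set R), measurable B /\ A = U i j @^-1` B).
have mA p : @measurable _ (g_sigma_algebraType G) (A i p) by exact: genA.
have -> : pattern_set i b = \big[setI/setT]_(p : I) (if p \in b then A i p else ~` A i p).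
  apply/seteqP; split => w /=.
    move=> <-; rewrite -bigcap_seq => p _ /=.
    by rewrite inE; case: ifPn => [/set_mem//|/negP h]; rewrite /= => /mem_set.
  rewrite -bigcap_seq => h; apply/setP => p; rewrite inE.
  have := h p (mem_index_enum p) => /=; case: ifPn => pb; first by move/mem_set.
  by move=> Aw; apply/negbTE/negP => /set_mem.
apply: (@bigsetI_measurable _ (g_sigma_algebraType G)) => p _.
by case: ifP => _; [exact: mA|apply: measurableC; exact: mA].
Qed.

Lemma pattern_set_measurable i b : measurable (pattern_set i b).
Proof. exact: gen_events_measurable (@pattern_set_gen i b). Qed.

Definition xi (i : nat) (w : Omega) : R := \sum_p a p * (\1_(A i p) w - m p).

Definition xi_val (b : {set I}) : R := \sum_p a p * ((p \in b)%:R - m p).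

Lemma xiE i w : xi i w = xi_val (pattern i w).
Proof. by apply: eq_bigr => p _; rewrite inE indicE. Qed.

Lemma bmf_xi i : bmf (xi i).
Proof.
apply: bmf_sum => p _.
exact: (bmfZ (a p) (bmfB (bmf_indic (gen_events_measurable (@genA i p))) (bmf_cst (m p)))).
Qed.

Lemma E_pattern i (F : R -> R) : 
  E (fun w => F (xi i w)) = \sum_b fine (P (pattern_set i b)) * F (xi_val b).
Proof.
transitivity (E (fun w => \sum_b F (xi_val b) * \1_(pattern_set i b) w)).
  apply: eq_Rintegral => w _; rewrite (bigD1 (pattern i w))//= indicE mem_set// mulr1.
  rewrite big1 ?addr0 -?xiE// => b bw; rewrite indicE memNset ?mulr0//.
  by move=> /esym/eqP; rewrite (negbTE bw).
have mp b := pattern_set_measurable i b.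
rewrite Esum; last by move=> b _; apply: bmfZ; exact: bmf_indic.
apply: eq_bigr => b _; rewrite EZ; last exact: bmf_indic.
by rewrite Eindic// mulrC.
Qed.

Definition block_event (s : seq nat) (D : nat -> set Omega) := \bigcap_(i in [set` s]) D i.

Lemma block_event_measurable s D : (forall i, i \in s -> gen_events (U i) (D i)) ->
  measurable (block_event s D).
Proof.
move=> gD; rewrite /block_event bigcap_seq.
rewrite big_seq; apply: bigsetI_measurable => i si.
exact: gen_events_measurable (gD i si).
Qed.

(** Independence is applied to the indices [i :: s] and again to [s], which lets the factor of [i]
    split off. The second claim presents the intersection as a block event again, ready for an
    induction. *)
Lemma block_event_cons s D i b : i \notin s -> uniq s ->
  (forall k, k \in s -> gen_events (U k) (D k)) ->
  fine (P (pattern_set i b `&` block_event s D)) =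
  fine (P (pattern_set i b)) * fine (P (block_event s D)) /\
  pattern_set i b `&` block_event s D =
  block_event (i :: s) (fun k => if k == i then pattern_set i b else D k).
Proof.
move=> iNs us gD.
pose D' k := if k == i then pattern_set i b else D k.
have eB : block_event s D' = block_event s D.
  apply: eq_bigcapr => k /= ks; rewrite /D'; case: eqP => // ki.
  by move: iNs; rewrite -ki ks.
have eq1 : pattern_set i b `&` block_event s D = block_event (i :: s) D'.
  by rewrite -eB /block_event !bigcap_seq big_cons {2}/D' eqxx.
split => //; rewrite eq1 /block_event Uind/=; last 2 first.
- by rewrite iNs us.
- move=> k; rewrite inE /D'; case: eqP => [-> _|_ /= ks]; first exact: pattern_set_gen.
  exact: gD.
rewrite big_cons {1}/D' eqxx fineM//; last 2 first.
- by rewrite fin_num_measure//; exact: pattern_set_measurable.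
- rewrite big_seq; apply: (big_ind (fun x : \bar R => x \is a fin_num)) => //.
    by move=> x y; exact: fin_numM.
  move=> k ks; rewrite fin_num_measure//; apply: (@gen_events_measurable k).
  by rewrite /D'; case: eqP => [->|_]; [exact: pattern_set_gen|exact: gD].
congr (_ * fine _); rewrite -Uind//.
  by congr (P _); exact: eB.
move=> k ks; rewrite /D'; case: eqP => [ki|_]; last exact: gD.
by move: iNs; rewrite -ki ks.
Qed.

End BlockIndependence.

(** * Trotter's exchange argument *)

Section CentralLimit.
Context {dO : measure_display} {Omega : measurableType dO} {R : realType}.
Variable P : probability Omega R.
Variables (J : Type) (U : nat -> J -> Omega -> R).
Hypothesis Umeas : forall i j, measurable_fun setT (U i j).
Hypothesis Uind : independent_vectors P U.
Variables (I : finType) (A : nat -> I -> set Omega).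
Hypothesis genA : forall i p, gen_events (U i) (A i p).
Variables (a m : I -> R) (v : R).
Hypothesis mE : forall i p, fine (P (A i p)) = m p.
Notation E X := (Rintegral P setT X).
Local Notation xi := (xi A a m).
Hypothesis varE : forall i, E (fun w => xi i w ^+ 2) = v.

Let PT : fine (P setT) = 1. Proof. by rewrite probability_setT. Qed.

Let bxi i : bmf (xi i). Proof. exact: (bmf_xi Umeas genA). Qed.

Lemma E_xi i : E (xi i) = 0.
Proof.
have mA p := gen_events_measurable Umeas (@genA i p).
have bI p := bmf_indic (R := R) (mA p).
rewrite Esum; last by move=> p _; apply: (bmfZ (a p) (bmfB (bI p) (bmf_cst (m p)))).
rewrite big1// => p _; rewrite EZ; last exact: bmfB (bI p) (bmf_cst (m p)).
rewrite EB//; last exact: bmf_cst.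
by rewrite Eindic// Ecst PT mulr1 mE subrr mulr0.
Qed.

Definition xi_bound : R := \sum_p `|a p| * (1 + `|m p|).

Lemma xi_le i w : `|xi i w| <= xi_bound.
Proof.
apply: (le_trans (ler_norm_sum _ _ _)); apply: ler_sum => p _.
rewrite normrM ler_wpM2l//; apply: (le_trans (ler_normB _ _)); rewrite lerD2r.
by rewrite indicE ger0_norm ?ler0n// lern1 leq_b1.
Qed.

Definition partial_xi (k : nat) (w : Omega) : R := \sum_(i < k) xi i w.

Section Step.
Variables (h h1 h2 : R -> R) (L c : R).
Hypothesis ch : cbnd h.
Hypothesis hL : forall x y,
  `|h (x + y) - h x - h1 x * y - h2 x * (y ^+ 2 / 2)| <= L * `|y| ^+ 3.
Hypothesis c0 : 0 <= c.

Let u := c ^+ 2 * v.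
Let rho := L * (c * xi_bound) ^+ 3 + L * gauss_cst * Num.sqrt u ^+ 3.

Let v0 : 0 <= v.
Proof. by rewrite -(varE 0); apply: E_ge0 => w; exact: sqr_ge0. Qed.

Let u0 : 0 <= u. Proof. by rewrite mulr_ge0 ?sqr_ge0. Qed.

Let L0 : 0 <= L.
Proof. by have := hL 0 1; rewrite normr1 !expr1n !mulr1; apply: le_trans. Qed.

(** Both averages have the same expansion up to second order, since [c * xi i] is centred with
    variance [u]; [rho] collects the two third-order remainders. *)
Lemma one_step i y : `|E (fun w => h (y + c * xi i w)) - gaussT u h y| <= rho.
Proof.
have bh : bmf (fun w => h (y + c * xi i w)).
  have [cch bh] := ch.
  apply: (bmf_comp cch bh (X := fun w => y + c * xi i w)).
  by have [] := bmfD (bmf_cst y) (bmfZ c (bxi i)).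
have b1 : bmf (fun w => h1 y * c * xi i w) by exact: bmfZ.
have b2 : bmf (fun w => h2 y * c ^+ 2 / 2 * xi i w ^+ 2) by apply: bmfZ; exact: bmf_sqr.
have b0 : bmf (fun w => h (y + c * xi i w) - h y) by apply: bmfB => //; exact: bmf_cst.
have b01 : bmf (fun w => h (y + c * xi i w) - h y - h1 y * c * xi i w) by exact: bmfB.
have e1 : `|E (fun w => h (y + c * xi i w)) - h y - h2 y * (u / 2)| <= L * (c * xi_bound) ^+ 3.
  have -> : E (fun w => h (y + c * xi i w)) - h y - h2 y * (u / 2) =
    E (fun w => h (y + c * xi i w) - h y - h1 y * c * xi i w - h2 y * c ^+ 2 / 2 * xi i w ^+ 2).
    rewrite EB// EB// EB//; last exact: bmf_cst.
    by rewrite Ecst PT EZ// E_xi EZ ?varE /u; [field|exact: bmf_sqr].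
  apply: (le_trans (normE _ (bmfB b01 b2))).
  have -> : L * (c * xi_bound) ^+ 3 = E (fun=> L * (c * xi_bound) ^+ 3).
    by rewrite Ecst PT mulr1.
  apply: leE.
  - exact: bmf_norm (bmfB b01 b2).
  - exact: bmf_cst.
  move=> w; have := hL y (c * xi i w).
  rewrite (_ : h1 y * (c * _) = h1 y * c * xi i w); last by ring.
  rewrite (_ : h2 y * ((c * _) ^+ 2 / 2) = h2 y * c ^+ 2 / 2 * xi i w ^+ 2); last by field.
  move=> /le_trans; apply; rewrite ler_wpM2l// lerXn2r ?nnegrE//.
    by rewrite mulr_ge0// (le_trans _ (xi_le i w)).
  by rewrite normrM (ger0_norm c0) ler_wpM2l// xi_le.
have e2 := gauss_taylor u0 ch (hL y).
rewrite (_ : _ - _ = (E (fun w => h (y + c * xi i w)) - h y - h2 y * (u / 2)) -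
  (gaussT u h y - h y - h2 y * (u / 2))); last by ring.
by apply: (le_trans (ler_normB _ _)); rewrite lerD.
Qed.

Let bhS x k : bmf (fun w => h (x + c * partial_xi k w)).
Proof.
have [cch bh] := ch; apply: (bmf_comp cch bh (X := fun w => x + c * partial_xi k w)).
have bS : bmf (partial_xi k) by apply: bmf_sum => i _; exact: bxi.
by have [] := bmfD (bmf_cst x) (bmfZ c bS).
Qed.

(** The block event, which concerns indices from [k] on, carries the induction: the last summand is
    split according to its pattern, its value moves into [x] and the pattern event joins the block.
    Independence thus never has to be stated for integrals. *)
Lemma trotter k : forall x (s : seq nat) (D : nat -> set Omega), uniq s ->
  (forall i, i \in s -> (k <= i)%N) -> (forall i, i \in s -> gen_events (U i) (D i)) ->
  `|E (fun w => h (x + c * partial_xi k w) * \1_(block_event s D) w) -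
    gaussT (k%:R * u) h x * fine (P (block_event s D))| <=
  k%:R * rho * fine (P (block_event s D)).
Proof.
elim: k => [|k IH] x s D us sk gD.
  have mD := block_event_measurable Umeas gD.
  have -> : E (fun w => h (x + c * partial_xi 0 w) * \1_(block_event s D) w) =
      E (fun w => h x * \1_(block_event s D) w).
    by apply: eq_Rintegral => w _; rewrite /partial_xi big_ord0 mulr0 addr0.
  rewrite EZ; last exact: bmf_indic.
  by rewrite Eindic// !mul0r gaussT0 ?subrr ?normr0//; have [] := ch.
have ks : k \notin s by apply/negP => /sk; rewrite ltnn.
pose q b := fine (P (pattern_set A k b)).
pose z b := c * xi_val a m b.
pose Pd := fine (P (block_event s D)).
pose D' b i := if i == k then pattern_set A k b else D i.
have q0 b : 0 <= q b by exact: fine_ge0.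
have Pd0 : 0 <= Pd by exact: fine_ge0.
have q1 : \sum_b q b = 1.
  have := E_pattern P Umeas genA a m k (fun=> 1).
  by rewrite Ecst PT mulr1 => ->; apply: eq_bigr => b _; rewrite mulr1.
have bc b := block_event_cons Umeas Uind genA b ks us gD.
have PD b : fine (P (block_event (k :: s) (D' b))) = q b * Pd.
  by have [e1 e2] := bc b; rewrite /D' -e2 e1.
have gD' b i : i \in k :: s -> gen_events (U i) (D' b i).
  rewrite inE /D'; case: eqP => [-> _|_ /= ins]; first exact: (@pattern_set_gen _ _ _ _ _ _ _ genA k b).
  exact: gD.
have IHb b := IH (x + z b) (k :: s) (D' b) _ _ (gD' b).
have split_E : E (fun w => h (x + c * partial_xi k.+1 w) * \1_(block_event s D) w) =
    \sum_b E (fun w => h (x + z b + c * partial_xi k w) * \1_(block_event (k :: s) (D' b)) w).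
  rewrite -Esum; last first.
    move=> b _; apply: bmfM; first exact: bhS.
    by apply: bmf_indic; exact: (block_event_measurable Umeas (gD' b)).
  apply: eq_Rintegral => w _; rewrite (bigD1 (pattern A k w))//= big1 ?addr0.
    rewrite /partial_xi big_ord_recr/= mulrDr (xiE A a m k w) -/(z _).
    rewrite addrA (addrAC x) /D'; have [_ <-] := bc (pattern A k w).
    by rewrite !indicE in_setI [in X in (X && _)]mem_set.
  move=> b bw; rewrite /D'; have [_ <-] := bc b.
  rewrite indicE in_setI [in X in (X && _)]memNset ?mulr0//.
  by move=> /esym/eqP; rewrite (negbTE bw).
(* [Q] averages [h] over the summand of index [k]. By [one_step] it is within [rho] of [gaussT u h],
   and [gaussT (k%:R * u)] does not enlarge this distance. *)
pose Q y := \sum_b q b * h (y + z b).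
have bh : bmf (h : measurableTypeR R -> R) by exact: cbnd_bmf.
have bQ : bmf (Q : measurableTypeR R -> R).
  apply: bmf_sum => b _; apply: bmfZ.
  have := bmf_translate (z b) bh; congr bmf; apply/funext => y; by rewrite addrC.
have QE y : Q y = E (fun w => h (y + c * xi k w)).
  by rewrite (E_pattern P Umeas genA a m k (fun t => h (y + c * t))).
have Qrho y : `|Q y - gaussT u h y| <= rho by rewrite QE; exact: one_step.
have ku0 : 0 <= k%:R * u by rewrite mulr_ge0.
have TQ : `|gaussT (k%:R * u) Q x - gaussT (k.+1%:R * u) h x| <= rho.
  rewrite -natr1 mulrDl mul1r -gaussT_semigroup//.
  by apply: gaussT_contract => //; exact: gaussT_bmf.
have TQE : gaussT (k%:R * u) Q x = \sum_b q b * gaussT (k%:R * u) h (x + z b).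
  exact: gaussT_sum.
rewrite split_E -/Pd.
have part1 : `|\sum_b E (fun w => h (x + z b + c * partial_xi k w) *
    \1_(block_event (k :: s) (D' b)) w) - gaussT (k%:R * u) Q x * Pd| <= k%:R * rho * Pd.
  rewrite TQE mulr_suml -sumrB; apply: (le_trans (ler_norm_sum _ _ _)).
  apply: (@le_trans _ _ (\sum_b k%:R * rho * (q b * Pd))); last first.
    by rewrite -mulr_sumr -mulr_suml q1 mul1r.
  apply: ler_sum => b _.
  rewrite (_ : q b * _ * Pd = gaussT (k%:R * u) h (x + z b) * (q b * Pd)); last by ring.
  rewrite -!PD.
  apply: IHb => /=; first by rewrite ks us.
  by move=> i; rewrite inE => /predU1P[->//|/sk]; exact: ltnW.
have tri (X Y Z : R) : `|X - Y * Pd| <= k%:R * rho * Pd -> `|Y - Z| <= rho ->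
    `|X - Z * Pd| <= k.+1%:R * rho * Pd.
  move=> XY YZ; rewrite (_ : X - Z * Pd = (X - Y * Pd) + (Y - Z) * Pd); last by ring.
  apply: (le_trans (ler_normD _ _)); rewrite (_ : k.+1%:R * rho * Pd = k%:R * rho * Pd + rho * Pd); last first.
    by rewrite -natr1; ring.
  rewrite lerD//.
  by rewrite normrM (ger0_norm Pd0) ler_wpM2r.
exact: tri part1 TQ.
Qed.

End Step.

(** With [c = 1 / sqrt n] the variances add up to [v], while the [n] errors of order [c^3] add up to
    [B * c]. [trotter] is used with the empty block. *)
Lemma clt_smooth h : smoothe h ->
  (fun n => E (fun w => h ((Num.sqrt n%:R)^-1 * partial_xi n w))) @ \oo --> gaussT v h 0.
Proof.
move=> sh; have ch : cbnd h by exact: smoothe_bmf.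
have [K [L [_ _ [h1 [h2 [hL _]]]]]] := sh.
have v0 : 0 <= v by rewrite -(varE 0); apply: E_ge0 => w; exact: sqr_ge0.
pose B := L * xi_bound ^+ 3 + L * gauss_cst * Num.sqrt v ^+ 3.
have L0 : 0 <= L by have := hL 0 1; rewrite normr1 !expr1n !mulr1; apply: le_trans.
have bound n : (0 < n)%N ->
    `|E (fun w => h ((Num.sqrt n%:R)^-1 * partial_xi n w)) - gaussT v h 0| <=
    B * (Num.sqrt n%:R)^-1.
  move=> n0; pose c : R := (Num.sqrt n%:R)^-1.
  have nR : 0 < n%:R :> R by rewrite ltr0n.
  have sn0 : 0 < Num.sqrt n%:R :> R by rewrite sqrtr_gt0.
  have c0 : 0 <= c by rewrite invr_ge0 ltW.
  have c2 : n%:R * c ^+ 2 = 1 by rewrite exprVn sqr_sqrtr ?ler0n// mulfV ?gt_eqF.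
  have p1 i : i \in [::] -> (n <= i)%N by [].
  have p2 i : i \in [::] -> gen_events (U i) ((fun=> setT) i) by [].
  have := @trotter h h1 h2 L c ch hL c0 n 0 [::] (fun=> setT) isT p1 p2.
  have -> : block_event [::] (fun=> setT) = setT :> set Omega.
    by rewrite /block_event; apply/seteqP; split => // w _ i.
  rewrite PT !mulr1 mulrA c2 mul1r.
  rewrite sqrtrM ?sqr_ge0// sqrtr_sqr (ger0_norm c0) -/c.
  rewrite (_ : n%:R * _ = (n%:R * c ^+ 2) * (B * c)); last by rewrite /B; ring.
  rewrite c2 mul1r; congr (`|_ - _| <= _).
  by apply: eq_Rintegral => w _; rewrite indicT mulr1 add0r.
apply/cvgrPdist_le => e e0.
near=> n.
have n0 : (0 < n)%N by near: n; exact: nbhs_infty_gt.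
rewrite distrC; apply: (le_trans (bound n n0)).
have sn0 : 0 < Num.sqrt n%:R :> R by rewrite sqrtr_gt0 ltr0n.
rewrite ler_pdivrMr// mulrC -ler_pdivrMr//.
apply: (le_trans (ler_norm _)); rewrite -sqrtr_sqr ler_wsqrtr//.
by near: n; exact: nbhs_infty_ger.
Unshelve. all: by end_near. Qed.

End CentralLimit.

(** * Copulas and the empirical process *)

Section SecondMoment.
Context {dO : measure_display} {Omega : measurableType dO} {R : realType}.
Variable P : probability Omega R.
Variables (J : Type) (U : nat -> J -> Omega -> R).
Hypothesis Umeas : forall i j, measurable_fun setT (U i j).
Hypothesis Uind : independent_vectors P U.
Notation E X := (Rintegral P setT X).

Lemma fineP_setT : fine (P setT) = 1. Proof. by rewrite probability_setT. Qed.

Lemma indep2 i k (A B : set Omega) : i != k -> gen_events (U i) A ->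
  gen_events (U k) B -> fine (P (A `&` B)) = fine (P A) * fine (P B).
Proof.
move=> ik gA gB; have mA := gen_events_measurable Umeas gA.
have mB := gen_events_measurable Umeas gB.
pose D l := if l == i then A else B.
have := Uind (J := [:: i; k]) (A := D).
rewrite /= inE ik => /(_ isT); rewrite bigcap_seq !big_cons !big_nil setIT mule1.
rewrite /D eqxx eq_sym (negbTE ik) => ->; first by rewrite fineM ?fin_num_measure.
by move=> l; rewrite !inE => /orP[/eqP->|/eqP->]; rewrite ?eqxx// eq_sym (negbTE ik).
Qed.

Lemma indicI (A B : set Omega) w : \1_(A `&` B) w = \1_A w * \1_B w :> R.
Proof. by rewrite !indicE in_setI; case: (w \in A); rewrite ?mul1r ?mul0r. Qed.

Lemma E_centered_prod (A B : set Omega) : measurable A -> measurable B ->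
  E (fun w => (\1_A w - fine (P A)) * (\1_B w - fine (P B))) =
  fine (P (A `&` B)) - fine (P A) * fine (P B).
Proof.
move=> mA mB; have mAB := measurableI _ _ mA mB.
transitivity (E (fun w => \1_(A `&` B) w - (fine (P B) * \1_A w +
   fine (P A) * \1_B w - fine (P A) * fine (P B)))).
  by apply: eq_Rintegral => w _; rewrite indicI; ring.
have bA := bmf_indic (R := R) mA; have bB := bmf_indic (R := R) mB.
have b1 := bmfD (bmfZ (fine (P B)) bA) (bmfZ (fine (P A)) bB).
rewrite EB; [|exact: bmf_indic|exact: bmfB b1 (bmf_cst _)].
rewrite EB//; last exact: bmf_cst.
rewrite ED; [|exact: bmfZ|exact: bmfZ].
rewrite EZ// EZ// !Eindic// Ecst fineP_setT; ring.
Qed.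

Variables (I : finType) (A : nat -> I -> set Omega).
Hypothesis genA : forall i p, gen_events (U i) (A i p).
Variables (a m : I -> R) (v : R).
Hypothesis mE : forall i p, fine (P (A i p)) = m p.
Hypothesis varE : forall i, E (fun w => xi A a m i w ^+ 2) = v.

Let mA i p : measurable (A i p).
Proof. exact: (gen_events_measurable Umeas (@genA i p)). Qed.

Let bA i p : bmf (fun w => \1_(A i p) w - m p).
Proof. exact: bmfB (bmf_indic (mA i p)) (bmf_cst (m p)). Qed.

Lemma E_xi_prod i k : E (fun w => xi A a m i w * xi A a m k w) =
  \sum_p \sum_q a p * a q * (fine (P (A i p `&` A k q)) - m p * m q).
Proof.
transitivity (E (fun w => \sum_p \sum_q a p * a q *
    ((\1_(A i p) w - m p) * (\1_(A k q) w - m q)))).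
  apply: eq_Rintegral => w _; rewrite /xi mulr_suml; apply: eq_bigr => p _.
  by rewrite mulr_sumr; apply: eq_bigr => q _; ring.
have b2 p q : bmf (fun w => (\1_(A i p) w - m p) * (\1_(A k q) w - m q)).
  by apply: bmfM; exact: bA.
rewrite Esum; last by move=> p _; apply: bmf_sum => q _; exact: bmfZ.
apply: eq_bigr => p _; rewrite Esum; last by move=> q _; exact: bmfZ.
apply: eq_bigr => q _; rewrite EZ//; congr (_ * _).
by rewrite -(mE i p) -(mE k q) E_centered_prod.
Qed.

Lemma E_xi_cross i k : i != k -> E (fun w => xi A a m i w * xi A a m k w) = 0.
Proof.
move=> ik; rewrite E_xi_prod big1// => p _; rewrite big1// => q _.
by rewrite (indep2 ik (@genA i p) (@genA k q)) !mE subrr mulr0.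
Qed.

Lemma E_partial_xi_sqr n : E (fun w => partial_xi A a m n w ^+ 2) = n%:R * v.
Proof.
have bx i : bmf (xi A a m i) by exact: (bmf_xi Umeas genA).
transitivity (E (fun w => \sum_(i < n) \sum_(k < n) xi A a m i w * xi A a m k w)).
  apply: eq_Rintegral => w _; rewrite expr2 /partial_xi mulr_suml.
  by apply: eq_bigr => i _; rewrite mulr_sumr.
rewrite Esum; last by move=> i _; apply: bmf_sum => k _; exact: bmfM.
rewrite (eq_bigr (fun=> v)); first by rewrite sumr_const card_ord mulr_natl.
move=> i _; rewrite Esum; last by move=> k _; exact: bmfM.
rewrite (bigD1 i)//= big1 ?addr0; last first.
  by move=> k ki; apply: E_xi_cross; rewrite eq_sym.
by rewrite -(varE i); apply: eq_Rintegral => w _; rewrite expr2.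
Qed.

End SecondMoment.

(** It stands in for the Cauchy-Schwarz inequality when a second moment is to bound a first absolute
    moment. *)
Lemma le_eta_sqr {R : realType} (eta x : R) : 0 < eta -> `|x| <= eta + x ^+ 2 / eta.
Proof.
move=> e0; rewrite -(ler_pM2l e0) mulrDr mulrCA mulfV ?gt_eqF// mulr1.
rewrite -real_normK ?num_real//; have := sqr_ge0 (`|x| - eta); nra.
Qed.

Section Copula.
Context {R : realType} {d : nat}.
Context {dO : measure_display} {Omega : measurableType dO}.
Variable P : probability Omega R.
Variable U : nat -> 'I_d -> Omega -> R.
Hypothesis hUmeas : forall i j, measurable_fun setT (U i j).
Hypothesis hUind : independent_vectors P U.
Hypothesis hUid : forall (i : nat) (x : 'rV[R]_d),
     P [set w | forall j, U i j w <= x ord0 j] =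
     P [set w | forall j, U 0%N j w <= x ord0 j].
Hypothesis hUunif : forall (j : 'I_d) (x : R), 0 <= x <= 1 ->
     P [set w | U 0%N j w <= x] = x%:E.
Variable C : 'rV[R]_d -> R.
Hypothesis hC : forall u, cube u ->
  (C u)%:E = P [set w | forall j, U 0%N j w <= u ord0 j].
Notation E X := (Rintegral P setT X).
Notation pt := 'rV[R]_d.

Definition orth (i : nat) (u : pt) : set Omega := [set w | forall j, U i j w <= u ord0 j].
Definition half i j (x : R) : set Omega := [set w | U i j w <= x].

Lemma half_gen i j x : gen_events (U i) (half i j x).
Proof.
apply: sub_sigma_algebra; exists j, `]-oo, x]%classic; split; first exact: measurable_itv.
by apply/seteqP; split => w /=; rewrite in_itv.
Qed.

Lemma half_measurable i j x : measurable (half i j x).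
Proof. exact: (gen_events_measurable hUmeas (@half_gen i j x)). Qed.

Lemma orth_gen i u : gen_events (U i) (orth i u).
Proof.
pose G := (fun A => exists j (B : set R), measurable B /\ A = U i j @^-1` B).
have -> : orth i u = \big[setI/setT]_(j : 'I_d) half i j (u ord0 j).
  apply/seteqP; split => w; rewrite -bigcap_seq.
    by move=> h j _; exact: h.
  by move=> h j; exact: (h j (mem_index_enum j)).
apply: (@bigsetI_measurable _ (g_sigma_algebraType G)) => j _.
exact: half_gen.
Qed.

Lemma orth_measurable i u : measurable (orth i u).
Proof. exact: (gen_events_measurable hUmeas (@orth_gen i u)). Qed.

Lemma fineP_orth i u : cube u -> fine (P (orth i u)) = C u.
Proof. by move=> cu; rewrite hUid -hC. Qed.

Lemma orthI i u v : orth i u `&` orth i v = orth i (ptmin u v).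
Proof.
apply/seteqP; split => w.
  by move=> [h1 h2] j; rewrite mxE le_min h1 h2.
by move=> h; split => j; have := h j; rewrite mxE le_min => /andP[].
Qed.

Lemma cube_ptmin (u v : pt) : cube u -> cube v -> cube (ptmin u v).
Proof.
move=> cu cv j; rewrite mxE; have /andP[? ?] := cu j; have /andP[? ?] := cv j.
by rewrite le_min ge_min; apply/andP; split; [apply/andP|apply/orP; left].
Qed.

Lemma cube_only_coord (u : pt) j : cube u -> cube (only_coord u j).
Proof. by move=> cu k; rewrite mxE; case: ifP => // _; rewrite ler01 lexx. Qed.

Let one : pt := \row_k 1.
Let cube_one : cube one. Proof. by move=> k; rewrite mxE ler01 lexx. Qed.

Lemma fineP_le (A B : set Omega) : measurable A -> measurable B -> A `<=` B ->
  fine (P A) <= fine (P B).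
Proof.
by move=> mA mB AB; rewrite fine_le ?fin_num_measure// le_measure ?inE.
Qed.

(** A union bound, written with indicators: outside the orthant at [one] some coordinate exceeds 1,
    and each of these [d] events has probability 0. *)
Lemma C_one : C one = 1.
Proof.
apply/eqP; rewrite eq_le -(fineP_orth 0 cube_one); apply/andP; split.
  by rewrite -[leRHS](fineP_setT P); apply: fineP_le => //; exact: orth_measurable.
have h : \sum_(j < d) fine (P (~` half 0 j 1)) = 0.
  rewrite big1// => j _; have mh := half_measurable 0 j 1.
  by rewrite probability_setC// hUunif ?ler01 ?lexx// -EFinB subrr.
rewrite -subr_le0 -h -[X in X - _](fineP_setT P).
rewrite -!Eindic//; last exact: orth_measurable.
have bo := bmf_indic (R := R) (orth_measurable 0 one).
rewrite -EB//; last exact: bmf_indic.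
rewrite (eq_bigr (fun j => E (\1_(~` half 0 j 1)))); last first.
  by move=> j _; rewrite Eindic//; apply: measurableC; exact: half_measurable.
rewrite -Esum; last first.
  by move=> j _; apply: bmf_indic; apply: measurableC; exact: half_measurable.
apply: leE.
- by apply: bmfB => //; exact: bmf_indic.
- by apply: bmf_sum => j _; apply: bmf_indic; apply: measurableC; exact: half_measurable.
move=> w; rewrite indicT.
have [ow|ow] := pselect (orth 0 one w).
  by rewrite (indicE _ (orth _ _)) mem_set// subrr; apply: sumr_ge0 => j _; rewrite indicE.
rewrite (indicE _ (orth _ _)) memNset// subr0.
have [j hj] : exists j, ~ half 0 j 1 w.
  by apply/existsNP => hh; apply: ow => j; rewrite mxE; exact: hh.
rewrite (bigD1 j)//= indicE mem_set// lerDl; apply: sumr_ge0 => k _; rewrite indicE.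
exact: ler0n.
Qed.

(** [hUid] compares orthants only. The half-line event agrees with an orthant up to the complement
    of [orth i' one], which is null by [C_one]. *)
Lemma P_half i j x : 0 <= x <= 1 -> fine (P (half i j x)) = x.
Proof.
move=> x01; pose u : pt := \row_k (if k == j then x else 1).
have cu : cube u by move=> k; rewrite mxE; case: ifP; rewrite ?x01 ?ler01 ?lexx.
have E i' : fine (P (half i' j x)) = fine (P (orth i' u)).
  have mo := orth_measurable i' u; have mh := half_measurable i' j x.
  have m1 := orth_measurable i' one.
  have sub : orth i' u `<=` half i' j x.
    by move=> w /(_ j); rewrite mxE eqxx.
  apply/eqP; rewrite eq_le; apply/andP; split; last exact: fineP_le.
  have -> : fine (P (orth i' u)) = fine (P (half i' j x `&` orth i' one)).
    congr (fine (P _)); apply/seteqP; split => w.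
      move=> h; split; first exact: sub.
      move=> k; have /andP[_] := cu k; rewrite [one _ _]mxE; apply: le_trans; exact: h.
    by move=> [h1 h2] k; rewrite mxE; case: eqP => [->//|_]; have := h2 k; rewrite mxE.
  rewrite -subr_le0 -!Eindic//; last exact: measurableI.
  rewrite -EB; [|exact: bmf_indic|by apply: bmf_indic; exact: measurableI].
  have N1 : E (fun w => 1 - \1_(orth i' one) w) = 0.
    rewrite EB; [|exact: bmf_cst|exact: bmf_indic].
    by rewrite Ecst fineP_setT Eindic// fineP_orth// C_one mulr1 subrr.
  rewrite -N1; apply: leE.
  - by apply: bmfB; apply: bmf_indic => //; exact: measurableI.
  - by apply: bmfB; [exact: bmf_cst|exact: bmf_indic].
  move=> w; rewrite indicI !indicE; case: (w \in half _ _ _); rewrite ?mul1r// mul0r subrr.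
  by case: (w \in _); rewrite ?subrr ?subr0.
by rewrite E fineP_orth// -(fineP_orth 0)// -E /half hUunif.
Qed.

Lemma C_only_coord u j : cube u -> C (only_coord u j) = u ord0 j.
Proof.
move=> cu; have co := cube_only_coord j cu.
have uj := cu j; rewrite -(P_half 0 j uj) -(fineP_orth 0 co).
have mo := orth_measurable 0 (only_coord u j); have mh := half_measurable 0 j (u ord0 j).
have m1 := orth_measurable 0 one.
have sub : orth 0 (only_coord u j) `<=` half 0 j (u ord0 j).
  by move=> w /(_ j); rewrite mxE eqxx.
apply/eqP; rewrite eq_le; apply/andP; split; first exact: fineP_le.
rewrite -subr_le0 -!Eindic// -EB; [|exact: bmf_indic|exact: bmf_indic].
have N1 : E (fun w => 1 - \1_(orth 0 one) w) = 0.
  rewrite EB; [|exact: bmf_cst|exact: bmf_indic].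
  by rewrite Ecst fineP_setT Eindic// fineP_orth// C_one mulr1 subrr.
rewrite -N1; apply: leE.
- by apply: bmfB; apply: bmf_indic.
- by apply: bmfB; [exact: bmf_cst|exact: bmf_indic].
move=> w; rewrite !indicE.
have [h1|h1] := pselect (orth 0 one w).
  rewrite (mem_set h1) subrr.
  have [h2|h2] := pselect (half 0 j (u ord0 j) w).
    rewrite (mem_set h2) mem_set ?subrr//.
    by move=> k; rewrite mxE; case: eqP => [->//|_]; have := h1 k; rewrite mxE.
  by rewrite (memNset h2) sub0r oppr_le0.
rewrite (memNset h1) subr0 lerBlDr.
by rewrite ler_wpDr// lern1 leq_b1.
Qed.

Lemma C_incr u v : cube u -> cube v ->
  C u - C (ptmin u v) <= \sum_j (u ord0 j - Num.min (u ord0 j) (v ord0 j)).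
Proof.
move=> cu cv; have cm := cube_ptmin cu cv.
pose mn j := Num.min (u ord0 j) (v ord0 j).
have mn01 j : 0 <= mn j <= 1.
  by rewrite /mn; have := cm j; rewrite mxE.
rewrite -(fineP_orth 0 cu) -(fineP_orth 0 cm).
rewrite (eq_bigr (fun j => E (fun w => \1_(half 0 j (u ord0 j)) w - \1_(half 0 j (mn j)) w))); last first.
  move=> j _; rewrite EB; [|by apply: bmf_indic; exact: half_measurable..].
  by rewrite !Eindic; [rewrite !P_half|exact: half_measurable..].
have bh j x : bmf (\1_(half 0 j x) : Omega -> R) by apply: bmf_indic; exact: half_measurable.
have bo x : bmf (\1_(orth 0 x) : Omega -> R) by apply: bmf_indic; exact: orth_measurable.
rewrite -Esum; last by move=> j _; exact: bmfB.
rewrite -!Eindic; [|exact: orth_measurable..].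
rewrite -EB//; apply: leE; [exact: bmfB|by apply: bmf_sum => j _; exact: bmfB|].
have pos j w : 0 <= \1_(half 0 j (u ord0 j)) w - \1_(half 0 j (mn j)) w :> R.
  rewrite subr_ge0 !indicE ler_nat.
  have [h|h] := pselect (half 0 j (mn j) w); last by rewrite (memNset h).
  rewrite (mem_set h) mem_set//=; apply: le_trans h _.
  by rewrite /mn ge_min lexx.
move=> w; rewrite !indicE.
have [h1|h1] := pselect (orth 0 u w); last first.
  rewrite (memNset h1) sub0r (@le_trans _ _ 0) ?oppr_le0 ?ler0n//.
  by apply: sumr_ge0 => j _; exact: pos.
have [h2|h2] := pselect (orth 0 (ptmin u v) w).
  by rewrite (mem_set h1) (mem_set h2) subrr; apply: sumr_ge0 => j _; exact: pos.
rewrite (mem_set h1) (memNset h2) subr0.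
have [j hj] : exists j, ~ half 0 j (mn j) w.
  by apply/existsNP => h; apply: h2 => j; rewrite mxE; exact: h.
rewrite (bigD1 j)//= (indicE _ (half 0 j (u ord0 j))) mem_set; last exact: h1.
rewrite indicE memNset// subr0 lerDl; apply: sumr_ge0 => k _; exact: pos.
Qed.

Lemma ptminC (u v : pt) : ptmin u v = ptmin v u.
Proof. by apply/rowP => j; rewrite !mxE minC. Qed.

Lemma C_min_le u v : cube u -> cube v -> C (ptmin u v) <= C u.
Proof.
move=> cu cv; rewrite -(fineP_orth 0 cu) -(fineP_orth 0 (cube_ptmin cu cv)) -orthI.
by apply: fineP_le; [apply: measurableI; exact: orth_measurable|exact: orth_measurable|move=> w []].
Qed.

Definition dist1 (u v : pt) : R := \sum_j `|u ord0 j - v ord0 j|.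

(** The left side is the probability of the symmetric difference of two orthant events. It bounds
    both [|C u - C v|] and the variance of [alpha u - alpha v]. *)
Lemma C_var u v : cube u -> cube v ->
  (C u - C (ptmin u v)) + (C v - C (ptmin u v)) <= dist1 u v.
Proof.
move=> cu cv; have h1 := C_incr cu cv; have h2 := C_incr cv cu.
rewrite (ptminC v u) in h2; apply: (le_trans (lerD h1 h2)).
rewrite -big_split/=; apply: ler_sum => j _; rewrite minC.
have [|] := leP (v ord0 j) (u ord0 j) => h; rewrite subrr ?add0r ?addr0.
  by rewrite ger0_norm ?subr_ge0.
by rewrite ltr0_norm ?subr_lt0// opprB.
Qed.

Lemma C_lip u v : cube u -> cube v -> `|C u - C v| <= dist1 u v.
Proof.
move=> cu cv; have h := C_var cu cv; have h1 := C_min_le cu cv; have h2 := C_min_le cv cu.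
rewrite ptminC in h2; rewrite ler_norml; apply/andP; split; lra.
Qed.

Lemma C_01 u : cube u -> 0 <= C u <= 1.
Proof.
move=> cu; rewrite -(fineP_orth 0 cu) fine_ge0//= -[leRHS](fineP_setT P).
by apply: fineP_le => //; exact: orth_measurable.
Qed.

End Copula.

(** * Ranks *)

Section RankCount.
Context {R : realType}.
Variables (n : nat) (x : nat -> R).
Hypothesis n0 : (0 < n)%N.
Hypothesis x_inj : forall i k : 'I_n, x i = x k -> i = k.

Definition edf (y : nat -> R) (k : nat) (t : R) : R :=
  k%:R^-1 * \sum_(i < k) (if y i <= t then 1 else 0).

Local Notation F := (edf x n).

Let nR : 0 < n%:R :> R. Proof. by rewrite ltr0n. Qed.
Let nV : 0 <= n%:R^-1 :> R. Proof. by rewrite invr_ge0 ltW. Qed.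

Lemma edf_nat t : F t = n%:R^-1 * \sum_(i < n) (x i <= t)%R%:R.
Proof. by congr (_ * _); apply: eq_bigr => i _; case: ifP. Qed.

Lemma edf_homo s t : s <= t -> F s <= F t.
Proof.
move=> st; rewrite !edf_nat ler_wpM2l//; apply: ler_sum => i _.
by rewrite ler_nat; case: (leP (x i) s) => // h; rewrite (le_trans h st).
Qed.

Lemma edf_01 t : 0 <= F t <= 1.
Proof.
rewrite edf_nat mulr_ge0 ?sumr_ge0//= mulrC ler_pdivrMr// mul1r.
apply: (@le_trans _ _ (\sum_(i < n) 1)).
  by apply: ler_sum => i _; rewrite lern1 leq_b1.
by rewrite sumr_const card_ord.
Qed.

Let NA u : R := n%:R^-1 * \sum_(i < n) (F (x i) < u)%R%:R.

(** The points of rank below [u] all lie at or below the largest of them, so their proportion is at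
    most its rank. *)
Let NA_le u : 0 <= u -> NA u <= u.
Proof.
move=> u0; have [i0 hi0|none] := pickP (fun i : 'I_n => F (x i) < u); last first.
  by rewrite /NA big1 ?mulr0// => i _; rewrite none.
have [im him hmax] := @Order.TotalTheory.arg_maxP _ _ 'I_n i0 (fun i : 'I_n => F (x i) < u)
  (fun i : 'I_n => x i) hi0.
apply: le_trans (ltW him); rewrite edf_nat ler_wpM2l//; apply: ler_sum => k _.
by rewrite ler_nat; case: ltP => // hk; have -> : x k <= x im by exact: hmax.
Qed.

(** Take the smallest point whose rank is at least [u]: in the absence of ties, every other point at
    or below it has rank below [u], and the point itself costs [1 / n]. *)
Let NA_ge u : u <= 1 -> u - n%:R^-1 <= NA u.
Proof.
move=> u1; have [i0 hi0|none] := pickP (fun i : 'I_n => ~~ (F (x i) < u)); last first.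
  rewrite /NA (eq_bigr (fun=> 1)); last first.
    by move=> i _; have := none i => /negbFE ->.
  rewrite sumr_const card_ord mulVf ?gt_eqF//.
  by rewrite lerBlDr (le_trans u1)// lerDl.
have [im him hmin] := @Order.TotalTheory.arg_minP _ _ 'I_n i0 (fun i : 'I_n => ~~ (F (x i) < u))
  (fun i : 'I_n => x i) hi0.
have h : u <= F (x im) by rewrite leNgt.
rewrite lerBlDr; apply: (le_trans h); rewrite edf_nat /NA -[X in _ + X]mulr1 -mulrDr.
rewrite ler_wpM2l// (bigD1 im)//= lexx addrC lerD2r.
rewrite [leRHS](bigD1 im)//= ler_wpDl//; apply: ler_sum => k kim.
rewrite ler_nat; case: (leP (x k) (x im)) => // hk.
have [//|hk'] := boolP (F (x k) < u).
have := hmin k hk' => hk2; have e : x k = x im by apply/eqP; rewrite eq_le hk hk2.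
by move: kim; rewrite (x_inj e) eqxx.
Qed.

(** Whichever of the two sets is the larger, the sum of absolute differences is a difference of
    counts. [NA_ge] settles the case [u <= F t] and [NA_le] the other. *)
Lemma rank_count u t : 0 <= u <= 1 ->
  n%:R^-1 * \sum_(i < n) `|(F (x i) < u)%R%:R - (x i <= t)%R%:R| <= `|u - F t| + n%:R^-1.
Proof.
move=> /andP[u0 u1]; have [ut|ut] := leP u (F t).
  have sub i : (F (x i) < u)%R -> x i <= t.
    move=> h; rewrite leNgt; apply/negP => ti.
    by have := edf_homo (ltW ti); rewrite leNgt (lt_le_trans h ut).
  rewrite (eq_bigr (fun i : 'I_n => (x i <= t)%R%:R - (F (x i) < u)%R%:R)); last first.
    move=> i _; rewrite -normrN opprB ger0_norm// subr_ge0 ler_nat.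
    by case: ltP => // /sub ->.
  rewrite sumrB mulrBr -edf_nat -/(NA u).
  have tri (a b c e : R) : b - u <= c -> u - e <= a -> b - a <= c + e by lra.
  by apply: tri (NA_ge u1); rewrite distrC ler_norm.
have sub i : x i <= t -> F (x i) < u.
  by move=> h; apply: le_lt_trans ut; exact: edf_homo.
rewrite (eq_bigr (fun i : 'I_n => (F (x i) < u)%R%:R - (x i <= t)%R%:R)); last first.
  by move=> i _; rewrite ger0_norm// subr_ge0 ler_nat; case: (leP (x i) t) => // /sub ->.
rewrite sumrB mulrBr -edf_nat -/(NA u).
have tri (a b c e : R) : u - b <= c -> a <= u -> 0 <= e -> a - b <= c + e by lra.
exact: tri (ler_norm _) (NA_le u0) nV.
Qed.

Lemma max_count : \sum_(i < n) (F (x i) == 1)%R%:R <= 1 :> R.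
Proof.
have top i : F (x i) = 1 -> forall k : 'I_n, x k <= x i.
  rewrite edf_nat => h k; rewrite leNgt; apply/negP => hk.
  have : \sum_(j < n) (x j <= x i)%R%:R < n%:R :> R.
    rewrite (bigD1 k)//= leNgt hk add0r.
    apply: (@le_lt_trans _ _ (\sum_(j < n | j != k) 1)).
      by apply: ler_sum => j _; rewrite lern1 leq_b1.
    rewrite sumr_const ltr_nat (_ : #|_| = n.-1) ?ltn_predL//.
    by rewrite -[in RHS](card_ord n) -(cardC1 k); apply: eq_card.
  have nV0 : 0 < n%:R^-1 :> R by rewrite invr_gt0.
  by rewrite -(ltr_pM2l nV0) h mulVf ?gt_eqF// ltxx.
have [i0 /eqP hi0|none] := pickP (fun i : 'I_n => F (x i) == 1); last first.
  by rewrite big1// => i _; rewrite none.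
rewrite (bigD1 i0)//= hi0 eqxx big1 ?addr0// => k ki.
case: eqP => // hk; have e : x k = x i0.
  by apply/eqP; rewrite eq_le (top _ hi0 k) (top _ hk i0).
by move: ki; rewrite (x_inj e) eqxx.
Qed.

End RankCount.

Lemma forall_indic_diff {R : realType} (I : finType) (a b : pred I) :
  `|[forall j, a j]%:R - [forall j, b j]%:R| <= \sum_j `|(a j)%:R - (b j)%:R| :> R.
Proof.
have [/forallP ha|/forallPn[j ja]] := boolP [forall j, a j];
have [/forallP hb|/forallPn[k kb]] := boolP [forall j, b j].
- by rewrite subrr normr0; apply: sumr_ge0.
- by rewrite subr0 normr1 (bigD1 k)//= ha (negbTE kb) subr0 normr1 lerDl; apply: sumr_ge0.
- rewrite sub0r normrN normr1 (bigD1 j)//= hb (negbTE ja) sub0r normrN normr1.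
  by rewrite lerDl; apply: sumr_ge0.
- by rewrite subrr normr0; apply: sumr_ge0.
Qed.

(** * Almost sure properties of the sample *)

Section NullSet.
Context {R : realType} {d : nat}.
Context {dO : measure_display} {Omega : measurableType dO}.
Variable P : probability Omega R.
Variable U : nat -> 'I_d -> Omega -> R.
Hypothesis hUmeas : forall i j, measurable_fun setT (U i j).
Hypothesis hUind : independent_vectors P U.
Hypothesis Phalf : forall i j x, 0 <= x <= 1 -> fine (P (half U i j x)) = x.
Notation E X := (Rintegral P setT X).

Lemma null_of_small (A : set Omega) : measurable A ->
  (forall k : nat, (0 < k)%N -> fine (P A) <= k%:R^-1) -> P.-negligible A.
Proof.
move=> mA h; apply/negligibleP => //.
have P0 : fine (P A) = 0.
  apply/eqP; rewrite eq_le fine_ge0// andbT; apply/ler_addgt0Pr => e e0; rewrite add0r.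
  have [k k0 ke] : exists2 k, (0 < k)%N & k%:R^-1 <= e.
    exists (Num.truncn e^-1).+1 => //; rewrite -[leRHS]invrK lef_pV2 ?posrE ?invr_gt0 ?ltr0n//.
    by rewrite ltW// truncnS_gt.
  by apply: le_trans ke; exact: h.
by rewrite -(fineK (fin_num_measure P _ mA)) P0.
Qed.

Let mh i j x : measurable (half U i j x) := half_measurable hUmeas i j x.

Lemma outside_null i j : P.-negligible [set w | ~ (0 < U i j w < 1)].
Proof.
have mZ : measurable [set w | ~ (0 < U i j w < 1)].
  rewrite [X in measurable X](_ : _ = ~` (U i j @^-1` `]0, 1[%classic)); last first.
    by apply/seteqP; split => w /=; rewrite in_itv.
  apply: measurableC; rewrite -[X in measurable X]setTI; exact: hUmeas.
apply: null_of_small => // k k0.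
have kR : 0 < k%:R :> R by rewrite ltr0n.
have k1 : k%:R^-1 <= 1 :> R by rewrite invf_le1// ler1n.
have bI (A : set Omega) : measurable A -> bmf (\1_A : Omega -> R) by exact: bmf_indic.
pose x : R := 1 - k%:R^-1.
have -> : k%:R^-1 = E (fun w => \1_(half U i j 0) w + (1 - \1_(half U i j x) w)).
  rewrite ED; [|exact: bI|by apply: bmfB; [exact: bmf_cst|exact: bI]].
  rewrite EB; [|exact: bmf_cst|exact: bI].
  rewrite Ecst (fineP_setT P) !Eindic// !Phalf ?lexx ?ler01//; last first.
    by rewrite /x subr_ge0 k1 gerBl invr_ge0 ltW.
  by rewrite /x; lra.
rewrite -Eindic//; apply: leE; first exact: bI.
  by apply: bmfD; [exact: bI|apply: bmfB; [exact: bmf_cst|exact: bI]].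
move=> w; rewrite !indicE.
have [h1|h1] := pselect (0 < U i j w < 1).
  rewrite memNset; last by move=> /=; apply.
  by rewrite addr_ge0// subr_ge0 lern1 leq_b1.
rewrite mem_set//.
have [h0|h0] := leP (U i j w) 0.
  by rewrite mem_set// lerDl subr_ge0 lern1 leq_b1.
rewrite (memNset (A := half U i j x)) ?subr0 ?lerDr//.
rewrite /half/= => hx; apply: h1; rewrite h0/= (le_lt_trans hx)// /x.
by rewrite gtrBl invr_gt0.
Qed.

(** Tied values in []0, 1]] share one of [N] cells of length [1 / N]; by independence this has
    probability [N * N^-2]. Values outside []0, 1]] are caught by two terms of expectation 0. *)
Lemma tie_null i k j : i != k -> P.-negligible [set w | U i j w = U k j w].
Proof.
move=> ik.
pose T := [set w | U i j w = U k j w].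
have mT : measurable T.
  have := measurable_fun_eqr (hUmeas i j) (hUmeas k j) measurableT (Y := [set true]) I.
  by rewrite setTI; congr measurable; apply/seteqP; split => w /= /eqP.
apply: null_of_small => // N N0.
have NR : 0 < N%:R :> R by rewrite ltr0n.
have bI (A : set Omega) : measurable A -> bmf (\1_A : Omega -> R) by exact: bmf_indic.
pose p (m : nat) : R := m%:R / N%:R.
have p01 m : (m <= N)%N -> 0 <= p m <= 1.
  by move=> mN; rewrite /p divr_ge0//= ler_pdivrMr// mul1r ler_nat.
pose cell l m := half U l j (p m.+1) `&` ~` half U l j (p m).
have gcell l m : gen_events (U l) (cell l m).
  pose G := (fun A => exists j (B : set R), measurable B /\ A = U l j @^-1` B).
  have mg y : @measurable _ (g_sigma_algebraType G) (half U l j y) by exact: half_gen.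
  by apply: (@measurableI _ (g_sigma_algebraType G)); [exact: mg|apply: measurableC; exact: mg].
have mcell l m : measurable (cell l m) by exact: (gen_events_measurable hUmeas (gcell l m)).
have pS m : p m <= p m.+1 by rewrite /p ler_pM2r ?invr_gt0// ler_nat.
have Pcell l m : (m < N)%N -> fine (P (cell l m)) = N%:R^-1.
  move=> mN.
  have -> : fine (P (cell l m)) = fine (P (half U l j (p m.+1))) - fine (P (half U l j (p m))).
    rewrite -!Eindic// -EB; [|exact: bI|exact: bI].
    apply: eq_Rintegral => w _; rewrite /cell in_setI !indicE.
    have [h|h] := pselect (half U l j (p m) w).
      rewrite (mem_set h) (memNset (A := ~` _)) ?andbF; last by apply.
      by rewrite mem_set ?subrr//; exact: le_trans h (pS m).
    by rewrite (memNset h) (mem_set (A := ~` _))// andbT subr0.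
  rewrite !Phalf ?p01// 1?ltnW// /p -natr1; field.
  by rewrite gt_eqF.
have P0 : fine (P (half U i j 0)) = 0 by rewrite Phalf ?lexx ?ler01.
have P1 : fine (P (half U i j 1)) = 1 by rewrite Phalf ?lexx ?ler01.
have -> : N%:R^-1 = E (fun w => \1_(half U i j 0) w + (1 - \1_(half U i j 1) w) +
    \sum_(m < N) \1_(cell i m `&` cell k m) w).
  have mII m : measurable (cell i m `&` cell k m) by exact: measurableI.
  rewrite ED; last 2 first.
  - by apply: bmfD; [exact: bI|apply: bmfB; [exact: bmf_cst|exact: bI]].
  - by apply: bmf_sum => m _; exact: bI.
  rewrite ED; [|exact: bI|by apply: bmfB; [exact: bmf_cst|exact: bI]].
  rewrite EB; [|exact: bmf_cst|exact: bI].
  rewrite Ecst (fineP_setT P) !Eindic// P0 P1 mulr1 subrr addr0 add0r.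
  rewrite Esum; last by move=> m _; exact: bI.
  rewrite (eq_bigr (fun=> N%:R^-1 * N%:R^-1)); last first.
    by move=> m _; rewrite Eindic// (indep2 hUmeas hUind ik (gcell i m) (gcell k m)) !Pcell.
  by rewrite sumr_const card_ord -[RHS]mulr_natl mulrA mulfV ?mul1r// gt_eqF.
rewrite -Eindic//; apply: leE; first exact: bI.
  apply: bmfD; last by apply: bmf_sum => m _; apply: bI; exact: measurableI.
  by apply: bmfD; [exact: bI|apply: bmfB; [exact: bmf_cst|exact: bI]].
move=> w; have s0 : 0 <= \sum_(m < N) \1_(cell i m `&` cell k m) w :> R.
  by apply: sumr_ge0 => m _; rewrite indicE.
have i0 (A : set Omega) : 0 <= \1_A w :> R by rewrite indicE.
have i1 (A : set Omega) : 0 <= 1 - \1_A w :> R by rewrite subr_ge0 indicE lern1 leq_b1.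
have [Tw|Tw] := pselect (T w); last first.
  by rewrite (indicE _ T) memNset//; apply: addr_ge0 => //; apply: addr_ge0.
rewrite (indicE _ T) mem_set//.
have [h0|h0] := leP (U i j w) 0.
  by rewrite (indicE _ (half U i j 0)) mem_set// -addrA lerDl addr_ge0.
have [h1|h1] := leP (U i j w) 1; last first.
  rewrite (indicE _ (half U i j 1)) memNset; last by rewrite /half/= => /(lt_le_trans h1); rewrite ltxx.
  by rewrite subr0 addrAC lerDr addr_ge0.
have ex : exists m, U i j w <= p m.+1.
  by exists N.-1; rewrite prednK// /p mulfV ?gt_eqF.
have [m hm hmin] := ex_minnP ex.
have mN : (m < N)%N.
  by rewrite -(prednK N0) ltnS; apply: hmin; rewrite prednK// /p mulfV ?gt_eqF.
have hm' : p m < U i j w.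
  case: m hm hmin mN => [|m] hm hmin mN; first by rewrite /p mul0r.
  by rewrite ltNge; apply/negP => /hmin; rewrite ltnn.
apply: ler_wpDl; first by rewrite addr_ge0.
rewrite (bigD1 (Ordinal mN))//= indicE mem_set ?lerDl; last first.
  by rewrite /cell /half /= -Tw; split; (split => //; apply/negP; rewrite -ltNge).
by apply: sumr_ge0 => l _.
Qed.

Definition good (w : Omega) : Prop := (forall i j, 0 < U i j w < 1) /\
  forall i k j, i != k -> U i j w <> U k j w.

Lemma good_ae : exists N : set Omega, [/\ measurable N, P N = 0%E &
  forall w, ~ N w -> good w].
Proof.
pose Bad := \bigcup_i \big[setU/set0]_(j : 'I_d) ([set w | ~ (0 < U i j w < 1)] `|`
  \bigcup_k (if i == k then set0 else [set w | U i j w = U k j w])).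
have [N [mN N0 sub]] : P.-negligible Bad.
  apply: negligible_bigcup => i.
  apply: (big_ind (fun A => P.-negligible A)); [exact: negligible_set0|by move=> A B; exact: negligibleU|move=> j _].
  apply: negligibleU; first exact: outside_null.
  apply: negligible_bigcup => k; case: eqP => [_|/eqP ik]; first exact: negligible_set0.
  exact: tie_null.
exists N; split => // w Nw.
have nb i j : ~ ([set w | ~ (0 < U i j w < 1)] `|`
  \bigcup_k (if i == k then set0 else [set w | U i j w = U k j w])) w.
  move=> h; apply: Nw; apply: sub; exists i => //.
  by rewrite -bigcup_seq; exists j => //=; exact: mem_index_enum.
split => [i j|i k j ik e].
  by apply: contrapT => h; apply: (nb i j); left.
by apply: (nb i j); right; exists k => //; rewrite (negbTE ik).
Qed.

End NullSet.

(** * Increments of the copula *)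

Section CubeCalculus.
Context {R : realType} {d : nat}.
Notation pt := 'rV[R]_d.
Variable C : pt -> R.
Variable dC : 'I_d -> pt -> R.
Hypothesis Clip : forall u v : pt, cube u -> cube v -> `|C u - C v| <= dist1 u v.
Hypothesis hdC : forall j u, cube u -> partial_deriv_cube C j u (dC j u).
Hypothesis hdCcont : forall j, {within @cube R d, continuous (dC j)}.

Definition bump (u : pt) (j : 'I_d) (t : R) : pt := u + t *: delta_mx ord0 j.

Lemma bumpE u j t k : bump u j t ord0 k = u ord0 k + (if k == j then t else 0).
Proof. by rewrite !mxE eqxx /=; case: eqP => _; rewrite ?mulr1 ?mulr0. Qed.

Lemma bumpD u j s t : bump (bump u j s) j t = bump u j (s + t).
Proof. by rewrite /bump -addrA -scalerDl. Qed.

Lemma cube_bump u j t : cube u -> 0 <= u ord0 j + t <= 1 -> cube (bump u j t).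
Proof. by move=> cu ut k; rewrite bumpE; case: eqP => [->//|_]; rewrite addr0. Qed.

Lemma dist1_bump u j t : dist1 (bump u j t) u = `|t|.
Proof.
rewrite /dist1 (bigD1 j)//= bumpE eqxx addrAC subrr add0r big1 ?addr0// => k kj.
by rewrite bumpE (negbTE kj) addr0 subrr normr0.
Qed.

Lemma partial_deriv_eps j u (e : R) : cube u -> 0 < e -> exists2 r : R, 0 < r &
  forall h, h != 0 -> `|h| < r -> cube (bump u j h) ->
    `|dC j u - h^-1 * (C (bump u j h) - C u)| <= e.
Proof.
move=> cu e0; have /cvgrPdist_le /(_ e e0) := @hdC j u cu.
rewrite near_withinE near_withinE => /nbhs_ballP[r /= r0 hr]; exists r => // h h0 hlt ch.
by apply: hr => //; rewrite /ball/= sub0r normrN.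
Qed.

(** Difference quotients are bounded by 1 through [Clip]. The increment points towards the farther
    face, so that the moved point stays in the cube. *)
Lemma dC_le1 j u : cube u -> `|dC j u| <= 1.
Proof.
move=> cu; apply/ler_addgt0Pr => e e0.
have [r r0 hr] := partial_deriv_eps j cu e0.
have /andP[u0 u1] := cu j.
have [h [h0 hlt ch]] : exists h, [/\ h != 0, `|h| < r & cube (bump u j h)].
  pose t := Num.min (r / 2) (2^-1).
  have t0 : 0 < t by rewrite lt_min divr_gt0//=.
  have tr : t < r by rewrite gt_min ltr_pdivrMr// mulr_natr mulr2n ltrDl r0.
  have t2 : t <= 2^-1 by rewrite ge_min lexx orbT.
  have [uh|uh] := leP (u ord0 j) 2^-1.
    exists t; split; rewrite ?gt_eqF ?gtr0_norm//; apply: cube_bump => //.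
    by apply/andP; split; lra.
  exists (- t); split; rewrite ?oppr_eq0 ?gt_eqF ?normrN ?gtr0_norm//.
  by apply: cube_bump => //; apply/andP; split; lra.
have q1 : `|h^-1 * (C (bump u j h) - C u)| <= 1.
  rewrite normrM normfV ler_pdivrMl ?normr_gt0// mulr1 -(dist1_bump u j h).
  exact: Clip.
rewrite -(subrK (h^-1 * (C (bump u j h) - C u)) (dC j u)).
by apply: (le_trans (ler_normD _ _)); rewrite addrC lerD// hr.
Qed.

Lemma C_line_deriv j u t : cube u -> 0 < u ord0 j + t < 1 ->
  is_derive t (1 : R) (fun s => C (bump u j s)) (dC j (bump u j t)).
Proof.
move=> cu /andP[t0 t1].
have cb : cube (bump u j t) by apply: cube_bump => //; rewrite !ltW.
have cv : (fun h : R => h^-1 *: ((fun s => C (bump u j s)) (h *: (1 : R) + t) -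
    (fun s => C (bump u j s)) t)) @ (0 : R)^' --> dC j (bump u j t).
  apply/cvgrPdist_le => e e0.
  have [r r0 hr] := partial_deriv_eps j cb e0.
  pose m := Num.min r (Num.min (u ord0 j + t) (1 - (u ord0 j + t))).
  have m0 : 0 < m by rewrite !lt_min r0 t0/= subr_gt0.
  rewrite near_withinE; apply/nbhs_ballP; exists m => //= h.
  rewrite /ball/= sub0r normrN => hm hn0.
  have := hm; rewrite !lt_min => /and3P[h1 h2 h3].
  have := hr h hn0 h1; rewrite bumpD /GRing.scale/= mulr1 addrC; apply.
  apply: cube_bump => //; rewrite addrA.
  move: h2 h3; rewrite !ltr_norml => /andP[? ?] /andP[? ?].
  by rewrite addrC; apply/andP; split; lra.
split; first by apply/cvg_ex; exists (dC j (bump u j t)).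
by apply: cvg_lim.
Qed.

Lemma C_mvt j u h : cube u -> 0 < u ord0 j < 1 -> 0 < u ord0 j + h < 1 ->
  exists2 t, `|t| <= `|h| & cube (bump u j t) /\
    C (bump u j h) - C u = dC j (bump u j t) * h.
Proof.
move=> cu /andP[u0 u1] /andP[h0 h1].
have b0 : bump u j 0 = u by rewrite /bump scale0r addr0.
have der t : Num.min 0 h <= t <= Num.max 0 h ->
    is_derive t (1 : R) (fun s => C (bump u j s)) (dC j (bump u j t)).
  move=> /andP[]; rewrite ge_min le_max => /orP t0 /orP t1.
  by apply: C_line_deriv => //; apply/andP; split; case: t0; case: t1 => ? ?; lra.
have cont t : Num.min 0 h <= t <= Num.max 0 h ->
    {for t, continuous (fun s => C (bump u j s))}.
  move=> th; apply: differentiable_continuous; apply/derivable1_diffP.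
  by have [] := der t th.
have cbt t : `|t| <= `|h| -> Num.min 0 h <= t <= Num.max 0 h -> cube (bump u j t).
  move=> _ /andP[]; rewrite ge_min le_max => /orP t0 /orP t1.
  by apply: cube_bump => //; apply/andP; split; case: t0; case: t1 => ? ?; lra.
have [hp|hn] := leP 0 h.
  have := @MVT_segment R (fun s => C (bump u j s)) (fun s => dC j (bump u j s)) 0 h hp.
  move=> [||t].
  - move=> t; rewrite in_itv/= => /andP[? ?]; apply: der.
    by rewrite (min_idPl hp) (max_idPr hp) !ltW.
  - apply: continuous_in_subspaceT => t; rewrite inE/= in_itv/= => th; apply: cont.
    by rewrite (min_idPl hp) (max_idPr hp).
  rewrite in_itv/= => /andP[t0 t1]; rewrite b0 subr0 => e; exists t.
    by rewrite !ger0_norm.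
  split => //; apply: cbt; first by rewrite !ger0_norm.
  by rewrite (min_idPl hp) (max_idPr hp) t0.
have hl := ltW hn.
have := @MVT_segment R (fun s => C (bump u j s)) (fun s => dC j (bump u j s)) h 0 hl.
move=> [||t].
- move=> t; rewrite in_itv/= => /andP[? ?]; apply: der.
  by rewrite (min_idPr hl) (max_idPl hl) !ltW.
- apply: continuous_in_subspaceT => t; rewrite inE/= in_itv/= => th; apply: cont.
  by rewrite (min_idPr hl) (max_idPl hl).
rewrite in_itv/= => /andP[t0 t1]; rewrite b0 sub0r => e; exists t.
  by rewrite !ler0_norm// lerN2.
split; last by apply: oppr_inj; rewrite opprB e mulrN.
apply: cbt; first by rewrite !ler0_norm// lerN2.
by rewrite (min_idPr hl) (max_idPl hl) t0.
Qed.

Lemma dC_cont_eps j u (e : R) : cube u -> 0 < e -> exists2 r : R, 0 < r &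
  forall v, cube v -> (forall k, `|u ord0 k - v ord0 k| < r) -> `|dC j u - dC j v| <= e.
Proof.
move=> cu e0.
have /cvgrPdist_le /(_ e e0) := (subspace_continuousP (@cube R d) (dC j)).1 (@hdCcont j) u cu.
rewrite near_withinE => /nbhs_ballP[r /= r0 hr]; exists r => // v cv uv.
by apply: hr => //; split => // i k; rewrite !ord1; exact: uv.
Qed.

(** Coordinates equal to 0 or 1 are kept fixed, so small shifts stay in the cube whatever the sign
    of [s j]. Nothing is lost, as the marginal process is almost surely 0 there
    ([alpha_boundary]). *)
Definition interior_dir (u : pt) (s : 'I_d -> R) (j : 'I_d) : R :=
  if 0 < u ord0 j < 1 then s j else 0.

Definition shift_pt (u : pt) (s : 'I_d -> R) (t : R) : pt :=
  \row_j (u ord0 j + t * interior_dir u s j).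

Lemma shift_pt_cube (u : pt) (s : 'I_d -> R) : cube u -> exists2 r : R, 0 < r &
  forall t, 0 <= t -> t < r -> forall j, 0 < u ord0 j < 1 ->
    0 < u ord0 j + t * s j < 1.
Proof.
move=> cu.
pose g j : R := if 0 < u ord0 j < 1 then
  Num.min (u ord0 j) (1 - u ord0 j) / (1 + `|s j|) else 1.
have g0 j : 0 < g j.
  rewrite /g; case: ifP => // /andP[a b]; rewrite divr_gt0// ?ltr_wpDr//.
  by rewrite lt_min a subr_gt0.
exists (\big[Num.min/1]_j g j).
  by apply: (big_ind (fun x => 0 < x)) => // x y x0 y0; rewrite lt_min x0.
move=> t t0 tg j uj.
have : t < g j by apply: (lt_le_trans tg); exact: bigmin_le_cond.
have p0 : 0 < 1 + `|s j| by rewrite ltr_wpDr.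
rewrite /g uj ltr_pdivlMr// mulrDr mulr1 lt_min => /andP[h1 h2].
have : `|t * s j| = t * `|s j| by rewrite normrM ger0_norm.
have := ler_norm (t * s j); have := ler_norm (- (t * s j)); rewrite normrN => a b c.
by apply/andP; split; lra.
Qed.

(** Continuity of the partial derivatives gives differentiability along [s]: each coordinate move is
    estimated by the mean value theorem at a point where [dC j] is within [e / S] of its value at
    [u]. *)
Lemma C_increment (u : pt) (s : 'I_d -> R) (e : R) : cube u -> 0 < e -> exists2 r : R, 0 < r &
  forall t, 0 < t -> t < r -> cube (shift_pt u s t) /\
  `|t^-1 * (C (shift_pt u s t) - C u) - \sum_j dC j u * interior_dir u s j| <= e.
Proof.
move=> cu e0.
have [r1 r10 hr1] := shift_pt_cube s cu.
pose S := 1 + \sum_j `|s j|.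
have S0 : 0 < S by rewrite ltr_pwDl// sumr_ge0.
have sS j : `|s j| < S.
  rewrite /S (bigD1 j)//= addrCA ltr_pwDr// ?lexx//.
  by rewrite ltr_pwDl// sumr_ge0.
have eS : 0 < e / S by rewrite divr_gt0.
have [r2 r20 hr2] : exists2 r2 : R, 0 < r2 & forall j v, cube v ->
    (forall k, `|u ord0 k - v ord0 k| < r2) -> `|dC j u - dC j v| <= e / S.
  have /choice[g hg] : forall j, exists r : R, 0 < r /\ forall v, cube v ->
      (forall k, `|u ord0 k - v ord0 k| < r) -> `|dC j u - dC j v| <= e / S.
    by move=> j; have [r r0 hr] := dC_cont_eps j cu eS; exists r.
  exists (\big[Num.min/1]_j g j).
    by apply: (big_ind (fun x => 0 < x)) => // [x y x0 y0|j _]; [rewrite lt_min x0|have [] := hg j].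
  move=> j v cv uv; have [_] := hg j; apply => // k; apply: (lt_le_trans (uv k)).
  exact: bigmin_le_cond.
exists (Num.min r1 (r2 / S)); first by rewrite lt_min r10 divr_gt0.
move=> t t0; rewrite lt_min => /andP[tr1 tr2].
have tS : t * S < r2 by rewrite -ltr_pdivlMr.
(* Only coordinates below [m] have been moved, so that consecutive points differ by one [bump] and
   the increments of [C] telescope. *)
pose z (m : nat) : pt := \row_j (u ord0 j + t * (if (j < m)%N then interior_dir u s j else 0)).
have dir_le j : `|interior_dir u s j| <= `|s j|.
  by rewrite /interior_dir; case: ifP => // _; rewrite normr0.
have zin m : cube (z m).
  move=> j; rewrite mxE; case: ifP => _; last by rewrite mulr0 addr0.
  rewrite /interior_dir; case: ifPn => uj; last by rewrite mulr0 addr0.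
  by have /andP[? ?] := hr1 t (ltW t0) tr1 j uj; rewrite !ltW.
have zd : z d = shift_pt u s t by apply/rowP => j; rewrite !mxE ltn_ord.
have z0 : z 0 = u by apply/rowP => j; rewrite !mxE ltn0 mulr0 addr0.
have zS (j : 'I_d) : z j.+1 = bump (z j) j (t * interior_dir u s j).
  apply/rowP => k; rewrite bumpE !mxE ltnS; have [->|kj] := eqVneq k j.
    by rewrite leqnn ltnn mulr0 addr0.
  by rewrite addr0 leq_eqVlt (_ : (nat_of_ord k == j) = false) //; apply/negbTE.
split; first by rewrite -zd.
have key (j : 'I_d) : `|(C (z j.+1) - C (z j)) - dC j u * (t * interior_dir u s j)| <=
    e / S * (t * `|s j|).
  have [uj|uj] := boolP (0 < u ord0 j < 1); last first.
    rewrite zS /interior_dir (negbTE uj) mulr0 /bump scale0r addr0 subrr mulr0 subr0 normr0.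
    by rewrite mulr_ge0 ?(ltW eS)// mulr_ge0// ltW.
  have zj : z j ord0 j = u ord0 j by rewrite mxE ltnn mulr0 addr0.
  have sj : interior_dir u s j = s j by rewrite /interior_dir uj.
  have [||th thl [cth e1]] := @C_mvt j (z j) (t * interior_dir u s j) (zin j).
  - by rewrite zj.
  - by rewrite zj sj; exact: hr1 (ltW t0) tr1 j uj.
  rewrite zS e1 -mulrBl normrM normrM (gtr0_norm t0) sj distrC.
  rewrite ler_wpM2r ?mulr_ge0 ?(ltW t0)//; apply: hr2 => // k.
  rewrite bumpE mxE.
  have e2 (a b c : R) : a - (a + b + c) = - (b + c) by ring.
  rewrite e2.
  rewrite normrN; case: eqP => [->|_].
    rewrite ltnn mulr0 add0r (le_lt_trans thl)// normrM (gtr0_norm t0).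
    by apply: le_lt_trans tS; rewrite ler_pM2l// (le_trans (dir_le j))// ltW.
  rewrite addr0 normrM (gtr0_norm t0); apply: le_lt_trans tS; rewrite ler_pM2l//.
  case: ifP => _; first by rewrite (le_trans (dir_le k))// ltW.
  by rewrite normr0 ltW.
have tele : C (shift_pt u s t) - C u = \sum_(j < d) (C (z j.+1) - C (z j)).
  by rewrite -(big_mkord xpredT (fun m => C (z m.+1) - C (z m))) telescope_sumr// zd z0.
rewrite tele mulr_sumr -sumrB.
rewrite (eq_bigr (fun j : 'I_d => t^-1 * ((C (z j.+1) - C (z j)) - dC j u * (t * interior_dir u s j)))); last first.
  by move=> j _; field; rewrite gt_eqF.
apply: (le_trans (ler_norm_sum _ _ _)).
apply: (@le_trans _ _ (\sum_(j < d) (e / S * `|s j|))).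
  apply: ler_sum => j _; rewrite normrM gtr0_norm ?invr_gt0// ler_pdivrMl//.
  by rewrite [leRHS]mulrCA; exact: key.
rewrite -mulr_sumr mulrAC ler_pdivrMr// ler_pM2l//.
by rewrite /S lerDr.
Qed.

End CubeCalculus.

(** * The empirical copula process *)

Section EmpiricalProcess.
Context {R : realType} {d : nat}.
Context {dO : measure_display} {Omega : measurableType dO}.
Variable P : probability Omega R.
Variable U : nat -> 'I_d -> Omega -> R.
Hypothesis hUmeas : forall i j, measurable_fun setT (U i j).
Hypothesis hUind : independent_vectors P U.
Hypothesis hUid : forall (i : nat) (x : 'rV[R]_d),
     P [set w | forall j, U i j w <= x ord0 j] =
     P [set w | forall j, U 0%N j w <= x ord0 j].
Hypothesis hUunif : forall (j : 'I_d) (x : R), 0 <= x <= 1 ->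
     P [set w | U 0%N j w <= x] = x%:E.
Variable C : 'rV[R]_d -> R.
Hypothesis hC : forall u, cube u ->
  (C u)%:E = P [set w | forall j, U 0%N j w <= u ord0 j].
Variable dC : 'I_d -> 'rV[R]_d -> R.
Hypothesis dC1 : forall j u, cube u -> `|dC j u| <= 1.
Notation E X := (Rintegral P setT X).
Notation pt := 'rV[R]_d.

Definition alpha (n : nat) (u : pt) (w : Omega) : R :=
  (Num.sqrt n%:R)^-1 * \sum_(i < n) (\1_(orth U i u) w - C u).

Definition beta (n : nat) (u : pt) (w : Omega) : R :=
  alpha n u w - \sum_j dC j u * alpha n (only_coord u j) w.

(** The inequality is strict because it arises from membership of [u] in the box from the rank
    vector to 1, which is open on the left. *)
Definition emp_cop (n : nat) (u : pt) (w : Omega) : R :=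
  n%:R^-1 * \sum_(i < n)
    [forall j, edf (fun k => U k j w) n (U i j w) < u ord0 j]%R%:R.

Definition gam (n : nat) (u : pt) (w : Omega) : R :=
  Num.sqrt n%:R * (emp_cop n u w - C u).

Let PT : fine (P setT) = 1. Proof. exact: fineP_setT. Qed.

Let mo i u : measurable (orth U i u) := orth_measurable hUmeas i u.

Lemma alpha_bmf n u : bmf (alpha n u).
Proof.
apply: bmfZ; apply: bmf_sum => i _; apply: bmfB; last exact: bmf_cst.
exact: bmf_indic.
Qed.

Lemma beta_bmf n u : bmf (beta n u).
Proof.
apply: bmfB; first exact: alpha_bmf.
by apply: bmf_sum => j _; apply: bmfZ; exact: alpha_bmf.
Qed.

Section LinearCombination.
Variables (I : finType) (a : I -> R) (x : I -> pt).
Hypothesis cx : forall p, cube (x p).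

(** The common variance of the linear combinations of [alpha] and of the Gaussian field at the
    points [x p]. *)
Definition cov_form : R :=
  \sum_p \sum_q a p * a q * (C (ptmin (x p) (x q)) - C (x p) * C (x q)).

Let A (i : nat) p := orth U i (x p).
Let m p := C (x p).

Let genA i p : gen_events (U i) (A i p).
Proof. exact: (@orth_gen _ _ _ _ U i (x p)). Qed.

Let mE i p : fine (P (A i p)) = m p.
Proof. exact: (fineP_orth hUid hC i (cx p)). Qed.

Let varE i : E (fun w => xi A a m i w ^+ 2) = cov_form.
Proof.
transitivity (E (fun w => xi A a m i w * xi A a m i w)).
  by apply: eq_Rintegral => w _; rewrite expr2.
rewrite (E_xi_prod hUmeas genA a mE); apply: eq_bigr => p _; apply: eq_bigr => q _.
rewrite /A orthI (fineP_orth hUid hC)//; exact: cube_ptmin.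
Qed.

Lemma lin_alphaE n w : \sum_p a p * alpha n (x p) w =
  (Num.sqrt n%:R)^-1 * partial_xi A a m n w.
Proof.
rewrite /partial_xi /xi exchange_big/= mulr_sumr; apply: eq_bigr => p _.
by rewrite /alpha mulrCA -mulr_sumr.
Qed.

Lemma cov_form_ge0 : 0 <= cov_form.
Proof. by rewrite -(varE 0); apply: E_ge0 => w; exact: sqr_ge0. Qed.

Lemma E_lin_alpha_sqr n : (0 < n)%N ->
  E (fun w => (\sum_p a p * alpha n (x p) w) ^+ 2) = cov_form.
Proof.
move=> n0; have nR : 0 < n%:R :> R by rewrite ltr0n.
have bS : bmf (partial_xi A a m n).
  by apply: bmf_sum => i _; exact: (bmf_xi hUmeas genA).
transitivity (E (fun w => n%:R^-1 * partial_xi A a m n w ^+ 2)).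
  by apply: eq_Rintegral => w _; rewrite lin_alphaE exprMn exprVn sqr_sqrtr.
rewrite EZ; last exact: bmf_sqr.
by rewrite (E_partial_xi_sqr hUmeas hUind genA mE varE) mulrA mulVf ?mul1r// gt_eqF.
Qed.

Lemma clt_lin_alpha h : smoothe h ->
  (fun n => E (fun w => h (\sum_p a p * alpha n (x p) w))) @ \oo --> gaussT cov_form h 0.
Proof.
move=> sh; have := clt_smooth hUmeas hUind genA mE varE sh.
by under eq_fun do under eq_Rintegral do rewrite -lin_alphaE.
Qed.

End LinearCombination.

(** [C_var] bounds the variance of the increment independently of [n], and [le_eta_sqr] converts
    this into a first moment. *)
Lemma E_alpha_diff n u v eta : (0 < n)%N -> cube u -> cube v -> 0 < eta ->
  E (fun w => `|alpha n u w - alpha n v w|) <= eta + dist1 u v / eta.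
Proof.
move=> n0 cu cv e0.
pose a (b : bool) : R := if b then 1 else -1.
pose x (b : bool) := if b then u else v.
have cx b : cube (x b) by case: b.
have := E_lin_alpha_sqr a cx n0; rewrite /cov_form !big_bool/= => h.
have lin w : \sum_b a b * alpha n (x b) w = alpha n u w - alpha n v w.
  by rewrite big_bool/= mul1r mulN1r.
have h2 : E (fun w => (alpha n u w - alpha n v w) ^+ 2) <= dist1 u v.
  have -> : E (fun w => (alpha n u w - alpha n v w) ^+ 2) =
      E (fun w => (\sum_b a b * alpha n (x b) w) ^+ 2).
    by apply: eq_Rintegral => w _; rewrite lin.
  rewrite h /a/x/= (ptminC v u).
  have mm z : ptmin z z = z by apply/rowP => j; rewrite mxE minxx.
  rewrite !mm; apply: le_trans (C_var hUmeas hUid hUunif hC cu cv).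
  have := sqr_ge0 (C u - C v); nra.
have bD : bmf (fun w => alpha n u w - alpha n v w) by apply: bmfB; exact: alpha_bmf.
apply: (@le_trans _ _ (E (fun w => eta + eta^-1 * (alpha n u w - alpha n v w) ^+ 2))).
  apply: leE; first exact: bmf_norm.
    by apply: bmfD; [exact: bmf_cst|apply: bmfZ; exact: bmf_sqr].
  by move=> w; rewrite (mulrC eta^-1); exact: le_eta_sqr.
rewrite ED; [|exact: bmf_cst|by apply: bmfZ; exact: bmf_sqr].
rewrite Ecst PT mulr1 lerD2l EZ; last exact: bmf_sqr.
by rewrite mulrC ler_pM2r ?invr_gt0.
Qed.

Lemma E_alpha_sqr n u : (0 < n)%N -> cube u -> E (fun w => alpha n u w ^+ 2) <= 1.
Proof.
move=> n0 cu.
have := @E_lin_alpha_sqr unit (fun=> 1) (fun=> u) (fun=> cu) n n0.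
have -> : E (fun w => (\sum_(p : unit) 1 * alpha n u w) ^+ 2) = E (fun w => alpha n u w ^+ 2).
  by apply: eq_Rintegral => w _; rewrite sumr_const card_unit mulr1n mul1r.
move=> ->; rewrite /cov_form !sumr_const card_unit !mulr1n !mul1r.
have -> : ptmin u u = u by apply/rowP => j; rewrite mxE minxx.
have /andP[c0 c1] := C_01 hUmeas hUid hC cu; nra.
Qed.

Lemma E_alpha_le n u : (0 < n)%N -> cube u -> E (fun w => `|alpha n u w|) <= 2.
Proof.
move=> n0 cu; have ba := alpha_bmf n u.
apply: (@le_trans _ _ (E (fun w => 1 + alpha n u w ^+ 2))).
  apply: leE; first exact: bmf_norm.
    by apply: bmfD; [exact: bmf_cst|exact: bmf_sqr].
  by move=> w; have := le_eta_sqr (alpha n u w) ltr01; rewrite divr1.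
rewrite ED; [|exact: bmf_cst|exact: bmf_sqr].
rewrite Ecst PT mulr1 -[leRHS]/(1 + 1) lerD2l; exact: E_alpha_sqr.
Qed.

(** At a [good] sample point all other coordinates are below 1, so the orthant at [only_coord u j]
    reduces to a half-line event. *)
Lemma alpha_only_coord n u j w : (0 < n)%N -> cube u -> good U w ->
  alpha n (only_coord u j) w =
  Num.sqrt n%:R * (edf (fun k => U k j w) n (u ord0 j) - u ord0 j).
Proof.
move=> n0 cu [gw _]; have nR : 0 < n%:R :> R by rewrite ltr0n.
have sR : 0 < Num.sqrt n%:R :> R by rewrite sqrtr_gt0.
rewrite /alpha /edf (C_only_coord hUmeas hUid hUunif hC j cu).
rewrite sumrB sumr_const card_ord.
have -> : \sum_(i < n) \1_(orth U i (only_coord u j)) w =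
    \sum_(i < n) (if U i j w <= u ord0 j then 1 else 0) :> R.
  apply: eq_bigr => i _; rewrite indicE; case: ifPn => h.
    rewrite mem_set// => k; rewrite mxE; case: eqP => [->//|_].
    by have /andP[_ /ltW] := gw i k.
  by rewrite memNset// => /(_ j); rewrite mxE eqxx; apply/negP.
set S := \sum_(i < n) _.
rewrite -[X in _ * (_ - X)]mulr_natl -{2 4}(sqr_sqrtr (ltW nR)).
by field; rewrite gt_eqF.
Qed.

Lemma emp_cop_diff n u x w : (0 < n)%N -> cube u -> good U w ->
  `|emp_cop n u w - n%:R^-1 * \sum_(i < n) \1_(orth U i x) w| <=
  \sum_j (`|u ord0 j - edf (fun k => U k j w) n (x ord0 j)| + n%:R^-1).
Proof.
move=> n0 cu [_ gw]; rewrite /emp_cop -mulrBr -sumrB normrM ger0_norm ?invr_ge0//.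
have ind i : \1_(orth U i x) w = [forall j, U i j w <= x ord0 j]%R%:R :> R.
  rewrite indicE; congr (_%:R); congr nat_of_bool; apply/idP/forallP => [/set_mem h j|h]; first exact: h.
  by apply/mem_set => j; exact: h.
apply: (@le_trans _ _ (n%:R^-1 * \sum_(i < n) \sum_j
  `|(edf (fun k => U k j w) n (U i j w) < u ord0 j)%R%:R - (U i j w <= x ord0 j)%R%:R|)).
  rewrite ler_wpM2l ?invr_ge0//; apply: (le_trans (ler_norm_sum _ _ _)).
  by apply: ler_sum => i _; rewrite ind; exact: forall_indic_diff.
rewrite exchange_big/= mulr_sumr; apply: ler_sum => j _.
apply: (rank_count n0 _ _ (cu j)) => i k e; apply/eqP; apply/negPn/negP => ik.
exact: (gw i k j ik e).
Qed.

(** What remains for a fixed direction [s]: oscillations of the marginal and of the full process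
    over a distance of order [1 / sqrt n], the differentiability defect of [C], and the cost [1 / n]
    of [rank_count] in each coordinate. *)
Definition err_term n u s w : R :=
  let x := shift_pt u s (Num.sqrt n%:R)^-1 in
  \sum_j `|alpha n (only_coord x j) w - alpha n (only_coord u j) w| +
  `|alpha n x w - alpha n u w| +
  `|Num.sqrt n%:R * (C x - C u) - \sum_j dC j u * interior_dir u s j| +
  d%:R / Num.sqrt n%:R.

(** The first sum is small when [s] is close to minus the marginal process, that is, when [x_j] is
    near the empirical quantile of order [u_j]. It occurs twice: once in [emp_cop_diff], once when
    [s] is exchanged for that process in the linear part. *)
Lemma gam_beta_bound n u s w : (0 < n)%N -> cube u ->
  cube (shift_pt u s (Num.sqrt n%:R)^-1) -> good U w ->
  `|gam n u w - beta n u w| <=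
  2 * (\sum_j `|interior_dir u s j + alpha n (only_coord u j) w|) + err_term n u s w.
Proof.
move=> n0 cu cs gw; rewrite /err_term; set x := shift_pt _ _ _; rewrite -/x in cs.
have nR : 0 < n%:R :> R by rewrite ltr0n.
have sR : 0 < Num.sqrt n%:R :> R by rewrite sqrtr_gt0.
set q := Num.sqrt n%:R in sR *.
have q2 : q ^+ 2 = n%:R by rewrite sqr_sqrtr// ltW.
pose H : R := n%:R^-1 * \sum_(i < n) \1_(orth U i x) w.
have HE : q * H = alpha n x w + q * C x.
  rewrite /alpha -/q sumrB sumr_const card_ord mulrBr.
  rewrite -[X in _ - _ * X + _]mulr_natl -q2 /H -q2; field.
  by rewrite gt_eqF.
pose sg := interior_dir u s.
pose al := fun j => alpha n (only_coord u j) w.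
pose alx := fun j => alpha n (only_coord x j) w.
have h1 : `|q * (emp_cop n u w - H)| <=
    \sum_j `|sg j + al j| + \sum_j `|alx j - al j| + d%:R / q.
  rewrite normrM (gtr0_norm sR).
  apply: (@le_trans _ _ (q * \sum_j (`|u ord0 j - edf (fun k => U k j w) n (x ord0 j)| + n%:R^-1))).
    by rewrite ler_pM2l//; exact: emp_cop_diff.
  rewrite mulr_sumr -big_split/=.
  have -> : d%:R / q = \sum_(j < d) q^-1 by rewrite sumr_const card_ord mulr_natl.
  rewrite -big_split/=; apply: ler_sum => j _.
  rewrite mulrDr; apply: lerD; last by rewrite -q2 expr2 invfM mulrA mulfV ?mul1r// gt_eqF.
  rewrite -{1}(gtr0_norm sR) -normrM.
  have -> : q * (u ord0 j - edf (fun k => U k j w) n (x ord0 j)) = - (sg j + al j) - (alx j - al j).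
    rewrite /alx (alpha_only_coord j n0 cs gw) -/q.
    have -> : x ord0 j = u ord0 j + q^-1 * sg j by rewrite mxE.
    by field; rewrite gt_eqF.
  by apply: (le_trans (ler_normB _ _)); rewrite normrN.
have h2 : `|\sum_j dC j u * (sg j + al j)| <= \sum_j `|sg j + al j|.
  apply: (le_trans (ler_norm_sum _ _ _)); apply: ler_sum => j _.
  by rewrite normrM ler_piMl// dC1.
have -> : gam n u w - beta n u w = q * (emp_cop n u w - H) + (alpha n x w - alpha n u w) +
    (q * (C x - C u) - \sum_j dC j u * sg j) + \sum_j dC j u * (sg j + al j).
  have -> : \sum_j dC j u * (sg j + al j) = \sum_j dC j u * sg j + \sum_j dC j u * al j.
    by rewrite -big_split/=; apply: eq_bigr => j _; rewrite mulrDr.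
  have e : q * (emp_cop n u w - H) = q * emp_cop n u w - q * H by ring.
  by rewrite e HE /gam /beta -/q; ring.
apply: (le_trans (ler_normD _ _)); apply: (le_trans (lerD (ler_normD _ _) (lexx _))).
apply: (le_trans (lerD (lerD (ler_normD _ _) (lexx _)) (lexx _))).
move: h1 h2; rewrite mulr2n mulrDl mul1r -/q.
set a1 := `|q * _|; set a2 := \sum_j `|sg j + al j|; set a3 := `|\sum_j _|.
by lra.
Qed.

End EmpiricalProcess.

Lemma measurable_bool_natmul {d0 : measure_display} {T : measurableType d0} {R : realType}
  (f : T -> bool) : measurable_fun setT f -> measurable_fun setT (fun w => (f w)%:R : R).
Proof.
move=> mf; rewrite (_ : (fun w => _) = fun w => if f w then 1 else 0 : R).
  exact: measurable_fun_ifT.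
by apply/funext => w; case: (f w).
Qed.

Lemma measurable_prod_fun {d0 : measure_display} {T : measurableType d0} {R : realType}
  (I : Type) (r : seq I) (f : I -> T -> R) : (forall i, measurable_fun setT (f i)) ->
  measurable_fun setT (fun w => \prod_(i <- r) f i w).
Proof.
move=> mf; elim: r => [|i r IH].
  rewrite (_ : (fun w => _) = fun=> 1); first exact: measurable_cst.
  by apply/funext => w; rewrite big_nil.
rewrite (_ : (fun w => _) = fun w => f i w * \prod_(i <- r) f i w).
  exact: measurable_funM.
by apply/funext => w; rewrite big_cons.
Qed.

(** As a product, the indicator of an orthant or a cell can be shown measurable one coordinate at a
    time. *)
Lemma forallb_prod {R : realType} (I : finType) (a : pred I) :
  [forall j, a j]%:R = \prod_j (a j)%:R :> R.
Proof.
have [/forallP h|/forallPn[j ja]] := boolP [forall j, a j].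
  by rewrite big1// => j _; rewrite h.
by rewrite (bigD1 j)//= (negbTE ja) mul0r.
Qed.

Lemma Rd_coord_measurable {R : realType} {d : nat} (j : 'I_d) :
  measurable_fun setT (fun u : Rd R d => (u : 'rV[R]_d) ord0 j).
Proof.
apply: (@measurability _ _ _ _ _ _ (@RGenOpens.G R) (RGenOpens.measurableE R)) => // _ [_ [a [b ->]] <-].
rewrite setTI; apply: sub_sigma_algebra.
have /continuousP := @coord_continuous R 1 d ord0 j; apply.
exact: interval_open.
Qed.

(** * Convergence in mean at a fixed point of the cube *)

Section PointwiseConvergence.
Context {R : realType} {d : nat}.
Context {dO : measure_display} {Omega : measurableType dO}.
Variable P : probability Omega R.
Variable U : nat -> 'I_d -> Omega -> R.
Hypothesis hUmeas : forall i j, measurable_fun setT (U i j).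
Hypothesis hUind : independent_vectors P U.
Hypothesis hUid : forall (i : nat) (x : 'rV[R]_d),
     P [set w | forall j, U i j w <= x ord0 j] =
     P [set w | forall j, U 0%N j w <= x ord0 j].
Hypothesis hUunif : forall (j : 'I_d) (x : R), 0 <= x <= 1 ->
     P [set w | U 0%N j w <= x] = x%:E.
Variable C : 'rV[R]_d -> R.
Hypothesis hC : forall u, cube u ->
  (C u)%:E = P [set w | forall j, U 0%N j w <= u ord0 j].
Variable dC : 'I_d -> 'rV[R]_d -> R.
Hypothesis hdC : forall j u, cube u -> partial_deriv_cube C j u (dC j u).
Hypothesis hdCcont : forall j, {within @cube R d, continuous (dC j)}.
Notation E X := (Rintegral P setT X).
Notation pt := 'rV[R]_d.

Let PT : fine (P setT) = 1. Proof. exact: fineP_setT. Qed.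
Let Clip := C_lip hUmeas hUid hUunif hC.
Let dC1 := dC_le1 Clip hdC.
Let Phalf := P_half hUmeas hUid hUunif hC.

Lemma edf_rank_measurable n i j :
  measurable_fun setT (fun w => edf (fun k => U k j w) n (U i j w)).
Proof.
apply: measurable_funM => //; apply: measurable_sum => k.
apply: measurable_fun_ifT => //; exact: measurable_fun_ler.
Qed.

Lemma emp_cop_joint_measurable n :
  measurable_fun setT (fun wu : Omega * Rd R d => emp_cop U n wu.2 wu.1).
Proof.
apply: measurable_funM => //; apply: measurable_sum => i.
rewrite (_ : (fun wu => _) = fun wu : Omega * Rd R d =>
  \prod_j (edf (fun k => U k j wu.1) n (U i j wu.1) < (wu.2 : pt) ord0 j)%R%:R); last first.
  by apply/funext => wu; rewrite -forallb_prod.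
apply: measurable_prod_fun => j; apply: measurable_bool_natmul.
apply: measurable_fun_ltr.
  by apply: measurableT_comp (edf_rank_measurable n i j) _.
by apply: measurableT_comp (Rd_coord_measurable j) _.
Qed.

Lemma emp_cop_01 n u w : 0 <= emp_cop U n u w <= 1.
Proof.
rewrite /emp_cop mulr_ge0 ?invr_ge0 ?sumr_ge0//=.
have [->|n0] := posnP n; first by rewrite big_ord0 mulr0 ler01.
rewrite mulrC ler_pdivrMr ?ltr0n// mul1r.
apply: (@le_trans _ _ (\sum_(i < n) 1)); last by rewrite sumr_const card_ord.
by apply: ler_sum => i _; rewrite lern1 leq_b1.
Qed.

Lemma gam_bmf n u : bmf (gam U C n u).
Proof.
apply: bmfZ; apply: bmfB; last exact: bmf_cst.
apply: (@bmf_section2 _ _ Omega (Rd R d) R (fun wu => emp_cop U n wu.2 wu.1) u).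
split; first exact: emp_cop_joint_measurable.
exists 1 => wu; have /andP[h0 h1] := emp_cop_01 n wu.2 wu.1.
by rewrite ger0_norm.
Qed.

Lemma err_term_bmf n u s : bmf (err_term U C dC n u s).
Proof.
have ba v := alpha_bmf hUmeas C n v.
apply: bmfD; last exact: bmf_cst.
apply: bmfD; last exact: bmf_cst.
apply: bmfD; last by apply: bmf_norm; exact: bmfB.
by apply: bmf_sum => j _; apply: bmf_norm; exact: bmfB.
Qed.

Lemma inv_sqrt_small (r : R) : 0 < r -> exists n0, forall n, (n0 <= n)%N ->
  (0 < n)%N /\ (Num.sqrt n%:R)^-1 < r.
Proof.
move=> r0; exists (Num.truncn (r^-1 ^+ 2)).+1 => n hn.
have n0 : (0 < n)%N by exact: leq_trans hn.
split => //; have nR : 0 < n%:R :> R by rewrite ltr0n.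
rewrite -[ltRHS]invrK ltf_pV2 ?posrE ?invr_gt0 ?sqrtr_gt0//.
rewrite -[ltLHS](ger0_norm (ltW _)) ?invr_gt0// -sqrtr_sqr ltr_sqrt//.
by apply: (lt_le_trans (truncnS_gt _)); rewrite ler_nat.
Qed.

Lemma dist1_shift (u : pt) (s : 'I_d -> R) (t : R) : 0 <= t -> dist1 (shift_pt u s t) u <= t * \sum_j `|s j|.
Proof.
move=> t0; rewrite /dist1 mulr_sumr; apply: ler_sum => j _.
rewrite mxE addrAC subrr add0r normrM (ger0_norm t0) ler_wpM2l//.
by rewrite /interior_dir; case: ifP => // _; rewrite normr0.
Qed.

Lemma dist1_oc (x u : pt) j : dist1 (only_coord x j) (only_coord u j) <= dist1 x u.
Proof.
rewrite /dist1; apply: ler_sum => k _; rewrite !mxE; case: eqP => [->//|_].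
by rewrite subrr normr0.
Qed.

Lemma E_err_term_cvg (u : pt) (s : 'I_d -> R) (e : R) : cube u -> 0 < e -> exists n0, forall n, (n0 <= n)%N ->
  [/\ (0 < n)%N, cube (shift_pt u s (Num.sqrt n%:R)^-1) &
  E (err_term U C dC n u s) <= e].
Proof.
move=> cu e0.
pose D : R := d%:R + 1.
have D0 : 0 < D by rewrite ltr_wpDl.
(* The [d + 1] oscillations cost [2 eta] each, hence [e / 2] in all; the two deterministic terms
   cost [e / 4] each. *)
pose eta := e / 4 / D.
have eta0 : 0 < eta by rewrite !divr_gt0.
have e4 : 0 < e / 4 by rewrite divr_gt0.
have [r r0 hr] := C_increment hdC hdCcont s cu e4.
pose S : R := \sum_j `|s j|.
have S0 : 0 <= S by exact: sumr_ge0.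
pose r2 := eta * eta / (S + 1).
have S1 : 0 < S + 1 by rewrite ltr_wpDl.
have r20 : 0 < r2 by exact: divr_gt0 (mulr_gt0 eta0 eta0) S1.
pose r3 := e / 4 / D.
have [n0 hn0] := @inv_sqrt_small (Num.min r (Num.min r2 r3)) ltac:(by rewrite !lt_min r0 r20 eta0).
exists n0 => n /hn0[n1]; rewrite !lt_min => /and3P[t1 t2 t3].
set t := (Num.sqrt n%:R)^-1 in t1 t2 t3 *.
have nR : 0 < n%:R :> R by rewrite ltr0n.
have t0 : 0 < t by rewrite invr_gt0 sqrtr_gt0.
have [cx det] := hr t t0 t1.
split => //.
set x := shift_pt u s t in cx det *.
have ba v := alpha_bmf hUmeas C n v.
have dx : dist1 x u / eta <= eta.
  rewrite ler_pdivrMr//; apply: (le_trans (dist1_shift u s (ltW t0))).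
  have : t * (S + 1) <= eta * eta by rewrite -ler_pdivlMr ?ltr_wpDl// ltW.
  by rewrite mulrDr mulr1 -/S; have := t0; lra.
have bd v y : cube v -> cube y -> dist1 v y <= dist1 x u ->
    E (fun w => `|alpha U C n v w - alpha U C n y w|) <= eta + eta.
  move=> cv cy vy.
  apply: (le_trans (E_alpha_diff hUmeas hUind hUid hUunif hC n1 cv cy eta0)).
  by rewrite lerD2l; apply: le_trans dx; rewrite ler_pM2r ?invr_gt0.
rewrite /err_term -/t -/x.
have b1 : bmf (fun w => \sum_j `|alpha U C n (only_coord x j) w - alpha U C n (only_coord u j) w|).
  by apply: bmf_sum => j _; apply: bmf_norm; exact: bmfB.
have b2 : bmf (fun w => `|alpha U C n x w - alpha U C n u w|) by apply: bmf_norm; exact: bmfB.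
rewrite ED; [|by apply: bmfD; [exact: bmfD|exact: bmf_cst]|exact: bmf_cst].
rewrite ED; [|exact: bmfD|exact: bmf_cst].
rewrite ED// !Ecst !PT !mulr1.
have p1 : E (fun w => \sum_j `|alpha U C n (only_coord x j) w - alpha U C n (only_coord u j) w|) <=
    d%:R * (eta + eta).
  rewrite Esum; last by move=> j _; apply: bmf_norm; exact: bmfB.
  apply: (@le_trans _ _ (\sum_(j < d) (eta + eta))).
    apply: ler_sum => j _; apply: bd; [exact: cube_only_coord..|exact: dist1_oc].
  by rewrite sumr_const card_ord mulr_natl.
have p2 := bd x u cx cu (lexx _).
have p3 : `|Num.sqrt n%:R * (C x - C u) - \sum_j dC j u * interior_dir u s j| <= e / 4.
  by move: det; rewrite /t invrK.
have p4 : d%:R / Num.sqrt n%:R <= e / 4.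
  rewrite -/t; apply: (@le_trans _ _ (D * t)).
    by rewrite ler_wpM2r ?(ltW t0)// lerDl.
  by rewrite mulrC -ler_pdivlMr// ltW.
have eD : D * (eta + eta) = e / 2.
  by rewrite /eta; field; rewrite gt_eqF.
have {}eD : d%:R * (eta + eta) + (eta + eta) = e / 2 by rewrite -eD /D; ring.
apply: (le_trans (lerD (lerD (lerD p1 p2) p3) p4)); rewrite eD.
by have := e0; lra.
Qed.

Lemma alpha_boundary n u j w : (0 < n)%N -> cube u -> good U w ->
  ~~ (0 < u ord0 j < 1) -> alpha U C n (only_coord u j) w = 0.
Proof.
move=> n0 cu gw uj; rewrite (alpha_only_coord hUmeas hUid hUunif hC j n0 cu gw).
have nR : 0 < n%:R :> R by rewrite ltr0n.
have /andP[u0 u1] := cu j; have [gw1 _] := gw.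
move: uj; rewrite negb_and -!leNgt => /orP[h|h].
  have -> : u ord0 j = 0 by apply/eqP; rewrite eq_le h u0.
  rewrite /edf big1 ?mulr0 ?subrr ?mulr0// => i _.
  by have /andP[h1 _] := gw1 i j; rewrite leNgt h1.
have -> : u ord0 j = 1 by apply/eqP; rewrite eq_le h u1.
rewrite /edf (eq_bigr (fun=> 1)); last first.
  by move=> i _; have /andP[_ h1] := gw1 i j; rewrite ltW.
by rewrite sumr_const card_ord mulVf ?subrr ?mulr0// gt_eqF.
Qed.

(** The grid of mesh [1 / N] on [[-N, N]], whence [2 N^2 + 1] values for each coordinate; the index
    [N^2] is the value 0. *)
Definition grid_dir (N : nat) (k : {ffun 'I_d -> 'I_(2 * (N * N)).+1}) (j : 'I_d) : R :=
  ((k j)%:R - (N * N)%:R) / N%:R.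

Lemma grid_near (N : nat) (y : R) : (0 < N)%N -> `|y| <= N%:R ->
  exists k : 'I_(2 * (N * N)).+1, `|(k%:R - (N * N)%:R) / N%:R - y| <= N%:R^-1.
Proof.
move=> N0; rewrite ler_norml => /andP[y1 y2].
have NR : 0 < N%:R :> R by rewrite ltr0n.
have z0 : 0 <= N%:R * (y + N%:R) by apply: mulr_ge0; [exact: ltW|lra].
have /andP[t1 t2] := truncn_itv z0.
have tN : (Num.truncn (N%:R * (y + N%:R)) < (2 * (N * N)).+1)%N.
  rewrite ltnS -(ler_nat R); apply: (le_trans t1).
  rewrite !natrM (mulrCA 2%:R) ler_pM2l// mulr_natl mulr2n lerD2r//.
exists (Ordinal tN) => /=; set k := Num.truncn _ in t1 t2 *.
rewrite (_ : _ - y = (k%:R - N%:R * (y + N%:R)) / N%:R); last first.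
  by rewrite natrM; field; rewrite gt_eqF.
rewrite normrM (gtr0_norm (x := N%:R^-1)) ?invr_gt0// ler_piMl ?invr_ge0 ?(ltW NR)//.
rewrite distrC ger0_norm ?subr_ge0//.
by move: t2; rewrite -natr1; lra.
Qed.

Lemma sqr_sum_le (a : 'I_d -> R) : (\sum_j `|a j|) ^+ 2 <= d%:R * \sum_j a j ^+ 2.
Proof.
rewrite expr2 mulr_suml.
apply: (@le_trans _ _ (\sum_j \sum_k (a j ^+ 2 / 2 + a k ^+ 2 / 2))).
  apply: ler_sum => j _; rewrite mulr_sumr; apply: ler_sum => k _.
  rewrite -(real_normK (num_real (a j))) -(real_normK (num_real (a k))).
  by have := sqr_ge0 (`|a j| - `|a k|); nra.
rewrite (eq_bigr (fun j => d%:R * (a j ^+ 2 / 2) + \sum_k (a k ^+ 2 / 2))); last first.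
  by move=> j _; rewrite big_split/= sumr_const card_ord mulr_natl.
rewrite big_split/= -mulr_sumr [X in _ + X]sumr_const card_ord -[X in _ + X]mulr_natl -mulrDr.
by rewrite -big_split/=; under eq_bigr do rewrite -splitr.
Qed.

(** [N] is chosen before [n], so the sum of the error terms over the finite grid still tends to 0 in
    mean. Where the marginal process leaves [[-N, N]], the zero direction and second moments take
    over. *)
Lemma gam_beta_cvg u e : cube u -> 0 < e -> exists n0, forall n, (n0 <= n)%N ->
  E (fun w => `|gam U C n u w - beta U C dC n u w|) <= e.
Proof.
move=> cu e0.
(* [B / N] is the expectation bound for the main term: [2 d / N] from the mesh and [2 d / N] times
   the [d] second moments, each at most 1. *)
pose B : R := 2 * d%:R + 2 * (d%:R * d%:R).
have B0 : 0 <= B by rewrite addr_ge0 ?mulr_ge0.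
pose N := (Num.truncn (2 * B / e)).+1.
have NR : 0 < N%:R :> R by rewrite ltr0n.
have BN : B / N%:R <= e / 2.
  have : 2 * B / e < N%:R by exact: truncnS_gt.
  by rewrite ltr_pdivrMr// ler_pdivrMr//; lra.
pose K := {ffun 'I_d -> 'I_(2 * (N * N)).+1}.
pose e' := e / 2 / (#|K|%:R + 1).
have e'0 : 0 < e' by rewrite !divr_gt0// ltr_wpDl.
have /choice[g hg] := fun k : K => E_err_term_cvg (grid_dir k) cu e'0.
exists (\max_k g k) => n hn.
have hk k := hg k n (leq_trans (leq_bigmax k) hn).
have z0 : K by exact: [ffun=> ord0].
have n0 : (0 < n)%N by have [] := hk z0.
have [Ns [mN N0 gN]] := good_ae hUmeas hUind Phalf.
have ba v := alpha_bmf hUmeas C n v.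
have bgb := bmfB (gam_bmf n u) (beta_bmf hUmeas C dC n u).
pose al j w := alpha U C n (only_coord u j) w.
have bal j : bmf (al j) by exact: ba.
have bsq : bmf (fun w => \sum_j al j w ^+ 2) by apply: bmf_sum => j _; exact: bmf_sqr.
have berr : bmf (fun w => \sum_(k : K) err_term U C dC n u (grid_dir k) w).
  by apply: bmf_sum => k _; exact: err_term_bmf.
pose F w := 2 * d%:R / N%:R + (2 * d%:R / N%:R * (\sum_j al j w ^+ 2) +
  \sum_(k : K) err_term U C dC n u (grid_dir k) w).
apply: (@le_trans _ _ (E F)).
  apply: (leE_ae mN N0); first exact: bmf_norm.
    by apply: bmfD; [exact: bmf_cst|apply: bmfD => //; exact: bmfZ].
  move=> w /gN gw.
  have errp k : 0 <= err_term U C dC n u (grid_dir k) w.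
    rewrite /err_term !addr_ge0// ?divr_ge0 ?sqrtr_ge0//.
    by apply: sumr_ge0.
  have [k kb] : exists k : K, \sum_j `|interior_dir u (grid_dir k) j + al j w| <=
      d%:R / N%:R + d%:R / N%:R * (\sum_j al j w ^+ 2).
    have intle (k : K) j : `|interior_dir u (grid_dir k) j + al j w| <= `|grid_dir k j + al j w|.
      rewrite /interior_dir; case: ifPn => // uj.
      by rewrite add0r /al (alpha_boundary n0 cu gw uj) normr0.
    have [allN|] := pselect (forall j, `|al j w| <= N%:R).
      have /choice[kk hkk] : forall j, exists k : 'I_(2 * (N * N)).+1,
          `|(k%:R - (N * N)%:R) / N%:R - - al j w| <= N%:R^-1.
        by move=> j; apply: grid_near => //; rewrite normrN.
      exists [ffun j => kk j]; rewrite -[leLHS]addr0 lerD//; last first.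
        by rewrite mulr_ge0 ?divr_ge0// sumr_ge0// => j _; exact: sqr_ge0.
      apply: (@le_trans _ _ (\sum_(j < d) N%:R^-1)).
        apply: ler_sum => j _; apply: (le_trans (intle _ j)).
        by have := hkk j; rewrite opprK /grid_dir ffunE.
      by rewrite sumr_const card_ord mulr_natl.
    move=> /existsNP[j0 /negP]; rewrite -ltNge => hj0.
    have hm : (N * N < (2 * (N * N)).+1)%N by rewrite ltnS leq_pmull.
    (* The middle of the grid, that is, the zero direction. *)
    exists [ffun=> Ordinal hm]; rewrite -[leLHS]add0r lerD ?divr_ge0//.
    apply: (@le_trans _ _ (\sum_j `|al j w|)).
      apply: ler_sum => j _; apply: (le_trans (intle _ j)).
      by rewrite /grid_dir ffunE/= subrr mul0r add0r.
    (* A sum of at least [N] is bounded by its square over [N], which [sqr_sum_le] compares with the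
       sum of squares. *)
    have sN : N%:R <= \sum_j `|al j w|.
      apply: (le_trans (ltW hj0)); rewrite (bigD1 j0)//= lerDl; exact: sumr_ge0.
    rewrite mulrAC ler_pdivlMr//; apply: le_trans (sqr_sum_le (fun j => al j w)).
    by rewrite expr2 ler_wpM2l// sumr_ge0.
  have [_ cx _] := hk k.
  apply: (le_trans (gam_beta_bound hUmeas hUid hUunif hC dC1 n0 cu cx gw)).
  have -> : F w = 2 * (d%:R / N%:R + d%:R / N%:R * (\sum_j al j w ^+ 2)) +
      \sum_(k : K) err_term U C dC n u (grid_dir k) w by rewrite /F; ring.
  apply: lerD; first by rewrite ler_pM2l.
  by rewrite (bigD1 k)//= lerDl; apply: sumr_ge0 => i _.
rewrite /F ED; [|exact: bmf_cst|by apply: bmfD => //; exact: bmfZ].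
rewrite ED//; last exact: bmfZ.
rewrite Ecst PT mulr1 EZ// Esum; last by move=> j _; exact: bmf_sqr.
rewrite Esum; last by move=> k _; exact: err_term_bmf.
have q1 : \sum_j E (fun w => al j w ^+ 2) <= d%:R.
  apply: (@le_trans _ _ (\sum_(j < d) 1)); last by rewrite sumr_const card_ord.
  apply: ler_sum => j _.
  by apply: (E_alpha_sqr hUmeas hUind hUid hC n0); exact: cube_only_coord.
have q2 : \sum_(k : K) E (err_term U C dC n u (grid_dir k)) <= e / 2.
  apply: (@le_trans _ _ (\sum_(k : K) e')).
    by apply: ler_sum => k _; have [] := hk k.
  rewrite sumr_const -[leLHS]mulr_natl /e' [leLHS]mulrCA ler_piMr//; first by rewrite divr_ge0// ltW.
  by rewrite ler_pdivrMr ?ltr_wpDl// mul1r lerDl.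
have q3 : 2 * d%:R / N%:R * (\sum_j E (fun w => al j w ^+ 2)) <= 2 * d%:R / N%:R * d%:R.
  by rewrite ler_wpM2l// divr_ge0// mulr_ge0.
have q4 : 2 * d%:R / N%:R + 2 * d%:R / N%:R * d%:R = B / N%:R by rewrite /B; ring.
by move: q2 q3 q4 BN; set X1 := \sum_(k : K) _; set X2 := _ * \sum_j _; lra.
Qed.

(** The majorant for dominated convergence in [u]. In the zero direction only twice the [d] marginal
    terms, of mean at most 2, and [d / sqrt n] survive. *)
Lemma gam_beta_ub n u : (0 < n)%N -> cube u ->
  E (fun w => `|gam U C n u w - beta U C dC n u w|) <= 5 * d%:R.
Proof.
move=> n0 cu.
have [Ns [mN N0 gN]] := good_ae hUmeas hUind Phalf.
have ba v := alpha_bmf hUmeas C n v.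
have bgb := bmfB (gam_bmf n u) (beta_bmf hUmeas C dC n u).
pose al j w := alpha U C n (only_coord u j) w.
have bal j : bmf (al j) by exact: ba.
have bs : bmf (fun w => \sum_j `|al j w|) by apply: bmf_sum => j _; exact: bmf_norm.
have xu : shift_pt u (fun=> 0) (Num.sqrt n%:R)^-1 = u.
  by apply/rowP => j; rewrite mxE /interior_dir if_same mulr0 addr0.
apply: (@le_trans _ _ (E (fun w => 2 * (\sum_j `|al j w|) + d%:R))).
  apply: (leE_ae mN N0); first exact: bmf_norm.
    by apply: bmfD; [exact: bmfZ|exact: bmf_cst].
  move=> w /gN gw.
  have cs : cube (shift_pt u (fun=> 0) (Num.sqrt n%:R)^-1) by rewrite xu.
  apply: (le_trans (gam_beta_bound hUmeas hUid hUunif hC dC1 n0 cu cs gw)).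
  rewrite /err_term xu.
  rewrite (eq_bigr (fun j => `|al j w|)); last first.
    by move=> j _; rewrite /interior_dir if_same add0r.
  rewrite lerD2l big1; last by move=> j _; rewrite subrr normr0.
  rewrite !subrr normr0 mulr0 !add0r big1; last first.
    by move=> j _; rewrite /interior_dir if_same mulr0.
  rewrite oppr0 normr0 add0r ler_pdivrMr ?sqrtr_gt0 ?ltr0n//.
  by rewrite ler_peMr// -[leLHS]sqrtr1 ler_wsqrtr// ler1n.
rewrite ED; [|exact: bmfZ|exact: bmf_cst].
rewrite EZ// Ecst PT mulr1 Esum; last by move=> j _; exact: bmf_norm.
have : \sum_j E (fun w => `|al j w|) <= \sum_(j < d) 2.
  apply: ler_sum => j _.
  by apply: (E_alpha_le hUmeas hUind hUid hC n0); exact: cube_only_coord.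
rewrite sumr_const card_ord -mulr_natl; set X := \sum_j _.
by have := ler0n R d; set D := d%:R; lra.
Qed.

End PointwiseConvergence.

(** * Functions of bounded Hardy-Krause variation *)

Section HardyKrause.
Context {R : realType} {d : nat}.
Notation pt := 'rV[R]_d.
Variable f : pt -> R.

Definition on_face (v : pt) (W : {set 'I_d}) : pt :=
  \row_k (if k \in W then v ord0 k else 1).

Definition all_one : pt := \row_k 1.

Lemma cube_one : cube all_one.
Proof. by move=> k; rewrite mxE ler01 lexx. Qed.

Lemma vertex_one (S T : {set 'I_d}) (v : pt) :
  vertex S T v all_one = on_face v (S :\: T)%SET.
Proof.
apply/rowP => k; rewrite !mxE finset.in_setD.
by case: (k \in S); case: (k \in T).
Qed.

(** The box from [v] to 1 is a cell of the partition with nodes [0], [v_k], [1], so its increment is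
    one term of a Vitali sum. *)
Lemma box_delta_bound M : (forall (S : {set 'I_d}) (m : nat) (p : 'I_d -> 'I_m.+2 -> R),
    S != finset.set0 -> grid_ok p -> vitali_sum f S p <= M) ->
  forall (S : {set 'I_d}) v, S != finset.set0 -> cube v ->
  `|box_delta f S v all_one| <= M.
Proof.
move=> hM S v S0 cv.
pose p (k : 'I_d) (i : 'I_3) : R :=
  if i == 0%N :> nat then 0 else if i == 1%N :> nat then v ord0 k else 1.
have pok : grid_ok p.
  move=> k; split => //; split => // i j; have /andP[v0 v1] := cv k.
  by rewrite /p; case: i => [[|[|[|]]]]//= _; case: j => [[|[|[|]]]]//= _ _; rewrite ?ler01.
apply: le_trans (hM S 1%N p S0 pok).
(* The upper cell in the directions of [S]; elsewhere [vitali_sum] admits only the index [ord0]. *)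
pose i : {ffun 'I_d -> 'I_2} := [ffun k => if k \in S then ord_max else ord0].
rewrite /vitali_sum (bigD1 i)/=; last first.
  by apply/forallP => k; rewrite ffunE; case: (k \in S).
rewrite [X in `|X| <= _](_ : _ = box_delta f S (\row_k p k (inord (i k))) (\row_k p k (inord (i k).+1))).
  by rewrite lerDl; exact: sumr_ge0.
apply: eq_bigr => T _; congr (_ * f _); apply/rowP => k; rewrite !mxE ffunE.
by case: (k \in S) => //; rewrite /p !inordK//= ; case: (k \in T).
Qed.

(** Induction on the dimension of the face. In the alternating sum over the box from [v] to 1 the
    vertex [v] is the only one off the lower-dimensional faces; the whole sum is bounded by the
    variation. *)
Lemma bounded_on_cube : bounded_HK f ->
  exists2 M, 0 <= M & forall v, cube v -> `|f v| <= M.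
Proof.
move=> [M hM].
have key k : exists2 b, 0 <= b & forall v (S : {set 'I_d}), cube v -> (#|S| <= k)%N ->
    `|f (on_face v S)| <= b.
  elim: k => [|k [b b0 hb]].
    exists `|f all_one| => // v S _; rewrite leqn0 finset.cards_eq0 => /eqP ->.
    rewrite (_ : on_face v finset.set0 = all_one)//.
    by apply/rowP => k; rewrite !mxE inE.
  exists (b + (`|M| + \sum_(T : {set 'I_d}) b)).
    by rewrite addr_ge0// addr_ge0// sumr_ge0.
  move=> v S cv Sk; have [S0|S0] := eqVneq S finset.set0.
    apply: (@le_trans _ _ b); first by apply: hb => //; rewrite S0 finset.cards0.
    by rewrite lerDl addr_ge0// sumr_ge0.
  have := box_delta_bound hM S0 cv.
  rewrite /box_delta (bigD1 finset.set0) ?finset.sub0set//= vertex_one finset.setD0.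
  set X := (-1) ^+ _ * _; set Y := \sum_(_ | _) _.
  have XE : `|X| = `|f (on_face v S)| by rewrite normrM normrX normrN1 expr1n mul1r.
  have hY : `|Y| <= \sum_(T : {set 'I_d}) b.
    apply: (le_trans (ler_norm_sum _ _ _)).
    rewrite [leRHS](bigID (fun T : {set 'I_d} => (T \subset S) && (T != finset.set0)))/=.
    rewrite -[leLHS]addr0; apply: lerD; last exact: sumr_ge0.
    apply: ler_sum => T /andP[TS T0].
    rewrite normrM normrX normrN1 expr1n mul1r vertex_one; apply: hb => //.
    rewrite -ltnS; apply: leq_trans Sk; rewrite finset.cardsD (finset.setIidPr TS).
    by rewrite ltn_subrL !finset.card_gt0 T0 S0.
  move=> h; rewrite -XE.
  have := ler_normB (X + Y) Y; rewrite addrK => h2.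
  by have := ler_norm M; lra.
have [b b0 hb] := key d; exists b => // v cv.
have := hb v [set: 'I_d]%SET cv; rewrite finset.cardsT card_ord => /(_ (leqnn _)).
by rewrite (_ : on_face v _ = v)//; apply/rowP => k; rewrite !mxE finset.in_setT.
Qed.

(** Every vertex other than [v] has a coordinate equal to 1, where [fhat] is 0. *)
Lemma box_delta_fhat (v : pt) :
  box_delta (fhat f) [set: 'I_d]%SET v all_one = (-1) ^+ d * fhat f v.
Proof.
rewrite /box_delta (bigD1 finset.set0) ?finset.sub0set//= big1 ?addr0.
  rewrite vertex_one !finset.setD0 finset.cardsT card_ord; congr (_ * fhat f _).
  by apply/rowP => k; rewrite !mxE finset.in_setT.
move=> T /andP[_ /finset.set0Pn[j jT]]; rewrite /fhat ifT ?mulr0//.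
by apply/existsP; exists j; rewrite mxE finset.in_setT jT mxE.
Qed.

Lemma sign_sqr : ((-1) ^+ d * (-1) ^+ d : R) = 1.
Proof. by rewrite -exprMn mulrNN mulr1 expr1n. Qed.

Variables m1 m2 : {finite_measure set (Rd R d) -> \bar R}.
Hypothesis hmubox : forall a b : pt, cube a -> cube b ->
     (forall j, a ord0 j <= b ord0 j) ->
     (m1 (box a b) - m2 (box a b))%E = (box_delta (fhat f) [set: 'I_d]%SET a b)%:E.

Lemma Rd_itv_measurable (B : 'I_d -> set R) : (forall j, measurable (B j)) ->
  measurable [set u : Rd R d | forall j, B j ((u : pt) ord0 j)].
Proof.
move=> mB; rewrite (_ : [set u | _] = \big[setI/setT]_(j : 'I_d)
    ((fun u : Rd R d => (u : pt) ord0 j) @^-1` (B j))).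
  apply: bigsetI_measurable => j _.
  rewrite -[X in measurable X]setTI; exact: (Rd_coord_measurable j).
apply/seteqP; split => w; rewrite -bigcap_seq.
  by move=> h j _; exact: h.
by move=> h j; apply: (h j); rewrite /= mem_index_enum.
Qed.

Lemma box_measurable (a b : pt) : measurable (box a b).
Proof.
rewrite (_ : box a b = [set u : Rd R d | forall j,
   [set` `]a ord0 j, b ord0 j]] ((u : pt) ord0 j)]).
  by apply: (@Rd_itv_measurable (fun j => [set` `]a ord0 j, b ord0 j]])) => j; exact: measurable_itv.
by apply/seteqP; split => u /= h j; have := h j; rewrite /= in_itv.
Qed.

Lemma cubeRd_measurable : measurable (@cubeRd R d).
Proof.
rewrite (_ : @cubeRd R d = [set u : Rd R d | forall j,
   [set` `[(0:R), 1]] ((u : pt) ord0 j)]).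
  by apply: (@Rd_itv_measurable (fun=> [set` `[(0:R), 1]])) => j; exact: measurable_itv.
by apply/seteqP; split => u /= h j; have := h j; rewrite /= in_itv.
Qed.

Lemma fhatE (v : pt) : cube v ->
  fhat f v = (-1) ^+ d * (fine (m1 (box v all_one)) - fine (m2 (box v all_one))).
Proof.
move=> cv; have := hmubox cv cube_one.
rewrite box_delta_fhat => /(_ _)/(congr1 fine); rewrite fineB ?fin_num_measure//; last 2 first.
- exact: box_measurable.
- exact: box_measurable.
move=> -> /=; first by rewrite mulrA sign_sqr mul1r.
by move=> j; rewrite mxE; have /andP[] := cv j.
Qed.

End HardyKrause.

(** * The rank statistic as an integral *)

Section Statistic.
Context {R : realType} {d : nat}.
Context {dO : measure_display} {Omega : measurableType dO}.
Variable U : nat -> 'I_d -> Omega -> R.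
Hypothesis hUmeas : forall i j, measurable_fun setT (U i j).

Definition rank_pt (n i : nat) (w : Omega) : 'rV[R]_d :=
  \row_j edf (fun k => U k j w) n (U i j w).

Lemma cube_rank_pt n i w : (0 < n)%N -> cube (rank_pt n i w).
Proof. by move=> n0 j; rewrite mxE; exact: edf_01. Qed.

Lemma edf_rational (y : nat -> R) n t : exists k : 'I_n.+1, edf y n t = k%:R / n%:R.
Proof.
have h : (\sum_(i < n) (y i <= t)%R < n.+1)%N.
  rewrite ltnS; apply: (@leq_trans (\sum_(i < n) 1)).
    by apply: leq_sum => i _; exact: leq_b1.
  by rewrite sum1_card card_ord.
exists (Ordinal h); rewrite /edf mulrC /= natr_sum; congr (_ / _).
by apply: eq_bigr => i _; case: ifP.
Qed.

(** Ranks are multiples of [1 / n], so [f] is evaluated on a finite grid only and may be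
    arbitrary. *)
Lemma rank_stat_bmf (f : 'rV[R]_d -> R) n i : (0 < n)%N -> bmf (fun w => f (rank_pt n i w)).
Proof.
move=> n0; have nR : n%:R != 0 :> R by rewrite pnatr_eq0 -lt0n.
pose x (k : {ffun 'I_d -> 'I_n.+1}) : 'rV[R]_d := \row_j ((k j)%:R / n%:R).
rewrite (_ : (fun w => _) = fun w => \sum_(k : {ffun 'I_d -> 'I_n.+1})
  f (x k) * \prod_j (edf (fun k => U k j w) n (U i j w) == x k ord0 j)%R%:R); last first.
  apply/funext => w.
  have /choice[k hk] := fun j => edf_rational (fun k => U k j w) n (U i j w).
  have xk : rank_pt n i w = x [ffun j => k j].
    by apply/rowP => j; rewrite !mxE ffunE hk.
  rewrite (bigD1 [ffun j => k j])//= [X in _ + X]big1 ?addr0.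
    by rewrite big1 ?mulr1 ?xk// => j _; rewrite hk mxE ffunE eqxx.
  move=> l lk; have [j lj] : exists j, l j != k j.
    apply/existsP; apply: contra_neqT lk => /existsPn h; apply/ffunP => j.
    by rewrite ffunE; apply/eqP/negPn; exact: h.
  rewrite (bigD1 j)//= hk mxE (inj_eq (mulIf (invr_neq0 nR))) eqr_nat.
  by rewrite eq_sym (inj_eq val_inj) (negbTE lj) mul0r mulr0.
apply: bmf_sum => k _; apply: bmfZ; split.
  apply: measurable_prod_fun => j; apply: measurable_bool_natmul.
  by apply: measurable_fun_eqr => //; exact: edf_rank_measurable.
exists 1 => w; rewrite -forallb_prod ger0_norm// lern1; exact: leq_b1.
Qed.

End Statistic.

Lemma bmf_swap {d1 d2 : measure_display} {T1 : measurableType d1}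
  {T2 : measurableType d2} {R : realType} (F : T1 * T2 -> R) :
  bmf F -> bmf (fun yx : T2 * T1 => F (yx.2, yx.1)).
Proof.
move=> [mF [M hM]]; split; last by exists M => yx.
by have := measurableT_comp mF (@measurable_swap _ _ T2 T1).
Qed.

Section Representation.
Context {R : realType} {d : nat}.
Context {dO : measure_display} {Omega : measurableType dO}.
Variable P : probability Omega R.
Variable U : nat -> 'I_d -> Omega -> R.
Hypothesis hUmeas : forall i j, measurable_fun setT (U i j).
Hypothesis hUind : independent_vectors P U.
Hypothesis hUid : forall (i : nat) (x : 'rV[R]_d),
     P [set w | forall j, U i j w <= x ord0 j] =
     P [set w | forall j, U 0%N j w <= x ord0 j].
Hypothesis hUunif : forall (j : 'I_d) (x : R), 0 <= x <= 1 ->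
     P [set w | U 0%N j w <= x] = x%:E.
Variable C : 'rV[R]_d -> R.
Hypothesis hC : forall u, cube u ->
  (C u)%:E = P [set w | forall j, U 0%N j w <= u ord0 j].
Notation E X := (Rintegral P setT X).
Notation pt := 'rV[R]_d.

Let PT : fine (P setT) = 1. Proof. exact: fineP_setT. Qed.
Let Phalf := P_half hUmeas hUid hUunif hC.

Lemma atom_null i j x : 0 <= x <= 1 -> P.-negligible [set w | U i j w = x].
Proof.
move=> /andP[x0 x1].
have mA : measurable [set w | U i j w = x].
  rewrite [X in measurable X](_ : _ = U i j @^-1` [set x])//.
  rewrite -[X in measurable X]setTI; exact: hUmeas.
have mh y : measurable (half U i j y) := half_measurable hUmeas i j y.
apply: null_of_small => // k k0; have kR : 0 < k%:R^-1 :> R by rewrite invr_gt0 ltr0n.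
have [xk|xk] := leP x k%:R^-1.
  apply: le_trans xk; rewrite -[leRHS](Phalf i j (x := x)) ?x0//.
  by apply: fineP_le => // w /= e; rewrite /half/= e.
pose y := x - k%:R^-1.
have y01 : 0 <= y <= 1 by rewrite /y; apply/andP; split; lra.
have : fine (P ([set w | U i j w = x] `|` half U i j y)) <= x.
  rewrite -[leRHS](Phalf i j (x := x)) ?x0//; apply: fineP_le => //.
    exact: measurableU.
  by move=> w [/= e|]; rewrite /half/= ?e// => /le_trans; apply; rewrite /y; lra.
rewrite measureU//; last first.
  apply/seteqP; split => w //= [e]; rewrite /half/= e /y => h; exfalso; lra.
by rewrite fineD ?fin_num_measure// Phalf//= /y; lra.
Qed.

Definition ltb_pt (v u : pt) : R := [forall j, v ord0 j < u ord0 j]%R%:R.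

Lemma ltb_pt_bmf (v : pt) : bmf (fun u : Rd R d => ltb_pt v u).
Proof.
split; last by exists 1 => u; rewrite ger0_norm// lern1; exact: leq_b1.
rewrite (_ : (fun u => _) = fun u : Rd R d => \prod_j (v ord0 j < (u : pt) ord0 j)%R%:R); last first.
  by apply/funext => u; rewrite -forallb_prod.
apply: measurable_prod_fun => j; apply: measurable_bool_natmul.
by apply: measurable_fun_ltr => //; exact: Rd_coord_measurable.
Qed.

Lemma ltb_joint_bmf i :
  bmf (fun wu : Omega * Rd R d => ltb_pt (\row_j U i j wu.1) wu.2).
Proof.
split; last by exists 1 => u; rewrite ger0_norm// lern1; exact: leq_b1.
rewrite (_ : (fun wu => _) = fun wu : Omega * Rd R d =>
    \prod_j (U i j wu.1 < (wu.2 : pt) ord0 j)%R%:R); last first.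
  apply/funext => wu; rewrite -forallb_prod; congr (_%:R); congr nat_of_bool.
  by apply: eq_forallb => j; rewrite mxE.
apply: measurable_prod_fun => j; apply: measurable_bool_natmul.
apply: measurable_fun_ltr.
  by apply: measurableT_comp (hUmeas i j) _.
by apply: measurableT_comp (Rd_coord_measurable j) _.
Qed.

(* A measurable version of [C], defined off the cube as well. *)
Definition Cx (u : pt) : R := E (fun w => ltb_pt (\row_j U 0%N j w) u).

(** [bmf_E] wants a finite measure on the outer space as well; a Dirac mass will do. *)
Lemma Cx_bmf : bmf (fun u : Rd R d => Cx u).
Proof. exact: (bmf_E (@dirac _ (Rd R d) (all_one : Rd R d) R) P (bmf_swap (ltb_joint_bmf 0))). Qed.

(** Strict and weak orthants differ only where some [U 0 j] equals [u_j], an event of probability 0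
    by continuity of the marginals. *)
Lemma Cx_cube u : cube u -> Cx u = C u.
Proof.
move=> cu; rewrite -(fineP_orth hUid hC 0 cu).
have mo := orth_measurable hUmeas 0 u.
rewrite -(Eindic _ mo).
have [N [mN N0 sub]] : P.-negligible (\big[setU/set0]_(j : 'I_d) [set w | U 0%N j w = u ord0 j]).
  apply: (big_ind (fun A => P.-negligible A)); [exact: negligible_set0|by move=> A B; exact: negligibleU|move=> j _].
  exact: atom_null.
apply: (Rintegral_off_null mN N0); first exact: bmf_indic.
move=> w Nw; rewrite /ltb_pt indicE; congr (_%:R); congr nat_of_bool.
apply/forallP/idP => [h|/set_mem h j].
  by apply/mem_set => j; have := h j; rewrite mxE => /ltW.
rewrite mxE lt_neqAle h andbT; apply/eqP => e; apply: Nw; apply: sub.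
by rewrite -bigcup_seq; exists j => //=; rewrite mem_index_enum.
Qed.

Variable m : {finite_measure set (Rd R d) -> \bar R}.
Hypothesis msupp : m (~` cubeRd (d:=d)) = 0%E.

Lemma gamx_joint n : bmf (fun wu : Omega * Rd R d => gam U Cx n wu.2 wu.1).
Proof.
apply: bmfZ; apply: bmfB.
  split; first exact: emp_cop_joint_measurable.
  exists 1 => wu; have /andP[h0 h1] := emp_cop_01 U n wu.2 wu.1.
  by rewrite ger0_norm.
have [mC [M hM]] := Cx_bmf; split; last by exists M => wu.
exact: measurableT_comp mC _.
Qed.

Definition stat_int n w : R := Rintegral m setT (fun u => gam U Cx n u w).

Lemma stat_int_bmf n : bmf (stat_int n).
Proof. exact: (bmf_E P m (gamx_joint n)). Qed.

(** The upper constraint [u <= 1] of the box holds almost everywhere because [m] lives on the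
    cube. *)
Lemma box_ltb (v : pt) :
  fine (m (box v all_one)) = Rintegral m setT (fun u => ltb_pt v u).
Proof.
have mb := box_measurable v all_one.
rewrite -(Eindic _ mb); apply/esym.
apply: (Rintegral_off_null (measurableC (cubeRd_measurable (R:=R) (d:=d))) msupp).
  exact: bmf_indic.
move=> u /contrapT cu; rewrite /ltb_pt indicE; congr (_%:R); congr nat_of_bool.
apply/forallP/idP => [h|/set_mem h j]; last by have /andP[] := h j.
by apply/mem_set => j; rewrite h mxE; have /andP[] := cu j.
Qed.

Lemma emp_cop_ltb n u w : emp_cop U n u w = n%:R^-1 * \sum_(i < n) ltb_pt (rank_pt U n i w) u.
Proof.
congr (_ * _); apply: eq_bigr => i _; congr (_%:R); congr nat_of_bool.
by apply: eq_forallb => j; rewrite mxE.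
Qed.

Lemma stat_intE n w : stat_int n w = Num.sqrt n%:R *
  (n%:R^-1 * \sum_(i < n) fine (m (box (rank_pt U n i w) all_one)) - Rintegral m setT Cx).
Proof.
rewrite /stat_int /gam; under eq_Rintegral do rewrite emp_cop_ltb.
have bs : bmf (fun u : Rd R d => \sum_(i < n) ltb_pt (rank_pt U n i w) u).
  by apply: bmf_sum => i _; exact: ltb_pt_bmf.
rewrite EZ; last by apply: bmfB; [exact: bmfZ|exact: Cx_bmf].
rewrite EB; [|exact: bmfZ|exact: Cx_bmf].
rewrite EZ// Esum; last by move=> i _; exact: ltb_pt_bmf.
by congr (_ * (_ * _ - _)); apply: eq_bigr => i _; rewrite box_ltb.
Qed.

Lemma E_ltb : E (fun w => Rintegral m setT (fun u => ltb_pt (\row_j U 0%N j w) u)) =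
  Rintegral m setT Cx.
Proof. exact: (E_swap P m (ltb_joint_bmf 0)). Qed.

End Representation.

Section RankStatistic.
Context {R : realType} {d : nat}.
Context {dO : measure_display} {Omega : measurableType dO}.
Variable P : probability Omega R.
Variable U : nat -> 'I_d -> Omega -> R.
Hypothesis hUmeas : forall i j, measurable_fun setT (U i j).
Variable f : 'rV[R]_d -> R.
Variable M : R.
Hypothesis M0 : 0 <= M.
Hypothesis fM : forall v, cube v -> `|f v| <= M.
Variables m1 m2 : {finite_measure set (Rd R d) -> \bar R}.
Hypothesis m1supp : m1 (~` cubeRd (d:=d)) = 0%E.
Hypothesis m2supp : m2 (~` cubeRd (d:=d)) = 0%E.
Hypothesis hmubox : forall a b : 'rV[R]_d, cube a -> cube b ->
     (forall j, a ord0 j <= b ord0 j) ->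
     (m1 (box a b) - m2 (box a b))%E = (box_delta (fhat f) [set: 'I_d]%SET a b)%:E.
Variable N : set Omega.
Hypothesis mN : measurable N.
Hypothesis N0 : P N = 0%E.
Hypothesis gN : forall w, ~ N w -> good U w.
Notation E X := (Rintegral P setT X).

Let Ef := E (fun w => f (\row_j U 0%N j w)).

(** Almost surely no coordinate of the sample is 1, so [f] and [fhat] agree there. [fhat] is the
    signed mass of a box, and Fubini turns its mean into an integral of the copula. *)
Lemma Ef_copula : Ef = (-1) ^+ d *
  (Rintegral m1 setT (Cx P U) - Rintegral m2 setT (Cx P U)).
Proof.
have b (m : {finite_measure set (Rd R d) -> \bar R}) := bmf_E P m (ltb_joint_bmf hUmeas 0).
rewrite -(E_ltb P hUmeas m1) -(E_ltb P hUmeas m2) -EB; [|exact: b|exact: b].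
rewrite -EZ; last by apply: bmfB; exact: b.
apply: (Rintegral_off_null mN N0); first by apply: bmfZ; apply: bmfB; exact: b.
move=> w /gN[gw _].
have cv : cube (\row_j U 0%N j w).
  by move=> j; rewrite mxE; have /andP[/ltW-> /ltW->] := gw 0%N j.
rewrite -!box_ltb// -(fhatE hmubox cv) /fhat ifF//.
apply/existsP => -[j]; rewrite mxE => /eqP e.
by have := gw 0%N j; rewrite e ltxx andbF.
Qed.

Definition rank_stat n w : R :=
  (Num.sqrt n%:R)^-1 * \sum_(i < n) (f (rank_pt U n i w) - Ef).

Lemma rank_stat_sum_bmf n : bmf (rank_stat n).
Proof.
apply: bmfZ; apply: bmf_sum => i _; apply: bmfB; last exact: bmf_cst.
by apply: rank_stat_bmf => //; case: n i => // -[].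
Qed.

Lemma rank_stat_int n w : (0 < n)%N -> good U w ->
  `|rank_stat n w - (-1) ^+ d * (stat_int P U m1 n w - stat_int P U m2 n w)| <=
  M * d%:R / Num.sqrt n%:R.
Proof.
move=> n0 gw; have nR : 0 < n%:R :> R by rewrite ltr0n.
have sR : 0 < Num.sqrt n%:R :> R by rewrite sqrtr_gt0.
set q := Num.sqrt n%:R in sR *.
have q2 : q ^+ 2 = n%:R by rewrite sqr_sqrtr// ltW.
have -> : (-1) ^+ d * (stat_int P U m1 n w - stat_int P U m2 n w) =
    q^-1 * \sum_(i < n) (fhat f (rank_pt U n i w) - Ef).
  rewrite !stat_intE// Ef_copula sumrB sumr_const card_ord.
  have -> : \sum_(i < n) fhat f (rank_pt U n i w) = \sum_(i < n) (-1) ^+ d *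
      (fine (m1 (box (rank_pt U n i w) all_one)) - fine (m2 (box (rank_pt U n i w) all_one))).
    by apply: eq_bigr => i _; apply: (fhatE hmubox); exact: cube_rank_pt.
  rewrite -mulr_sumr sumrB -[X in _ = _ * (_ - X)]mulr_natl -/q -!q2.
  set s := (-1) ^+ d; set a := \sum_(i < n) _; set b := \sum_(i < n) _.
  by field; rewrite gt_eqF.
rewrite /rank_stat -/q -mulrBr -sumrB normrM gtr0_norm ?invr_gt0// mulrC ler_pM2r ?invr_gt0//.
apply: (le_trans (ler_norm_sum _ _ _)).
(* Each [i] for which [f] and [fhat] differ is charged to a coordinate of rank 1; by [max_count]
   every coordinate is charged at most once. *)
apply: (@le_trans _ _ (\sum_(i < n) \sum_j
   M * (edf (fun k => U k j w) n (U i j w) == 1)%R%:R)).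
  apply: ler_sum => i _; rewrite opprB addrA subrK /fhat.
  case: ifPn => [/existsP[j]|_]; last by rewrite subrr normr0 sumr_ge0// => j _; rewrite mulr_ge0.
  rewrite mxE => /eqP e; rewrite subr0 (bigD1 j)//= e eqxx mulr1.
  apply: (le_trans (fM (cube_rank_pt U i w n0))).
  by rewrite lerDl; apply: sumr_ge0 => k _; rewrite mulr_ge0.
rewrite exchange_big/= mulrC mulr_natl -[X in _ *+ X](card_ord d) -sumr_const.
apply: ler_sum => j _; rewrite -mulr_sumr ler_piMr//.
apply: max_count => // i k e; apply/eqP; apply/negPn/negP => ik.
by have [_ gw2] := gw; exact: (gw2 i k j ik e).
Qed.

End RankStatistic.

(** * Riemann sums on the cube *)

Section GridCells.
Context {R : realType} {d : nat}.
Notation pt := 'rV[R]_d.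

Definition gpt M (k : {ffun 'I_d -> 'I_M.+2}) : pt := \row_j ((k j)%:R / M.+1%:R).

(** As the indices reach [M.+1], the half-open cells also cover the points with a coordinate equal
    to 1, at the price of sticking out of the cube. *)
Definition cellb M (k : {ffun 'I_d -> 'I_M.+2}) (u : pt) : R :=
  [forall j, gpt k ord0 j <= u ord0 j < gpt k ord0 j + M.+1%:R^-1]%R%:R.

Definition step M (h : pt -> R) (u : pt) : R :=
  \sum_(k : {ffun 'I_d -> 'I_M.+2}) cellb k u * h (gpt k).

Lemma cube_gpt M (k : {ffun 'I_d -> 'I_M.+2}) : cube (gpt k).
Proof.
move=> j; rewrite mxE divr_ge0//= ler_pdivrMr ?ltr0n// mul1r ler_nat -ltnS.
exact: ltn_ord.
Qed.

Lemma cellb_bmf M (k : {ffun 'I_d -> 'I_M.+2}) : bmf (fun u : Rd R d => cellb k u).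
Proof.
split; last by exists 1 => u; rewrite ger0_norm// lern1; exact: leq_b1.
rewrite (_ : (fun u => _) = fun u : Rd R d => \prod_j
  (gpt k ord0 j <= (u : pt) ord0 j < gpt k ord0 j + M.+1%:R^-1)%R%:R); last first.
  by apply/funext => u; rewrite -forallb_prod.
apply: measurable_prod_fun => j; apply: measurable_bool_natmul.
apply: measurable_and.
  by apply: measurable_fun_ler => //; exact: Rd_coord_measurable.
by apply: measurable_fun_ltr => //; exact: Rd_coord_measurable.
Qed.

Lemma step_near M u : cube u -> exists v, [/\ cube v,
  forall j, `|v ord0 j - u ord0 j| < M.+1%:R^-1 & forall h, step M h u = h v].
Proof.
move=> cu; have MR : 0 < M.+1%:R :> R by rewrite ltr0n.
pose t j := Num.truncn (M.+1%:R * u ord0 j).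
have ht j : (t j)%:R / M.+1%:R <= u ord0 j < (t j)%:R / M.+1%:R + M.+1%:R^-1.
  have /andP[u0 _] := cu j.
  have /andP[] := truncn_itv (mulr_ge0 (ltW MR) u0).
  rewrite -/(t j) -[(t j).+1%:R]natr1 => t1 t2.
  rewrite (_ : _ + M.+1%:R^-1 = ((t j)%:R + 1) / M.+1%:R); last by rewrite mulrDl mul1r.
  by rewrite ler_pdivrMr// ltr_pdivlMr// mulrC t1 t2.
have tM j : (t j < M.+2)%N.
  rewrite ltnS -(ler_nat R); have /andP[h _] := ht j.
  rewrite -[leRHS]mul1r -ler_pdivrMr//; apply: (le_trans h).
  by have /andP[] := cu j.
pose k : {ffun 'I_d -> 'I_M.+2} := [ffun j => Ordinal (tM j)].
have gk j : gpt k ord0 j = (t j)%:R / M.+1%:R by rewrite mxE ffunE.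
exists (gpt k); split; first exact: cube_gpt.
  move=> j; have /andP[h1 h2] := ht j; rewrite gk ltr_norml.
  have M0 : 0 < M.+1%:R^-1 :> R by rewrite invr_gt0.
  move: h1 h2 M0; set a := (t j)%:R / _; set b := M.+1%:R^-1 => h1 h2 b0.
  by apply/andP; split; lra.
move=> h; rewrite /step (bigD1 k)//= [X in _ + X]big1 ?addr0.
  rewrite /cellb; have -> : [forall j, gpt k ord0 j <= u ord0 j < gpt k ord0 j + M.+1%:R^-1].
    by apply/forallP => j; rewrite gk.
  by rewrite mul1r.
move=> l lk; rewrite /cellb; case: forallP => [hl|_]; last by rewrite mul0r.
exfalso; suff e : l = k by rewrite e eqxx in lk.
apply/ffunP => j; apply: ord_inj.
rewrite ffunE /=; have := hl j; rewrite mxE.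
have /andP[h1 h2] := ht j; move=> /andP[h3 h4].
have step_lt (a b : nat) : a%:R / M.+1%:R <= u ord0 j ->
    u ord0 j < b%:R / M.+1%:R + M.+1%:R^-1 -> (a <= b)%N.
  move=> x y; have := le_lt_trans x y.
  rewrite (_ : _ + M.+1%:R^-1 = (b%:R + 1) / M.+1%:R); last by rewrite mulrDl mul1r.
  by rewrite ltr_pM2r ?invr_gt0// natr1 ltr_nat ltnS.
by apply/eqP; rewrite eqn_leq !step_lt.
Qed.

Variable m : {finite_measure set (Rd R d) -> \bar R}.

Definition cell_mass M (k : {ffun 'I_d -> 'I_M.+2}) : R := Rintegral m setT (cellb k).

Lemma step_bmf M h : bmf (fun u : Rd R d => step M h u).
Proof.
apply: bmf_sum => k _; apply: bmfM; [exact: cellb_bmf|exact: bmf_cst].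
Qed.

Lemma E_step M h : Rintegral m setT (fun u => step M h u) =
  \sum_(k : {ffun 'I_d -> 'I_M.+2}) cell_mass k * h (gpt k).
Proof.
rewrite Esum; last by move=> k _; apply: bmfM; [exact: cellb_bmf|exact: bmf_cst].
apply: eq_bigr => k _; rewrite [RHS]mulrC -EZ; last exact: cellb_bmf.
by apply: eq_Rintegral => u _; rewrite mulrC.
Qed.

Lemma cell_mass_ge0 M (k : {ffun 'I_d -> 'I_M.+2}) : 0 <= cell_mass k.
Proof. by apply: E_ge0 => u. Qed.

Hypothesis msupp : m (~` cubeRd (d:=d)) = 0%E.

Lemma cell_mass_sum M : \sum_(k : {ffun 'I_d -> 'I_M.+2}) cell_mass k = fine (m setT).
Proof.
rewrite -[RHS]mul1r -Ecst.
transitivity (Rintegral m setT (fun u => step M (fun=> 1) u)).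
  by rewrite E_step; apply: eq_bigr => k _; rewrite mulr1.
apply/esym; apply: (Rintegral_off_null (measurableC (cubeRd_measurable (R:=R) (d:=d))) msupp).
  exact: step_bmf.
by move=> u /contrapT cu; have [v [_ _ ->]] := step_near M cu.
Qed.

(** Uniform continuity on the cube in the sup distance. In this form it passes to sums, products and
    [only_coord] without subspace topologies. *)
Definition unif (h : pt -> R) : Prop := forall e, 0 < e -> exists2 r, 0 < r &
  forall u v, cube u -> cube v -> (forall j, `|u ord0 j - v ord0 j| < r) ->
  `|h u - h v| <= e.

Lemma mesh_small (r : R) : 0 < r -> exists M0, forall M, (M0 <= M)%N -> M.+1%:R^-1 < r.
Proof.
move=> r0; exists (Num.truncn r^-1) => M hM.
rewrite -[ltRHS]invrK ltf_pV2 ?posrE ?invr_gt0 ?ltr0n//.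
by apply: (lt_le_trans (truncnS_gt _)); rewrite ler_nat.
Qed.

Lemma unif_bounded h : unif h -> exists2 K, 0 <= K & forall u, cube u -> `|h u| <= K.
Proof.
move=> hh; have [r r0 hr] := hh 1 ltr01; have [M hM] := mesh_small r0.
exists (1 + \sum_(k : {ffun 'I_d -> 'I_M.+2}) `|h (gpt k)|).
  by rewrite addr_ge0// sumr_ge0.
move=> u cu; have [v [cv uv hv]] := step_near M cu.
have h1 : `|h u - h v| <= 1.
  by apply: hr => // j; rewrite distrC; apply: lt_trans (uv j) (hM M _).
have h2 : `|h v| <= \sum_(k : {ffun 'I_d -> 'I_M.+2}) `|h (gpt k)|.
  rewrite -hv; apply: (le_trans (ler_norm_sum _ _ _)); apply: ler_sum => k _.
  by rewrite normrM (ger0_norm (x := cellb k u))// ler_piMl// lern1 leq_b1.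
by rewrite -[h u](subrK (h v)); apply: (le_trans (ler_normD _ _)); exact: lerD.
Qed.

Lemma unifB h1 h2 : unif h1 -> unif h2 -> unif (fun u => h1 u - h2 u).
Proof.
move=> H1 H2 e e0; have e2 : 0 < e / 2 by rewrite divr_gt0.
have [r1 r10 hr1] := H1 _ e2; have [r2 r20 hr2] := H2 _ e2.
exists (Num.min r1 r2); first by rewrite lt_min r10.
move=> u v cu cv uv.
have uv1 j : `|u ord0 j - v ord0 j| < r1 by have := uv j; rewrite lt_min => /andP[].
have uv2 j : `|u ord0 j - v ord0 j| < r2 by have := uv j; rewrite lt_min => /andP[].
have := hr1 u v cu cv uv1; have := hr2 u v cu cv uv2.
rewrite (_ : _ - _ - _ = (h1 u - h1 v) - (h2 u - h2 v)); last by ring.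
move=> p2 p1; apply: (le_trans (ler_normB _ _)); rewrite (splitr e); exact: lerD.
Qed.

Lemma unifM h1 h2 : unif h1 -> unif h2 -> unif (fun u => h1 u * h2 u).
Proof.
move=> H1 H2 e e0.
have [K1 K10 hK1] := unif_bounded H1; have [K2 K20 hK2] := unif_bounded H2.
have K1p : 0 < K1 + 1 by rewrite ltr_wpDl.
have K2p : 0 < K2 + 1 by rewrite ltr_wpDl.
have e1 : 0 < e / 2 / (K2 + 1) by rewrite !divr_gt0.
have e2 : 0 < e / 2 / (K1 + 1) by rewrite !divr_gt0.
have [r1 r10 hr1] := H1 _ e1; have [r2 r20 hr2] := H2 _ e2.
exists (Num.min r1 r2); first by rewrite lt_min r10.
move=> u v cu cv uv.
have uv1 j : `|u ord0 j - v ord0 j| < r1 by have := uv j; rewrite lt_min => /andP[].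
have uv2 j : `|u ord0 j - v ord0 j| < r2 by have := uv j; rewrite lt_min => /andP[].
have p1 := hr1 u v cu cv uv1; have p2 := hr2 u v cu cv uv2.
rewrite (_ : _ - _ = (h1 u - h1 v) * h2 u + h1 v * (h2 u - h2 v)); last by ring.
apply: (le_trans (ler_normD _ _)); rewrite (splitr e) !normrM; apply: lerD.
  apply: (@le_trans _ _ (e / 2 / (K2 + 1) * (K2 + 1))); last by rewrite divfK// gt_eqF.
  by apply: ler_pM => //; apply: (le_trans (hK2 u cu)); rewrite lerDl.
apply: (@le_trans _ _ ((K1 + 1) * (e / 2 / (K1 + 1)))); last by rewrite mulrC divfK// gt_eqF.
by apply: ler_pM => //; apply: (le_trans (hK1 v cv)); rewrite lerDl.
Qed.

Lemma unif_sum (I : Type) (s : seq I) (h : I -> pt -> R) :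
  (forall i, unif (h i)) -> unif (fun u => \sum_(i <- s) h i u).
Proof.
move=> H; elim: s => [|i s IH].
  by move=> e e0; exists 1 => // u v _ _ _; rewrite !big_nil subrr normr0 ltW.
have HN : unif (fun u => - \sum_(i <- s) h i u).
  by move=> e /IH[r r0 hr]; exists r => // u v cu cv uv; rewrite -opprD normrN; exact: hr.
move=> e e0; have [r r0 hr] := unifB (H i) HN e0.
exists r => // u v cu cv uv; rewrite !big_cons.
by have := hr u v cu cv uv; rewrite !opprK.
Qed.

Lemma unif_only_coord h j : unif h -> unif (fun u => h (only_coord u j)).
Proof.
move=> H e e0; have [r r0 hr] := H e e0; exists r => // u v cu cv uv.
apply: hr; [exact: cube_only_coord..|move=> k; rewrite !mxE; case: eqP => [_|_]; first exact: uv].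
by rewrite subrr normr0.
Qed.

Lemma cube_compact : compact (@cube R d).
Proof.
have := @rV_compact R d (fun=> `[(0:R), 1]%classic) (fun=> @segment_compact R 0 1).
congr compact; apply/seteqP; split => u /= h j; have := h j; by rewrite /= in_itv.
Qed.

Lemma unif_continuous h : {within @cube R d, continuous h} -> unif h.
Proof.
move=> ch e e0.
have [r r0 hr] := compact_unif_continuous cube_compact ch e0.
exists r => // u v cu cv uv; apply: hr => //; split => // i j; rewrite ord1; exact: uv.
Qed.

Lemma step_int_cvg h : unif h ->
  (fun M => \sum_(k : {ffun 'I_d -> 'I_M.+2}) cell_mass k * h (gpt k)) @ \oo -->
  Rintegral m (cubeRd (d:=d)) h.
Proof.
move=> H; have [K K0 hK] := unif_bounded H.
have mC := cubeRd_measurable (R:=R) (d:=d).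
(* Nothing is known of [h] off the cube, so both sides are cut off there; [msupp] makes this
   free. *)
pose X M (u : Rd R d) : R := \1_(cubeRd (d:=d)) u * step M h u.
pose Y (u : Rd R d) : R := \1_(cubeRd (d:=d)) u * h u.
have bX M : bmf (X M) by apply: bmfM; [exact: bmf_indic|exact: step_bmf].
have inC (u : Rd R d) : cube u -> \1_(cubeRd (d:=d)) u = 1 :> R.
  by move=> cu; rewrite indicE mem_set.
have outC (u : Rd R d) : ~ cube u -> \1_(cubeRd (d:=d)) u = 0 :> R.
  by move=> cu; rewrite indicE memNset.
have := @E_dct _ _ _ m X Y K.
case.
- by move=> M; have [] := bX M.
- move=> M u; have [cu|cu] := pselect (cube u); last by rewrite /X outC// mul0r normr0.
  by rewrite /X inC// mul1r; have [v [cv _ ->]] := step_near M cu; exact: hK.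
- move=> u; have [cu|cu] := pselect (cube u); last first.
    rewrite (_ : (fun M => _) = fun=> 0); last by apply/funext => M; rewrite /X outC// mul0r.
    by rewrite /Y outC// mul0r; exact: cvg_cst.
  apply/cvgrPdist_le => e e0; have [r r0 hr] := H e e0; have [M0 hM0] := mesh_small r0.
  exists M0 => // M /= hM; rewrite /X /Y inC// !mul1r.
  have [v [cv uv ->]] := step_near M cu; apply: hr => // j.
  by rewrite distrC; apply: lt_trans (uv j) (hM0 M hM).
move=> _ XY.
rewrite (_ : (fun M => _) = fun M => Rintegral m setT (X M)); last first.
  apply/funext => M; rewrite -E_step; apply/esym.
  apply: (Rintegral_off_null (measurableC mC) msupp); first exact: step_bmf.
  by move=> u /contrapT cu; rewrite /X inC// mul1r.
rewrite (_ : Rintegral m (cubeRd (d:=d)) h = Rintegral m setT Y)//.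
rewrite Rintegral_mkcond; apply: eq_Rintegral => u _; rewrite patchE /Y.
case: ifPn => [/set_mem cu|/negP cu]; first by rewrite inC// mul1r.
by rewrite outC ?mul0r// => h1; apply: cu; exact/mem_set.
Qed.

End GridCells.

Lemma bmf_fst {d1 d2 : measure_display} {T1 : measurableType d1}
  {T2 : measurableType d2} {R : realType} (X : T1 -> R) :
  bmf X -> bmf (fun xy : T1 * T2 => X xy.1).
Proof.
move=> [mX [M hM]]; split; last by exists M => xy.
by have := measurableT_comp mX (@measurable_fst _ _ T1 T2).
Qed.

Lemma bmf_snd {d1 d2 : measure_display} {T1 : measurableType d1}
  {T2 : measurableType d2} {R : realType} (X : T2 -> R) :
  bmf X -> bmf (fun xy : T1 * T2 => X xy.2).
Proof.
move=> [mX [M hM]]; split; last by exists M => xy.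
by have := measurableT_comp mX (@measurable_snd _ _ T1 T2).
Qed.

(** The witness [1 / (1 + sum of the inverses)] lies below every [r i] and makes sense for empty
    [I]. *)
Lemma exists_pos_le {R : realType} (I : finType) (r : I -> R) : (forall i, 0 < r i) ->
  exists2 s, 0 < s & forall i, s <= r i.
Proof.
move=> r0; pose S : R := 1 + \sum_i (r i)^-1.
have S0 : 0 <= \sum_i (r i)^-1 by apply: sumr_ge0 => i _; rewrite invr_ge0 ltW.
have Sp : 0 < S by rewrite ltr_wpDr.
exists S^-1; first by rewrite invr_gt0.
move=> i; rewrite -[leRHS]invrK lef_pV2 ?posrE ?invr_gt0//.
rewrite /S (bigD1 i)//= addrCA lerDl addr_ge0// sumr_ge0// => k _.
by rewrite invr_ge0 ltW.
Qed.

(** * Discretization of the integral in mean *)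

Section Discretization.
Context {R : realType} {d : nat}.
Context {dO : measure_display} {Omega : measurableType dO}.
Variable P : probability Omega R.
Variable U : nat -> 'I_d -> Omega -> R.
Hypothesis hUmeas : forall i j, measurable_fun setT (U i j).
Hypothesis hUind : independent_vectors P U.
Hypothesis hUid : forall (i : nat) (x : 'rV[R]_d),
     P [set w | forall j, U i j w <= x ord0 j] =
     P [set w | forall j, U 0%N j w <= x ord0 j].
Hypothesis hUunif : forall (j : 'I_d) (x : R), 0 <= x <= 1 ->
     P [set w | U 0%N j w <= x] = x%:E.
Variable C : 'rV[R]_d -> R.
Hypothesis hC : forall u, cube u ->
  (C u)%:E = P [set w | forall j, U 0%N j w <= u ord0 j].
Variable dC : 'I_d -> 'rV[R]_d -> R.
Hypothesis hdC : forall j u, cube u -> partial_deriv_cube C j u (dC j u).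
Hypothesis hdCcont : forall j, {within @cube R d, continuous (dC j)}.
Notation E X := (Rintegral P setT X).
Notation pt := 'rV[R]_d.

Let PT : fine (P setT) = 1. Proof. exact: fineP_setT. Qed.
Let Clip := C_lip hUmeas hUid hUunif hC.
Let dC1 := dC_le1 Clip hdC.

(** One [r] serves all [n], because the moment bounds on [alpha] are free of [n]; the coefficients
    [dC j] are uniformly continuous. *)
Lemma beta_equicont e : 0 < e -> exists2 r, 0 < r & forall u v, cube u -> cube v ->
  (forall j, `|u ord0 j - v ord0 j| < r) -> forall n, (0 < n)%N ->
  E (fun w => `|beta U C dC n u w - beta U C dC n v w|) <= e.
Proof.
move=> e0; pose D : R := d%:R + 1.
have D0 : 0 < D by rewrite ltr_wpDl.
(* The increment of [alpha] costs [2 eta]; each coordinate costs [2 eta] for the marginal increment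
   and [2 eta] for that of [dC j]. In all this is below [4 D eta = e]. *)
pose eta := e / 4 / D.
have eta0 : 0 < eta by rewrite !divr_gt0.
have /choice[rj hrj] : forall j, exists r, 0 < r /\ forall u v, cube u -> cube v ->
    (forall k, `|u ord0 k - v ord0 k| < r) -> `|dC j u - dC j v| <= eta.
  by move=> j; have [r r0 hr] := unif_continuous (@hdCcont j) eta0; exists r.
have [r1 r10 hr1] := exists_pos_le (fun j => (hrj j).1).
pose r2 := eta * eta / D.
have r20 : 0 < r2 by rewrite divr_gt0// mulr_gt0.
exists (Num.min r1 r2); first by rewrite lt_min r10.
move=> u v cu cv uv n n0.
have uv1 j k : `|u ord0 k - v ord0 k| < rj j.
  by have := uv k; rewrite lt_min => /andP[h _]; apply: lt_le_trans h (hr1 j).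
have d1 : dist1 u v / eta <= eta.
  rewrite ler_pdivrMr//; apply: (@le_trans _ _ (D * r2)); last by rewrite /r2 mulrC divfK// gt_eqF.
  apply: (@le_trans _ _ (\sum_(j < d) r2)).
    by apply: ler_sum => j _; have := uv j; rewrite lt_min => /andP[_ /ltW].
  by rewrite sumr_const card_ord -[leLHS]mulr_natl ler_wpM2r ?(ltW r20)// lerDl.
have ba y := alpha_bmf hUmeas C n y.
have bd x y : cube x -> cube y -> dist1 x y <= dist1 u v ->
    E (fun w => `|alpha U C n x w - alpha U C n y w|) <= eta + eta.
  move=> cx cy xy.
  apply: (le_trans (E_alpha_diff hUmeas hUind hUid hUunif hC n0 cx cy eta0)).
  by rewrite lerD2l; apply: le_trans d1; rewrite ler_pM2r ?invr_gt0.
pose A1 w := `|alpha U C n u w - alpha U C n v w|.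
pose A2 j w := `|alpha U C n (only_coord u j) w - alpha U C n (only_coord v j) w|.
pose A3 j w := `|alpha U C n (only_coord v j) w|.
have b1 : bmf A1 by apply: bmf_norm; exact: bmfB.
have b2 j : bmf (A2 j) by apply: bmf_norm; exact: bmfB.
have b3 j : bmf (A3 j) by apply: bmf_norm.
have bb : bmf (fun w => \sum_j (A2 j w + eta * A3 j w)).
  by apply: bmf_sum => j _; apply: bmfD; [|exact: bmfZ].
apply: (@le_trans _ _ (E (fun w => A1 w + \sum_j (A2 j w + eta * A3 j w)))).
  apply: leE.
  - by apply: bmf_norm; apply: bmfB; exact: beta_bmf.
  - exact: bmfD.
  move=> w; rewrite /beta.
  rewrite (_ : _ - _ - _ = (alpha U C n u w - alpha U C n v w) -
    \sum_j (dC j u * alpha U C n (only_coord u j) w - dC j v * alpha U C n (only_coord v j) w)); last first.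
    by rewrite sumrB; ring.
  apply: (le_trans (ler_normB _ _)); rewrite lerD2l.
  apply: (le_trans (ler_norm_sum _ _ _)); apply: ler_sum => j _.
  rewrite (_ : _ - _ = dC j u * (alpha U C n (only_coord u j) w - alpha U C n (only_coord v j) w) +
     (dC j u - dC j v) * alpha U C n (only_coord v j) w); last by ring.
  apply: (le_trans (ler_normD _ _)).
  rewrite (normrM (dC j u)) (normrM (dC j u - dC j v)); apply: lerD.
    by rewrite ler_piMl//; exact: dC1.
  by apply: ler_wpM2r => //; apply: (hrj j).2 => // k; exact: uv1.
rewrite ED// Esum; last by move=> j _; apply: bmfD; [|exact: bmfZ].
have p1 := bd u v cu cv (lexx _).
have p2 : \sum_j E (fun w => A2 j w + eta * A3 j w) <= \sum_(j < d) (4 * eta).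
  apply: ler_sum => j _; rewrite ED//; last exact: bmfZ.
  rewrite EZ//.
  have q1 : E (A2 j) <= eta + eta.
    by apply: bd; [exact: cube_only_coord..|exact: dist1_oc].
  have q2 : E (A3 j) <= 2.
    by apply: (E_alpha_le hUmeas hUind hUid hC n0); exact: cube_only_coord.
  have : eta * E (A3 j) <= eta * 2 by rewrite ler_pM2l.
  by move: q1; lra.
apply: (le_trans (lerD p1 p2)).
rewrite sumr_const card_ord -[X in _ + X]mulr_natl.
have eD : D * (4 * eta) = e by rewrite /eta; field; rewrite gt_eqF.
by move: eD; rewrite /D => <-; have := eta0; lra.
Qed.

Variable m : {finite_measure set (Rd R d) -> \bar R}.
Hypothesis msupp : m (~` cubeRd (d:=d)) = 0%E.

Lemma gamx_gam n u w : cube u -> gam U (Cx P U) n u w = gam U C n u w.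
Proof. by move=> cu; rewrite /gam (Cx_cube hUmeas hUid hUunif hC cu). Qed.

(** After Fubini the mean error is integrated over [u]. At each [u] it exceeds the equicontinuity
    bound [kp] by at most the mean distance of [gam] and [beta], which tends to 0 boundedly. *)
Lemma stat_int_approx e : 0 < e -> exists M0, forall M, (M0 <= M)%N ->
  exists n0, forall n, (n0 <= n)%N ->
  E (fun w => `|stat_int P U m n w -
    \sum_(k : {ffun 'I_d -> 'I_M.+2}) cell_mass m k * beta U C dC n (gpt k) w|) <= e.
Proof.
move=> e0; pose mT := fine (m setT).
have mT0 : 0 <= mT by exact: fine_ge0.
have mT1 : 0 < mT + 1 by rewrite ltr_wpDl.
pose kp := e / 2 / (mT + 1).
have kp0 : 0 < kp by rewrite !divr_gt0.
have [r r0 hr] := beta_equicont kp0.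
have [M0 hM0] := mesh_small r0.
exists M0 => M /hM0 Mr.
pose F n (wu : Omega * Rd R d) : R :=
  gam U (Cx P U) n wu.2 wu.1 - step M (fun v => beta U C dC n v wu.1) wu.2.
have bF n : bmf (F n).
  apply: bmfB; first exact: gamx_joint.
  apply: bmf_sum => k _; apply: bmfM.
    exact: (bmf_snd (cellb_bmf k)).
  exact: (bmf_fst (beta_bmf hUmeas C dC n (gpt k))).
have bFn n : bmf (fun wu => `|F n wu|) by exact: bmf_norm.
pose Psi n (u : Rd R d) : R := E (fun w => `|F n (w, u)|).
have bPsi n : bmf (Psi n).
  exact: (bmf_E m P (bmf_swap (bFn n))).
have mC := cubeRd_measurable (R:=R) (d:=d).
(* The excess over [kp] is what tends to 0 pointwise; [Psi n] itself need not, as the mesh is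
   fixed. *)
pose Psi' n (u : Rd R d) : R := \1_(cubeRd (d:=d)) u * Num.max (Psi n u - kp) 0.
have inC (u : Rd R d) : cube u -> \1_(cubeRd (d:=d)) u = 1 :> R.
  by move=> cu; rewrite indicE mem_set.
have outC (u : Rd R d) : ~ cube u -> \1_(cubeRd (d:=d)) u = 0 :> R.
  by move=> cu; rewrite indicE memNset.
have PsiG n u : (0 < n)%N -> cube u ->
    Psi n u - kp <= E (fun w => `|gam U C n u w - beta U C dC n u w|).
  move=> n0 cu; have [v [cv uv sv]] := step_near M cu.
  have bg := gam_bmf hUmeas C n u; have bb y := beta_bmf hUmeas C dC n y.
  rewrite lerBlDr; apply: (@le_trans _ _ (E (fun w => `|gam U C n u w - beta U C dC n u w| +
      `|beta U C dC n u w - beta U C dC n v w|))).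
    apply: leE.
    - exact: (bmf_section2 (u : Rd R d) (bFn n)).
    - by apply: bmfD; apply: bmf_norm; exact: bmfB.
    move=> w; rewrite /F /= sv gamx_gam//.
    rewrite (_ : _ - _ = (gam U C n u w - beta U C dC n u w) +
       (beta U C dC n u w - beta U C dC n v w)); last by ring.
    exact: ler_normD.
  rewrite ED; [|by apply: bmf_norm; exact: bmfB..].
  rewrite lerD2l; apply: hr => // j.
  by rewrite distrC; exact: lt_trans (uv j) Mr.
have mPsi' n : measurable_fun setT (Psi' n).
  apply: measurable_funM; first by have [] := bmf_indic (R := R) mC.
  apply: measurable_maxr => //.
  by have [] := bmfB (bPsi n) (bmf_cst kp).
have d0 : 0 <= 5 * d%:R :> R by rewrite mulr_ge0.
(* The index is shifted because the bounds on the processes hold for positive sample sizes. *)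
have Psi'b n u : `|Psi' n.+1 u| <= 5 * d%:R.
  have [cu|cu] := pselect (cube u); last by rewrite /Psi' outC// mul0r normr0.
  rewrite /Psi' inC// mul1r ger0_norm; last by rewrite le_max lexx orbT.
  rewrite ge_max d0 andbT; apply: (le_trans (PsiG _ _ _ cu)) => //.
  exact: (gam_beta_ub hUmeas hUind hUid hUunif hC hdC).
have Psi'c u : (fun n => Psi' n.+1 u) @ \oo --> (0 : R).
  have [cu|cu] := pselect (cube u); last first.
    rewrite (_ : (fun n => _) = fun=> 0); last by apply/funext => n; rewrite /Psi' outC// mul0r.
    exact: cvg_cst.
  apply/cvgrPdist_le => x x0.
  have [n0 hn0] := gam_beta_cvg hUmeas hUind hUid hUunif hC hdC hdCcont cu x0.
  exists n0 => // n /= hn; rewrite /Psi' inC// mul1r sub0r normrN.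
  rewrite ger0_norm; last by rewrite le_max lexx orbT.
  rewrite ge_max (ltW x0) andbT; apply: (le_trans (PsiG _ _ _ cu)) => //.
  by apply: hn0; exact: leqW.
have [_] := E_dct m (fun n => mPsi' n.+1) Psi'b Psi'c.
rewrite Ecst mul0r => /cvgrPdist_le/(_ (e / 2)).
rewrite divr_gt0// => /(_ isT)[n0 _ hn0].
exists n0.+1 => -[//|n]; rewrite ltnS => hn.
have bPsi' : bmf (Psi' n.+1) by split => //; exists (5 * d%:R).
apply: (@le_trans _ _ (E (fun w => Rintegral m setT (fun u => `|F n.+1 (w, u)|)))).
  apply: leE.
  - apply: bmf_norm; apply: bmfB; first exact: stat_int_bmf.
    by apply: bmf_sum => k _; apply: bmfZ; exact: beta_bmf.
  - exact: (bmf_E P m (bFn n.+1)).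
  move=> w; rewrite -(E_step m M (fun v => beta U C dC n.+1 v w)) -EB; last 2 first.
  - exact: (bmf_section1 w (gamx_joint P hUmeas n.+1)).
  - exact: step_bmf.
  exact: normE (bmf_section1 w (bF n.+1)).
rewrite (E_swap P m (bFn n.+1)).
apply: (@le_trans _ _ (Rintegral m setT (fun u => Psi' n.+1 u + kp))).
  apply: (leE_ae (measurableC mC) msupp); first exact: bPsi.
    by apply: bmfD => //; exact: bmf_cst.
  move=> u /contrapT cu; rewrite /Psi' inC// mul1r -lerBlDr.
  by rewrite le_max lexx.
rewrite ED//; last exact: bmf_cst.
rewrite Ecst (splitr e); apply: lerD.
  have := hn0 n hn; rewrite sub0r normrN; exact: le_trans (ler_norm _).
rewrite /kp mulrAC ler_pdivrMr// ler_pM2l ?divr_gt0//.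
by rewrite lerDl.
Qed.

End Discretization.

(** * Gaussian limits *)

Section GaussianLimits.
Context {R : realType}.
Local Notation RR := (measurableTypeR R).

Lemma gauss_cst_ge0 : 0 <= gauss_cst :> R.
Proof. by rewrite mulr_ge0// addr_ge0// expR_ge0. Qed.

(** By the semigroup law and contraction only a step of variance [w] is left, which [gauss_taylor]
    bounds; [w <= 1] makes the term of order [w^(3/2)] at most linear. *)
Lemma gaussT_incr (K L : R) h v w : smooth K L h -> 0 <= v -> 0 <= w <= 1 ->
  `|gaussT (v + w) h 0 - gaussT v h 0| <= (`|K| + `|L| * gauss_cst) * w.
Proof.
move=> sh v0 /andP[w0 w1].
have ch : cbnd h by apply: smoothe_bmf; exists K, L.
have bh := cbnd_bmf ch.
rewrite -gaussT_semigroup//; apply: gaussT_contract => //; first exact: gaussT_bmf.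
move=> y; have [_ _ [h1 [h2 [ht hK]]]] := sh.
have := gauss_taylor w0 ch (ht y); set X := gaussT w h y - h y => hX.
have s1 : Num.sqrt w <= 1 by rewrite -[leRHS]sqrtr1 ler_wsqrtr.
have s3 : Num.sqrt w ^+ 3 <= w.
  by rewrite exprS sqr_sqrtr// ler_piMl.
have s30 : 0 <= Num.sqrt w ^+ 3 by rewrite exprn_ge0// sqrtr_ge0.
have q1 : `|h2 y * (w / 2)| <= `|K| * w.
  rewrite normrM ler_pM//; first exact: le_trans (hK y) (ler_norm K).
  by rewrite ger0_norm ?divr_ge0//; lra.
have q2 : L * gauss_cst * Num.sqrt w ^+ 3 <= `|L| * gauss_cst * w.
  apply: (@le_trans _ _ (`|L| * gauss_cst * Num.sqrt w ^+ 3)).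
    by rewrite ler_wpM2r// ler_wpM2r ?gauss_cst_ge0// ler_norm.
  by rewrite ler_wpM2l// mulr_ge0// gauss_cst_ge0.
rewrite -[X](subrK (h2 y * (w / 2))) mulrDl addrC; apply: (le_trans (ler_normD _ _)).
by apply: lerD => //; apply: le_trans hX q2.
Qed.

Lemma gaussT_close (K L : R) h v v' : smooth K L h -> 0 <= v -> 0 <= v' ->
  `|v - v'| <= 1 ->
  `|gaussT v h 0 - gaussT v' h 0| <= (`|K| + `|L| * gauss_cst) * `|v - v'|.
Proof.
move=> sh; wlog vv : v v' / v' <= v.
  move=> H v0 v'0 d1; have [vv|/ltW vv] := leP v' v; first exact: H.
  by rewrite distrC (distrC v); apply: H => //; rewrite distrC.
move=> v0 v'0; rewrite ger0_norm ?subr_ge0// => d1.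
have -> : gaussT v h 0 = gaussT (v' + (v - v')) h 0 by rewrite addrC subrK.
by apply: gaussT_incr => //; rewrite subr_ge0 vv.
Qed.

(** Bolzano-Weierstrass, in terms of cluster points instead of subsequences. *)
Lemma bounded_cluster (v : nat -> R) (V : R) : (forall n, 0 <= v n <= V) ->
  exists2 s, 0 <= s & forall e, 0 < e -> forall n0, exists2 n, (n0 <= n)%N & `|v n - s| <= e.
Proof.
move=> hv.
have [|s [/=]] := @segment_compact R 0 V (v @ \oo) _.
  by exists 0%N => // n _ /=; rewrite in_itv /=.
rewrite in_itv/= => /andP[s0 _] cl; exists s => // e e0 n0.
have [|//|x [[n n0n <-] /= nx]] := cl [set v n | n in [set n | (n0 <= n)%N]] (ball s e).
- by exists n0 => // n /= hn; exists n.
- exact: nbhsx_ballx.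
- by exists n => //; rewrite distrC ltW.
Qed.

End GaussianLimits.

Lemma sum_enum_val {R : nmodType} (I : finType) (F : I -> R) :
  \sum_(p : I) F p = \sum_(i < #|I|) F (enum_val i).
Proof. by rewrite (reindex (fun i : 'I_#|I| => enum_val i))//; exact: onW_bij (enum_val_bij _). Qed.

Section LimitField.
Context {R : realType} {d : nat}.
Notation pt := 'rV[R]_d.
Variable C : pt -> R.
Hypothesis C01 : forall u, cube u -> 0 <= C u <= 1.

Lemma cov_formZ (I : finType) (s : R) (a : I -> R) (x : I -> pt) :
  cov_form C (fun p => s * a p) x = s ^+ 2 * cov_form C a x.
Proof.
rewrite /cov_form mulr_sumr; apply: eq_bigr => p _; rewrite mulr_sumr.
by apply: eq_bigr => q _; ring.
Qed.

Lemma cov_form_le (I : finType) (a : I -> R) (x : I -> pt) : (forall p, cube (x p)) ->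
  cov_form C a x <= (\sum_p `|a p|) ^+ 2.
Proof.
move=> cx; rewrite expr2 mulr_suml; apply: ler_sum => p _.
rewrite mulr_sumr; apply: ler_sum => q _.
apply: (le_trans (ler_norm _)); rewrite 2!normrM ler_piMr ?mulr_ge0//.
have /andP[c1 c2] := C01 (cx p); have /andP[c3 c4] := C01 (cx q).
have /andP[c5 c6] := C01 (cube_ptmin (cx p) (cx q)).
by rewrite ler_norml; apply/andP; split; nra.
Qed.

Context {dO : measure_display} {Omega : measurableType dO}.
Variable P : probability Omega R.
Variable B : pt -> Omega -> R.
Hypothesis hB : centred_gaussian_field P B (fun u v => C (ptmin u v) - C u * C v).

Lemma field_lin_measurable (I : finType) (a : I -> R) (x : I -> pt) :
  measurable_fun setT (fun w => \sum_p a p * B (x p) w).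
Proof.
apply: measurable_sum => p; apply: measurable_funM => //; exact: hB.1.
Qed.

Lemma field_lin_law (I : finType) (a : I -> R) (x : I -> pt) : (forall p, cube (x p)) ->
  forall A : set R, measurable A ->
  P ((fun w => \sum_p a p * B (x p) w) @^-1` A) = gauss_prob (cov_form C a x) A.
Proof.
move=> cx A mA; rewrite -gauss_lawE.
have := hB.2 #|I| (fun i => x (enum_val i)) (fun i => a (enum_val i)) (fun i => cx _) A mA.
rewrite (_ : \sum_(i < #|I|) \sum_(l < #|I|) _ = cov_form C a x); last first.
  rewrite /cov_form [RHS]sum_enum_val; apply: eq_bigr => i _.
  by rewrite [RHS]sum_enum_val.
move=> <-; congr (P _); apply/seteqP; split => w /=; rewrite (sum_enum_val (fun p => a p * B (x p) w)).
  by move=> h; apply/mem_set.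
by move/set_mem.
Qed.

Variable dC : 'I_d -> pt -> R.
Hypothesis dC1 : forall j u, cube u -> `|dC j u| <= 1.

(** The index [ord0] stands for the grid point itself and [lift ord0 j] for its [j]-th marginal
    point. Combinations of [beta], or of the limit field, thus become combinations of [alpha], or of
    [B], at the same points with the same coefficients. *)
Definition grid_coef M (c : {ffun 'I_d -> 'I_M.+2} -> R)
    (p : {ffun 'I_d -> 'I_M.+2} * 'I_d.+1) : R :=
  c p.1 * (if unlift ord0 p.2 is Some j then - dC j (gpt p.1) else 1).

Definition grid_at M (p : {ffun 'I_d -> 'I_M.+2} * 'I_d.+1) : pt :=
  if unlift ord0 p.2 is Some j then only_coord (gpt p.1) j else gpt p.1.

Lemma cube_grid_at M (p : {ffun 'I_d -> 'I_M.+2} * 'I_d.+1) : cube (grid_at p).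
Proof.
rewrite /grid_at; case: unlift => [j|]; last exact: cube_gpt.
by apply: cube_only_coord; exact: cube_gpt.
Qed.

Lemma grid_sumE M (c : {ffun 'I_d -> 'I_M.+2} -> R) (z : pt -> R) :
  \sum_p grid_coef c p * z (grid_at p) =
  \sum_k c k * (z (gpt k) - \sum_j dC j (gpt k) * z (only_coord (gpt k) j)).
Proof.
transitivity (\sum_k \sum_i grid_coef c (k, i) * z (grid_at (k, i))).
  by rewrite pair_bigA; apply: eq_bigr => -[].
apply: eq_bigr => k _; rewrite big_ord_recl /grid_coef /grid_at/= unlift_none mulr1.
rewrite mulrBr; congr (_ + _); rewrite mulr_sumr -sumrN; apply: eq_bigr => j _.
by rewrite liftK; ring.
Qed.

Lemma grid_coef_norm M (c : {ffun 'I_d -> 'I_M.+2} -> R) :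
  \sum_p `|grid_coef c p| <= d.+1%:R * \sum_k `|c k|.
Proof.
apply: (@le_trans _ _ (\sum_k \sum_(i < d.+1) `|c k|)).
  rewrite pair_bigA; apply: ler_sum => -[k i] _ /=.
  rewrite normrM /= ler_piMr//; case: unlift => [j|]; last by rewrite normr1.
  by rewrite normrN; apply: dC1; exact: cube_gpt.
rewrite mulr_sumr; apply: ler_sum => k _.
by rewrite sumr_const card_ord mulr_natl.
Qed.

End LimitField.

(* [measurableTypeR R], on which [normal_prob] lives, and [R] carry the same
   measurable sets under two different displays. *)
Lemma gauss_real {R : realType} (v : R) : exists nu : {finite_measure set R -> \bar R},
  (forall A : set R, nu A = gauss_prob v A) /\
  forall h : R -> R, continuous h -> (exists M, forall x, `|h x| <= M) ->
  Rintegral nu setT h = gaussT v h 0.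
Proof.
have mid : measurable_fun setT (id : measurableTypeR R -> R) by exact: measurable_id.
pose X : {mfun measurableTypeR R >-> R} := HB.pack (id : measurableTypeR R -> R) (@isMeasurableFun.Build _ _ _ _ (id : measurableTypeR R -> R) mid).
exists (distribution (gauss_prob v) X); split => // h ch bh.
have bhR : bmf h by split => //; exact: continuous_measurable_fun.
rewrite -(E_law (P := gauss_prob v) (Y := (id : measurableTypeR R -> R)) mid _ bhR)//.
by apply: eq_Rintegral => y _ /=; rewrite add0r.
Qed.

(** * Convergence of the statistic and normality of the limit *)

Section RankStatisticLimit.
Context {R : realType} {d : nat}.
Context {dO : measure_display} {Omega : measurableType dO}.
Variable P : probability Omega R.
Variable U : nat -> 'I_d -> Omega -> R.
Hypothesis hUmeas : forall i j, measurable_fun setT (U i j).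
Hypothesis hUind : independent_vectors P U.
Hypothesis hUid : forall (i : nat) (x : 'rV[R]_d),
     P [set w | forall j, U i j w <= x ord0 j] =
     P [set w | forall j, U 0%N j w <= x ord0 j].
Hypothesis hUunif : forall (j : 'I_d) (x : R), 0 <= x <= 1 ->
     P [set w | U 0%N j w <= x] = x%:E.
Variable C : 'rV[R]_d -> R.
Hypothesis hC : forall u, cube u ->
  (C u)%:E = P [set w | forall j, U 0%N j w <= u ord0 j].
Variable dC : 'I_d -> 'rV[R]_d -> R.
Hypothesis hdC : forall j u, cube u -> partial_deriv_cube C j u (dC j u).
Hypothesis hdCcont : forall j, {within @cube R d, continuous (dC j)}.
Variables m1 m2 : {finite_measure set (Rd R d) -> \bar R}.
Hypothesis m1supp : m1 (~` cubeRd (d:=d)) = 0%E.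
Hypothesis m2supp : m2 (~` cubeRd (d:=d)) = 0%E.
Context {dO' : measure_display} {Omega' : measurableType dO'}.
Variable P' : probability Omega' R.
Variable B : 'rV[R]_d -> Omega' -> R.
Hypothesis hB : centred_gaussian_field P' B (fun u v => C (ptmin u v) - C u * C v).
Hypothesis hBcont : forall w, {within @cube R d, continuous (fun u => B u w)}.
Notation E X := (Rintegral P setT X).
Notation E' X := (Rintegral P' setT X).
Notation pt := 'rV[R]_d.

Let Clip := C_lip hUmeas hUid hUunif hC.
Let dC1 := dC_le1 Clip hdC.
Let C01 u (cu : cube u) := C_01 hUmeas hUid hC cu.

Definition copula_field (u : pt) (w : Omega') : R :=
  B u w - \sum_(j < d) dC j u * B (only_coord u j) w.

Definition field_int (w : Omega') : R :=
  Rintegral m1 (cubeRd (d:=d)) (fun u => copula_field u w) -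
  Rintegral m2 (cubeRd (d:=d)) (fun u => copula_field u w).

Let c M (k : {ffun 'I_d -> 'I_M.+2}) : R := cell_mass m1 k - cell_mass m2 k.
Let a M := grid_coef dC (c (M := M)).
Let vM M := cov_form C (@a M) (@grid_at R d M).
(** The Riemann sum of [field_int] as a combination of values of [B], so that its law is known to be
    Gaussian with variance [vM M]. *)
Let YM M w := \sum_p @a M p * B (grid_at p) w.

Lemma copula_field_unif w : unif (fun u => copula_field u w).
Proof.
apply: unifB; first exact: unif_continuous.
apply: unif_sum => j; apply: unifM; first exact: unif_continuous.
exact: (unif_only_coord j (unif_continuous (@hBcont w))).
Qed.

Let YM_cvg w : (fun M => YM M w) @ \oo --> field_int w.
Proof.
rewrite (_ : (fun M => YM M w) = fun M =>
  \sum_(k : {ffun 'I_d -> 'I_M.+2}) cell_mass m1 k * copula_field (gpt k) w -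
  \sum_(k : {ffun 'I_d -> 'I_M.+2}) cell_mass m2 k * copula_field (gpt k) w); last first.
  apply/funext => M; rewrite /YM (grid_sumE dC (c (M := M)) (fun u => B u w)) -sumrB.
  by apply: eq_bigr => k _; rewrite mulrBl.
by apply: cvgB; apply: step_int_cvg => //; exact: copula_field_unif.
Qed.

Lemma field_int_measurable : measurable_fun setT field_int.
Proof.
apply: (measurable_fun_cvg (h := YM)) => [M|w _]; last exact: YM_cvg.
exact: (field_lin_measurable hB).
Qed.

Let vM_ge0 M : 0 <= vM M.
Proof. exact: (cov_form_ge0 hUmeas hUid hC (@a M) (@cube_grid_at R d M)). Qed.

Let E_YM M h : smoothe h -> E' (h \o YM M) = gaussT (vM M) h 0.
Proof.
move=> sh; have [ch bh] := smoothe_bmf sh.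
have bhR : bmf h by split => //; exact: continuous_measurable_fun.
have [nu [nuE nuh]] := gauss_real (vM M).
rewrite -nuh// (E_law (nu := nu) _ _ bhR)//; first exact: (field_lin_measurable hB).
move=> A mA; rewrite nuE; apply: (field_lin_law hB) => //; exact: cube_grid_at.
Qed.

Let EY_cvg h : smoothe h -> (fun M => gaussT (vM M) h 0) @ \oo --> E' (h \o field_int).
Proof.
move=> sh; have [ch [K hK]] := smoothe_bmf sh.
rewrite (_ : (fun M => _) = fun M => E' (h \o YM M)); last first.
  by apply/funext => M; rewrite E_YM.
have [] := @E_dct _ _ _ P' (fun M => h \o YM M) (h \o field_int) K => //.
- move=> M; have mh : measurable_fun setT h by exact: continuous_measurable_fun.
  exact: (measurableT_comp mh (field_lin_measurable hB (@a M) (@grid_at R d M))).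
- by move=> M w; exact: hK.
- by move=> w; exact: (cvg_comp _ _ (@YM_cvg w) (ch (field_int w))).
Qed.

Let V : R := (d.+1%:R * (fine (m1 setT) + fine (m2 setT))) ^+ 2.

Let vM_le M : vM M <= V.
Proof.
apply: (le_trans (cov_form_le C01 (@a M) (@cube_grid_at R d M))).
have s0 : 0 <= \sum_p `|@a M p| by exact: sumr_ge0.
have f1 : 0 <= fine (m1 setT) by exact: fine_ge0.
have f2 : 0 <= fine (m2 setT) by exact: fine_ge0.
rewrite /V ler_sqr ?nnegrE//; last by rewrite mulr_ge0// addr_ge0.
apply: (le_trans (grid_coef_norm dC1 _)); rewrite ler_wpM2l//.
rewrite -(cell_mass_sum m1supp M) -(cell_mass_sum m2supp M) -big_split/=.
apply: ler_sum => k _; apply: (le_trans (ler_normB _ _)).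
by rewrite !ger0_norm// cell_mass_ge0.
Qed.

(** The variances [vM] stay in [[0, V]], so they have a cluster point [v]. The whole sequence
    [gaussT (vM M) h 0] converges to the mean of [h] under the limit, and it is close to
    [gaussT v h 0] for arbitrarily large [M]; hence the two agree. *)
Lemma field_int_gaussian : exists v : R, 0 <= v /\
  forall A : set R, measurable A -> P' (field_int @^-1` A) = gauss_law v A.
Proof.
have vb M : 0 <= vM M <= V by rewrite vM_ge0 vM_le.
have [v v0 hv] := bounded_cluster vb.
exists v; split => // A mA; rewrite gauss_lawE.
have [nu [nuE nuh]] := gauss_real v; rewrite -nuE.
apply: (law_of_smooth field_int_measurable) => // h [K [L sh]].
have she : smoothe h by exists K, L.
have [ch bh] := smoothe_bmf she; rewrite nuh//.
apply/eqP; rewrite -subr_eq0 -normr_le0; apply/ler_addgt0Pr => e e0; rewrite add0r.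
pose Q : R := `|K| + `|L| * gauss_cst + 1.
have Q0 : 0 <= `|K| + `|L| * gauss_cst by rewrite addr_ge0// mulr_ge0// gauss_cst_ge0.
have Q1 : 0 < Q by rewrite ltr_wpDl.
have e2 : 0 < e / 2 by rewrite divr_gt0.
have /cvgrPdist_le/(_ _ e2)[M0 _ hM0] := EY_cvg she.
pose e' := Num.min 1 (e / 2 / Q).
have e'0 : 0 < e' by rewrite lt_min ltr01 divr_gt0.
have [M hM] := hv e' e'0 M0; rewrite le_min => /andP[h1 h2].
have p1 := hM0 M hM.
have p2 := gaussT_close sh (vM_ge0 M) v0 h1.
have p3 : (`|K| + `|L| * gauss_cst) * `|vM M - v| <= e / 2.
  apply: (@le_trans _ _ (Q * `|vM M - v|)); first by rewrite ler_wpM2r// lerDl.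
  by rewrite mulrC -ler_pdivlMr.
have {}p2 := le_trans p2 p3; have := lerD p1 p2; rewrite -splitr => p4.
apply: le_trans p4; apply: le_trans (ler_normD _ _).
by rewrite addrA subrK.
Qed.

Variable f : pt -> R.
Hypothesis hfHK : bounded_HK f.
Hypothesis hmubox : forall a b : 'rV[R]_d, cube a -> cube b ->
     (forall j, a ord0 j <= b ord0 j) ->
     (m1 (box a b) - m2 (box a b))%E = (box_delta (fhat f) [set: 'I_d]%SET a b)%:E.

Let Lin n M (m : {finite_measure set (Rd R d) -> \bar R}) w : R :=
  \sum_(k : {ffun 'I_d -> 'I_M.+2}) cell_mass m k * beta U C dC n (gpt k) w.

Let LinE n M w : \sum_p ((-1) ^+ d * @a M p) * alpha U C n (grid_at p) w =
  (-1) ^+ d * (Lin n M m1 w - Lin n M m2 w).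
Proof.
rewrite -sumrB; under eq_bigr do rewrite -mulrA; rewrite -mulr_sumr; congr (_ * _).
rewrite (grid_sumE dC (c (M := M)) (fun u => alpha U C n u w)).
by apply: eq_bigr => k _; rewrite mulrBl.
Qed.

(** Three distances: from the limit to the Gaussian law of the grid [M], from there to the
    combination of [alpha] by the central limit theorem, and from there to the statistic by the
    Lipschitz property of [h]. *)
Lemma rank_stat_cvg h : smoothe h ->
  (fun n => E (h \o rank_stat P U f n)) @ \oo --> E' (h \o field_int).
Proof.
move=> she; have [K [L sh]] := she; have [ch bh] := smoothe_bmf she.
have [Mf Mf0 fM] := bounded_on_cube hfHK.
have [N [mN N0 gN]] := good_ae hUmeas hUind (P_half hUmeas hUid hUunif hC).
apply/cvgrPdist_le => e e0.
have e4 : 0 < e / 4 by rewrite divr_gt0.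
pose Q : R := `|K| + 1.
have Q0 : 0 < Q by rewrite ltr_wpDl.
(* Three errors of this size pass through the Lipschitz constant [K <= Q]: the discretizations for
   [m1] and [m2], and the exchange of [f] for [fhat]. *)
have eQ : 0 < e / 8 / Q by rewrite !divr_gt0.
have /cvgrPdist_le/(_ _ e4)[M1 _ hM1] := EY_cvg she.
have [M2 hM2] := stat_int_approx hUmeas hUind hUid hUunif hC hdC hdCcont m1supp eQ.
have [M3 hM3] := stat_int_approx hUmeas hUind hUid hUunif hC hdC hdCcont m2supp eQ.
(* The grid is fixed before [n], since the central limit theorem is applied to one finite family of
   points. *)
pose M := maxn M1 (maxn M2 M3).
have M1M : (M1 <= M)%N by rewrite leq_max leqnn.
have M2M : (M2 <= M)%N by rewrite !leq_max leqnn orbT.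
have M3M : (M3 <= M)%N by rewrite !leq_max leqnn !orbT.
have [n2 hn2] := hM2 M M2M; have [n3 hn3] := hM3 M M3M.
have := clt_lin_alpha hUmeas hUind hUid hC (a := fun p => (-1) ^+ d * @a M p)
  (@cube_grid_at R d M) she.
rewrite (cov_formZ C) expr2 sign_sqr mul1r => clt.
have /cvgrPdist_le/(_ _ e4)[n1 _ hn1] := clt.
have e5 : 0 < e / 8 / Q / (Mf * d%:R + 1).
  by rewrite divr_gt0// ltr_wpDl// mulr_ge0.
have [n4 hn4] := inv_sqrt_small e5.
exists (maxn n1 (maxn n2 (maxn n3 n4))) => // n /= hn.
have {hn} [h1 h2 h3 h4] : [/\ (n1 <= n)%N, (n2 <= n)%N, (n3 <= n)%N & (n4 <= n)%N].
  by move: hn; rewrite !geq_max => /and4P[-> -> -> ->].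
have [n0 small] := hn4 n h4.
have := hn1 n h1; under eq_Rintegral do rewrite LinE; move=> q1.
have q2 := hM1 M M1M.
pose S := rank_stat P U f n.
pose T w := (-1) ^+ d * (Lin n M m1 w - Lin n M m2 w).
pose D1 w := `|stat_int P U m1 n w - Lin n M m1 w|.
pose D2 w := `|stat_int P U m2 n w - Lin n M m2 w|.
have bLin (m : {finite_measure set (Rd R d) -> \bar R}) : bmf (Lin n M m).
  by apply: bmf_sum => k _; apply: bmfZ; exact: beta_bmf.
have bZ (m : {finite_measure set (Rd R d) -> \bar R}) : bmf (stat_int P U m n).
  exact: stat_int_bmf.
have bD1 : bmf D1 by apply: bmf_norm; exact: bmfB.
have bD2 : bmf D2 by apply: bmf_norm; exact: bmfB.
have bS : bmf S by exact: rank_stat_sum_bmf.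
have bT : bmf T by apply: bmfZ; exact: bmfB.
have bhS : bmf (fun w => h (S w)) by apply: bmf_comp => //; have [] := bS.
have bhT : bmf (fun w => h (T w)) by apply: bmf_comp => //; have [] := bT.
pose q : R := Mf * d%:R / Num.sqrt n%:R.
have bq : bmf (fun w : Omega => q + (D1 w + D2 w)).
  by apply: bmfD; [exact: bmf_cst|exact: bmfD].
have q3 : `|E (fun w => h (T w)) - E (fun w => h (S w))| <= e / 2.
  rewrite -EB//; apply: (le_trans (normE _ (bmfB bhT bhS))).
  apply: (@le_trans _ _ (E (fun w => Q * (q + (D1 w + D2 w))))).
    apply: (leE_ae mN N0); [by apply: bmf_norm; exact: bmfB|exact: bmfZ|].
    move=> w /gN gw; have [_ hL _] := sh.
    have KQ : K <= Q by rewrite /Q (le_trans (ler_norm K))// lerDl.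
    apply: (le_trans (hL _ _)).
    apply: (@le_trans _ _ (Q * `|T w - S w|)); first by rewrite ler_wpM2r.
    rewrite ler_wpM2l// ?(ltW Q0)//.
    have := rank_stat_int hUmeas Mf0 fM m1supp m2supp hmubox mN N0 gN n0 gw.
    rewrite -/S -/q distrC; set W := _ * (_ - _) => hW.
    have -> : T w - S w = (T w - W) + (W - S w) by rewrite addrA subrK.
    apply: (le_trans (ler_normD _ _)); rewrite addrC; apply: lerD => //.
    rewrite /T /W -mulrBr normrM normrX normrN1 expr1n mul1r distrC.
    rewrite (_ : _ - _ = (stat_int P U m1 n w - Lin n M m1 w) -
      (stat_int P U m2 n w - Lin n M m2 w)); last by ring.
    exact: ler_normB.
  rewrite EZ// ED; [|exact: bmf_cst|exact: bmfD].
  rewrite ED// Ecst (fineP_setT P) mulr1.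
  have r1 : E D1 <= e / 8 / Q by exact: hn2.
  have r2 : E D2 <= e / 8 / Q by exact: hn3.
  have r3 : q <= e / 8 / Q.
    have MD : 0 < Mf * d%:R + 1 by rewrite ltr_wpDl// mulr_ge0.
    apply: (@le_trans _ _ ((Mf * d%:R + 1) * (Num.sqrt n%:R)^-1)).
      by rewrite ler_wpM2r ?invr_ge0 ?sqrtr_ge0// lerDl.
    by rewrite mulrC -ler_pdivlMr// ltW.
  apply: (@le_trans _ _ (Q * (e / 8 / Q + (e / 8 / Q + e / 8 / Q)))).
    by rewrite ler_wpM2l ?(ltW Q0)// !lerD.
  rewrite (_ : Q * _ = e / 8 + (e / 8 + e / 8)); last by field; rewrite gt_eqF.
  by have := e0; lra.
have tri (x y z t : R) : `|x - y| <= e / 4 -> `|y - z| <= e / 4 -> `|z - t| <= e / 2 ->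
    `|x - t| <= e.
  by rewrite !ler_norml => /andP[? ?] /andP[? ?] /andP[? ?]; apply/andP; split; lra.
exact: tri q2 q1 q3.
Qed.

End RankStatisticLimit.

(** * Assembly of the theorem *)

Section FiniteMeasure.
Context {d : measure_display} {T : measurableType d} {R : realType}.
Variable mu : {measure set T -> \bar R}.
Hypothesis fin_mu : (mu setT < +oo)%E.

(** The proof of finiteness is an argument so that the finite-measure instance can be found from the
    term. *)
Definition finite_copy (_ : (mu setT < +oo)%E) : set T -> \bar R := mu.

HB.instance Definition _ := isMeasure.Build _ _ _ (finite_copy fin_mu)
  (measure0 mu) (measure_ge0 mu) (@measure_semi_sigma_additive _ _ _ mu).

HB.instance Definition _ := Measure_isFinite.Build _ _ _ (finite_copy fin_mu)
  (lty_fin_num_fun fin_mu).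

Lemma finite_measureP :
  exists m : {finite_measure set T -> \bar R}, (m : {measure set T -> \bar R}) = mu.
Proof. by exists (finite_copy fin_mu : {finite_measure set T -> \bar R}); apply: eq_measure. Qed.

End FiniteMeasure.

Unset Implicit Arguments.

Theorem mainTheorem3
  (R : realType) (d : nat) (hd : (2 <= d)%N)
  (dO : measure_display) (Omega : measurableType dO) (P : probability Omega R)
  (U : nat -> 'I_d -> Omega -> R)
  (hUmeas : forall i j, measurable_fun setT (U i j))
  (hUind : independent_vectors P U)
  (hUid : forall (i : nat) (x : 'rV[R]_d),
     P [set w | forall j, U i j w <= x ord0 j] =
     P [set w | forall j, U 0%N j w <= x ord0 j])
  (hUunif : forall (j : 'I_d) (x : R), 0 <= x <= 1 ->
     P [set w | U 0%N j w <= x] = x%:E)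
  (C : 'rV[R]_d -> R)
  (hC : forall u, cube u -> (C u)%:E = P [set w | forall j, U 0%N j w <= u ord0 j])
  (dC : 'I_d -> 'rV[R]_d -> R)
  (hdC : forall j u, cube u -> partial_deriv_cube C j u (dC j u))
  (hdCcont : forall j, {within @cube R d, continuous (dC j)})
  (f : 'rV[R]_d -> R)
  (hfrc : right_cont_cube f)
  (hfHK : bounded_HK f)
  (mu1 mu2 : {measure set (Rd R d) -> \bar R})
  (hmu1fin : (mu1 setT < +oo)%E) (hmu2fin : (mu2 setT < +oo)%E)
  (hmu1supp : mu1 (~` cubeRd (d:=d)) = 0%E) (hmu2supp : mu2 (~` cubeRd (d:=d)) = 0%E)
  (hmubox : forall a b : 'rV[R]_d, cube a -> cube b ->
     (forall j, a ord0 j <= b ord0 j) ->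
     (mu1 (box a b) - mu2 (box a b))%E = (box_delta (fhat f) [set: 'I_d]%SET a b)%:E)
  (dO' : measure_display) (Omega' : measurableType dO') (P' : probability Omega' R)
  (B : 'rV[R]_d -> Omega' -> R)
  (hB : centred_gaussian_field P' B (fun u v => C (ptmin u v) - C u * C v))
  (hBcont : forall w, {within @cube R d, continuous (fun u => B u w)}) :
  let Fn := fun (n : nat) (j : 'I_d) (w : Omega) (x : R) =>
    n%:R^-1 * \sum_(i < n) (if U i j w <= x then 1 else 0) in
  let Ef := Rintegral P setT (fun w => f (\row_j U 0%N j w)) in
  let Sn := fun (n : nat) (w : Omega) =>
    (Num.sqrt n%:R)^-1 *
      \sum_(i < n) (f (\row_j Fn n j w (U i j w)) - Ef) in
  let G := fun (u : 'rV[R]_d) (w : Omega') =>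
    B u w - \sum_(j < d) dC j u * B (only_coord u j) w in
  let Y := fun w : Omega' =>
    Rintegral mu1 (cubeRd (d:=d)) (fun u => G u w)
    - Rintegral mu2 (cubeRd (d:=d)) (fun u => G u w) in
  measurable_fun setT Y /\
  cvg_distr P P' Sn Y /\
  exists v : R, 0 <= v /\
    forall A : set R, measurable A -> P' (Y @^-1` A) = gauss_law v A.
Proof.
move=> Fn Ef Sn G Y.
(* The given measures have finite mass as a hypothesis, whereas Fubini and [bmf] work with bundled
   finite measures. *)
have [m1 m1E] := finite_measureP hmu1fin; have [m2 m2E] := finite_measureP hmu2fin.
rewrite -m1E in hmu1supp hmubox; rewrite -m2E in hmu2supp hmubox.
have -> : Y = field_int dC m1 m2 B by rewrite /Y -m1E -m2E.
split; first exact: (field_int_measurable hdCcont hmu1supp hmu2supp hB hBcont).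
split.
  apply: weak_of_smooth.
  - by move=> n; have [] := rank_stat_sum_bmf P hUmeas f n.
  - exact: (field_int_measurable hdCcont hmu1supp hmu2supp hB hBcont).
  move=> h sh.
  exact: (rank_stat_cvg hUmeas hUind hUid hUunif hC hdC hdCcont hmu1supp hmu2supp hB hBcont hfHK hmubox sh).
exact: (field_int_gaussian hUmeas hUid hUunif hC hdC hdCcont hmu1supp hmu2supp hB hBcont).
Qed.
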